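(* Let $n\ge2$, and assume $r\in[1,\infty[$ and $s\in\,]n/2,n[$ satisfy $$\frac1{2r}+\frac n{2s}>1.$$ Then there exist a potential $V(t,x)\in L^r(0,1;L^s(\mathbb R^n))$ and a solution $u(t,x)\in C([0,1];L^2(\mathbb R^n))$ to the equation $$iu_t-\Delta u+V(t,x)u=0$$ such that, for all admissible pairs $(p,q)$ with $p<\infty$ and for any $0<T<1$, $$u\in L^p(0,T;L^q(\mathbb R^n))\qquad\text{but}\qquad u\notin L^p(0,1;L^q(\mathbb R^n)).$$
   Context: $L^p(a,b;L^q(\mathbb R^n))$ is the mixed space-time space with norm $\left(\int_a^b\|u(t,\cdot)\|_{L^q(\mathbb R^n)}^p\,dt\right)^{1/p}$ (essential supremum if $p=\infty$). Admissible pairs. For $n\ge2$, $(p,q)$ is admissible if $\frac1p+\frac n{2q}=\frac n4$, $p,q\in[2,\infty]$ and $(n,p,q)\ne(2,2,\infty)$. Solutions of the equation are understood in the sense of the integral equation $u(t)=e^{-it\Delta}u(0)+i\int_0^te^{-i(t-\tau)\Delta}V(\tau)u(\tau)\,d\tau$, where $e^{-it\Delta}$ is the unitary group on $L^2(\mathbb R^n)$ solving $i\partial_tu-\Delta u=0$. *)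

(* Defs.v *)
From HB Require Import structures.
From mathcomp Require Import all_boot all_order all_algebra.
From mathcomp Require Import all_classical all_reals all_analysis.
From mathcomp Require Import complex.
Set Implicit Arguments.
Unset Strict Implicit.
Unset Printing Implicit Defensive.
Import Order.TTheory GRing.Theory Num.Theory.
Import numFieldNormedType.Exports.
Import ComplexField.

Local Open Scope classical_set_scope.
Local Open Scope ring_scope.

Definition row_display : measure_display. Proof. exact. Qed.

(* R^n is 'rV[R]_n with its Borel sigma-algebra, presented as the one generated
   by the coordinates. *)
Section measurable_row.
Context (R : realType) (n : nat).

Let coord (i : 'I_n) (x : 'rV[R]_n) : measurableTypeR R := x ord0 i.

Let row_set0 : g_sigma_preimage coord set0.
Proof. exact: sigma_algebra0. Qed.

Let row_setC A : g_sigma_preimage coord A -> g_sigma_preimage coord (~` A).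
Proof. exact: sigma_algebraC. Qed.

Let row_bigcup (F : (set 'rV[R]_n)^nat) :
  (forall i, g_sigma_preimage coord (F i)) ->
  g_sigma_preimage coord (\bigcup_i (F i)).
Proof. exact: sigma_algebra_bigcup. Qed.

HB.instance Definition _ := @isMeasurable.Build row_display 'rV[R]_n
  (g_sigma_preimage coord) row_set0 row_setC row_bigcup.

Lemma measurable_coord (i : 'I_n) :
  measurable_fun [set: 'rV[R]_n] (coord i).
Proof.
move=> _ Y mY; rewrite setTI; apply: sub_sigma_algebra => /=.
rewrite -bigcup_seq/=; exists i => /=; first by rewrite mem_index_enum.
by exists Y => //; rewrite setTI.
Qed.

Lemma measurable_fun_row d (T : measurableType d) (f : T -> 'rV[R]_n) :
  (forall i, measurable_fun [set: T] (coord i \o f)) ->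
  measurable_fun [set: T] f.
Proof.
move=> mf _ A mA; rewrite setTI; move: A mA.
suff : (measurable : set (set 'rV[R]_n)) `<=`
    [set A | measurable (f @^-1` A)] by [].
apply: smallest_sub.
  split => [|A mA|F mF] /=.
  - by rewrite preimage_set0.
  - by rewrite setTD preimage_setC; exact: measurableC.
  - by rewrite preimage_bigcup; apply: bigcupT_measurable => k; exact: mF.
move=> B; rewrite -bigcup_seq => -[i _ [C mC <-]] /=.
by rewrite setTI -[X in measurable X]setTI; exact: mf.
Qed.

End measurable_row.

Section lebesgue_cons.
Context (R : realType) (n : nat).
Local Open Scope ereal_scope.

Definition row_cons (p : measurableTypeR R * 'rV[R]_n) : 'rV[R]_n.+1 :=
  @row_mx R 1%N 1%N n (p.1 : R)%:M%R p.2.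

Lemma measurable_row_cons : measurable_fun setT row_cons.
Proof.
apply: measurable_fun_row => i /=.
rewrite [X in measurable_fun _ X](_ : _ = fun p : measurableTypeR R * 'rV[R]_n =>
    match @fintype.split 1%N n i with inl _ => p.1 | inr k => p.2 ord0 k end); last first.
  apply/funext => p /=; rewrite /row_cons mxE.
  by case: (fintype.split _) => k //; rewrite mxE !ord1 eqxx mulr1n.
case: (fintype.split _) => k.
  exact: measurable_fst.
by apply: (measurableT_comp (@measurable_coord R n k)); exact: measurable_snd.
Qed.

Let behead_row (x : 'rV[R]_n.+1) : measurableTypeR R * 'rV[R]_n :=
  (x ord0 ord0, \row_j x ord0 (lift ord0 j)).

Let measurable_behead : measurable_fun setT behead_row.
Proof.
apply/measurable_fun_pairP; split => /=.
  exact: (@measurable_coord R n.+1 ord0).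
apply: measurable_fun_row => i /=.
rewrite [X in measurable_fun _ X](_ : _ =
    fun x : 'rV[R]_n.+1 => x ord0 (lift ord0 i)); last first.
  by apply/funext => x /=; rewrite mxE.
exact: (@measurable_coord R n.+1 (lift ord0 i)).
Qed.

Variable mu : {sigma_finite_measure set 'rV[R]_n -> \bar R}.

Definition lebesgue_cons : set 'rV[R]_n.+1 -> \bar R :=
  pushforward (@lebesgue_measure R \x mu) row_cons.


Let lebesgue_cons0 : lebesgue_cons set0 = 0.
Proof. by rewrite /lebesgue_cons /pushforward preimage_set0 measure0. Qed.

Let lebesgue_cons_ge0 A : 0 <= lebesgue_cons A.
Proof. by rewrite /lebesgue_cons /pushforward; exact: measure_ge0. Qed.

Let lebesgue_cons_additive : semi_sigma_additive lebesgue_cons.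
Proof.
have [m mE] : exists m : {measure set 'rV[R]_n.+1 -> \bar R},
    m = lebesgue_cons :> (set _ -> _).
  by exists (measure_function_pushforward__canonical__measure_function_Measure
    (@lebesgue_measure R \x mu) measurable_row_cons).
by rewrite -mE; exact: measure_semi_sigma_additive.
Qed.

HB.instance Definition _ := isMeasure.Build _ _ _ lebesgue_cons
  lebesgue_cons0 lebesgue_cons_ge0 lebesgue_cons_additive.

Let lebesgue_cons_sigma_finite : sigma_finite setT lebesgue_cons.
Proof.
have /sigma_finiteP[F [FT ndF Foo]] := sigma_finiteT (@lebesgue_measure R).
have /sigma_finiteP[G [GT ndG Goo]] := sigma_finiteT mu.
exists (fun k => behead_row @^-1` (F k `*` G k)).
  rewrite -preimage_bigcup -(@preimage_setT _ _ behead_row); congr (_ @^-1` _).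
  rewrite -setXTT FT GT predeqE => -[x y]; split.
    move=> [/= [k _ Fkx] [l _ Gly]]; exists (maxn k l) => //; split.
    - by move: x Fkx; exact/subsetPset/ndF/leq_maxl.
    - by move: y Gly; exact/subsetPset/ndG/leq_maxr.
  by move=> [k _ []/= ? ?]; split; exists k.
move=> k; have [mF Fk] := Foo k; have [mG Gk] := Goo k; split.
  by rewrite -[X in measurable X]setTI; apply: measurable_behead => //;
    exact: measurableX.
rewrite /lebesgue_cons /pushforward -comp_preimage.
rewrite (_ : behead_row \o row_cons = id) ?preimage_id.
  by rewrite product_measure1E// lte_mul_pinfty// ge0_fin_numE.
apply/funext => -[a v] /=; congr pair.
  rewrite /row_cons mxE; case: fintype.splitP => [j _|//].
  by rewrite mxE !ord1 eqxx mulr1n.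
apply/rowP => j; rewrite !mxE.
case: fintype.splitP => [i /=|i /=]; first by rewrite ord1.
by rewrite add1n => -[ji]; congr (v _ _); apply/val_inj.
Qed.

HB.instance Definition _ := Measure_isSigmaFinite.Build _ _ _ lebesgue_cons
  lebesgue_cons_sigma_finite.

End lebesgue_cons.

Fixpoint lebesgue_row (R : realType) (n : nat) :
    {sigma_finite_measure set 'rV[R]_n -> \bar R} :=
  match n with
  | 0 => [the {sigma_finite_measure set 'rV[R]_0 -> \bar R}
           of dirac (0 : 'rV[R]_0)]
  | m.+1 => [the {sigma_finite_measure set 'rV[R]_m.+1 -> \bar R}
              of lebesgue_cons (lebesgue_row R m)]
  end.

Section complex_valued.
Context (R : realType).
Implicit Type z : R[i].

Definition modulus z : R := Normc.normc z.

Definition cmeasurable d (T : measurableType d) (D : set T) (f : T -> R[i]) :=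
  measurable_fun D (fun x => complex.Re (f x)) /\
  measurable_fun D (fun x => complex.Im (f x)).

Definition cintegral d (T : measurableType d)
    (mu : {measure set T -> \bar R}) (D : set T) (f : T -> R[i]) : R[i] :=
  Complex (\int[mu]_(x in D) complex.Re (f x))
          (\int[mu]_(x in D) complex.Im (f x)).

Definition cis_derive (F : R -> R[i]) (t : R) (l : R[i]) :=
  is_derive t 1 (fun s => complex.Re (F s)) (complex.Re l) /\
  is_derive t 1 (fun s => complex.Im (F s)) (complex.Im l).

End complex_valued.

Section test_functions.
Context (R : realType) (n : nat).
Implicit Types (phi : 'rV[R]_n -> R) (s : seq 'I_n).

Definition partial (i : 'I_n) phi : 'rV[R]_n -> R :=
  fun x => 'D_(delta_mx ord0 i) phi x.

Definition iter_partial s phi : 'rV[R]_n -> R := foldr partial phi s.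

Definition smooth phi :=
  forall s, continuous (iter_partial s phi) /\
    forall i x, derivable (iter_partial s phi) x (delta_mx ord0 i).

Definition test_function phi :=
  smooth phi /\ compact (closure [set x | phi x != 0]).

Definition laplacian phi : 'rV[R]_n -> R :=
  fun x => \sum_(i < n) partial i (partial i phi) x.

End test_functions.

Section lebesgue_spaces.
Context (R : realType) (n : nat).
Local Open Scope ereal_scope.
Local Notation fct := ('rV[R]_n -> R[i]).

Definition Lq_norm (q : \bar R) (f : fct) : \bar R :=
  Lnorm (lebesgue_row R n) q (fun x => (modulus (f x))%:E).

Definition in_Lq (q : \bar R) (f : fct) :=
  cmeasurable setT f /\ Lq_norm q f < +oo.

Definition LpLq_norm (a b : R) (p q : \bar R) (u : R -> fct) : \bar R :=
  Lnorm (mrestr (@lebesgue_measure R) (measurable_itv `]a, b[)) p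
    (fun t => Lq_norm q (u t)).

Definition in_LpLq (a b : R) (p q : \bar R) (u : R -> fct) :=
  @cmeasurable R _ (measurableTypeR R * 'rV[R]_n)%type (`]a, b[ `*` setT)
    (fun z => u z.1 z.2) /\
  LpLq_norm a b p q u < +oo.

Definition in_C_L2 (D : set R) (u : R -> fct) :=
  (forall t, D t -> in_Lq 2%:E (u t)) /\
  (forall t, D t ->
    (fun s => Lq_norm 2%:E (fun x => u s x - u t x)%R) @ within D (nbhs t)
      --> 0).

Definition dot_L2 (f g : fct) : R[i] :=
  cintegral (lebesgue_row R n) setT (fun x => f x * conjc (g x))%R.

(* Bochner integral of an L^2-valued function: the space being separable, weak
   measurability is strong measurability, and the integral is determined by its
   scalar products. *)
Definition is_L2_integral (D : set R) (F : R -> fct) (I : fct) :=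
  [/\ {ae @lebesgue_measure R, forall t, D t -> in_Lq 2%:E (F t)},
      forall g, in_Lq 2%:E g ->
        @cmeasurable R _ (measurableTypeR R) D (fun t => dot_L2 (F t) g),
      \int[@lebesgue_measure R]_(t in D) Lq_norm 2%:E (F t) < +oo,
      in_Lq 2%:E I &
      forall g, in_Lq 2%:E g ->
        dot_L2 I g =
        cintegral (@lebesgue_measure R) D (fun t => dot_L2 (F t) g)].

End lebesgue_spaces.

Section schrodinger.
Context (R : realType) (n : nat).
Local Notation fct := ('rV[R]_n -> R[i]).
Local Notation "f =ae g" :=
  {ae lebesgue_row R n, forall x, f x = g x} (at level 70).

(* [U t] is e^{-it Delta}. It acts on functions rather than on classes modulo
   equality almost everywhere; its values outside L^2 are irrelevant. The last
   field is i d/dt U(t)f - Delta U(t)f = 0 tested, in x, against C_c^oo. *)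
Record is_schrodinger_group (U : R -> fct -> fct) : Prop := {
  group_L2 : forall t f, in_Lq 2%:E f -> in_Lq 2%:E (U t f) ;
  group_linear : forall t (a : R[i]) f g, in_Lq 2%:E f -> in_Lq 2%:E g ->
    U t (fun x => a * f x + g x) =ae (fun x => a * U t f x + U t g x) ;
  group_unitary : forall t f g, in_Lq 2%:E f -> in_Lq 2%:E g ->
    dot_L2 (U t f) (U t g) = dot_L2 f g ;
  group0 : forall f, in_Lq 2%:E f -> U 0 f =ae f ;
  groupD : forall s t f, in_Lq 2%:E f -> U (s + t) f =ae U s (U t f) ;
  group_continuous : forall f, in_Lq 2%:E f -> in_C_L2 setT (U ^~ f) ;
  group_solves : forall f phi, in_Lq 2%:E f -> test_function phi ->
    forall t, exists2 l : R[i],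
      cis_derive (fun s => cintegral (lebesgue_row R n) setT
        (fun x => U s f x * (phi x)%:C%C)) t l &
      'i%C * l - cintegral (lebesgue_row R n) setT
        (fun x => U t f x * (laplacian phi x)%:C%C) = 0
}.

(* [G] is the Duhamel integral of e^{-i(t-tau) Delta} F(tau) over [0, t]: a
   Bochner integral in L^2, possibly improper at the upper end point. If this
   holds for all t in [0, 1], the integral is a genuine Bochner integral for
   t < 1. Absolute convergence cannot be required up to t = 1: by the
   inhomogeneous Strichartz estimate, it would put u in all the spaces
   L^p(0,1;L^q). *)
Definition is_duhamel (U : R -> fct -> fct) (F : R -> fct) (t : R) (G : fct) :=
  exists J : R -> fct,
    (forall s, s < t -> is_L2_integral `]0, s[ (fun tau => U (t - tau) (F tau))
      (J s)) /\
    in_Lq 2%:E G /\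
    (fun s => Lq_norm 2%:E (fun x => J s x - G x)) @ t^'- --> 0%E.

Definition mild_solution (U : R -> fct -> fct) (V u : R -> fct) :=
  let F : R -> fct := fun tau x => V tau x * u tau x in
  {ae @lebesgue_measure R, forall tau, tau \in `]0, 1[ -> in_Lq 2%:E (F tau)} /\
  forall t, t \in `[0, 1] ->
    exists2 G, is_duhamel U F t G &
      u t =ae (fun x => U t (u 0) x + 'i%C * G x).

Definition admissible (p q : \bar R) :=
  [/\ (p^-1 + (n%:R / 2)%:E * q^-1 = (n%:R / 4)%:E)%E,
      (2%:E <= p)%E, (2%:E <= q)%E &
      ~ [/\ n = 2%N, p = 2%:E & q = +oo%E]].

End schrodinger.

(* Main.v *)
Require Import Defs.
From mathcomp Require Import all_boot all_order all_algebra.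
From mathcomp Require Import all_classical all_reals all_analysis.
From mathcomp Require Import measurable_realfun complex ring lra.
Set Implicit Arguments.
Unset Strict Implicit.
Unset Printing Implicit Defensive.
Import Order.TTheory GRing.Theory Num.Theory.
Import numFieldNormedType.Exports.
Local Open Scope classical_set_scope.
Local Open Scope ring_scope.

(** The equation is solved backwards: choose [u], and let [V] be whatever makes
    it a solution. With [rho = (1 - t)^2 + |x|^2], take the positive function
<<
      u(t, x) = rho^(- n / 4) / (16 + (ln rho)^2),
      V = (Delta u - i d_t u) / u.
>>
    It is smooth for [t < 1] and concentrates at the origin at time 1. Up to a
    factor that varies slowly, [u] is a power of [rho], and so its logarithmic
    derivatives are bounded by powers of [rho]; as [d_t rho] and [x] are at most
    of the order of 1 and of the square root of [rho], this gives
    [|V| <= C / rho] ([potential_le]).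

    The size of [V]. By scaling, the [L^s] norm of [1 / rho] is a multiple of
    [(1 - t)^(n / s - 2)], and its power [r] is integrable on [0, 1] if and only
    if [r (2 - n / s) < 1], which is the hypothesis on [r] and [s]
    ([potential_in_LrLs]).

    The size of [u]. The power [- n / 4] is critical for [L^2]: the square of
    [rho^(- n / 4)] just fails to be integrable at time 1, and the logarithm
    repairs it, since [1 / (l (ln l)^4)] is integrable at 0 and at infinity
    ([profile_L2_bound]). As [u(t)] increases to [u(1)], this function dominates
    the whole curve, which is therefore continuous in [L^2]. For [t <= T < 1]
    the function [u(t)] is below [u(T)], which is bounded and in [L^2]; hence
    [u] has finite norms on [0, T]. On the other hand, on the cube of side
    [2 (1 - t)] the function [u] is at least of the order of
    [(1 - t)^(- n / 2)], up to a logarithm, so that for an admissible pair the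
    [L^q] norm is at least of the order of [(1 - t)^(- 2 / p)], up to a
    logarithm. Its power [p] is not integrable: there is room for the loss of a
    factor [(1 - t)^(1 / p)], far more than the logarithm needs
    ([solution_norm_ge]).

    The integral equation. For [g] in [L^2], the scalar product of
    [U(t - tau) u(tau)] and [g] equals that of [u(tau)] and [U(tau - t) g], and
    has derivative [i] times the scalar product of [U(t - tau) (V u)(tau)] and
    [g]: the Duhamel formula on [0, s], for [s < 1], is the fundamental theorem of
    calculus ([integral_dot_source]), and the one on [0, 1] follows by continuity
    in [L^2]. The group is only known to solve the free equation when tested
    against smooth functions with compact support. This suffices because
    [u(tau)] is the limit of the truncations [truncated], which are dominated,
    together with their Laplacians, by a multiple of [u(tau)]
    ([truncated_bounded], [group_derivative]). *)

(** * Derivatives and measurability *)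

Section pointwise_derivatives.
Context (R : realType) (V : normedModType R).
Implicit Types (f g : V -> R) (x v : V).

(** The rules of differentiation for functions given by formulas in their
    argument, rather than by operations on functions: derivatives of explicit
    expressions are then assembled as terms, without rewriting. *)
Lemma is_derive_fun_cst (c : R) x v : is_derive x v (fun _ => c) 0.
Proof. exact: is_derive_cst. Qed.

Lemma is_derive_fun_add f g x v a b : is_derive x v f a -> is_derive x v g b ->
  is_derive x v (fun y => f y + g y) (a + b).
Proof. exact: is_deriveD. Qed.

Lemma is_derive_fun_mul f g x v a b : is_derive x v f a -> is_derive x v g b ->
  is_derive x v (fun y => f y * g y) (a * g x + f x * b).
Proof.
move=> fa gb; rewrite addrC [a * _]mulrC; exact: (is_deriveM fa gb).
Qed.

Lemma is_derive_fun_inv f x v a : f x != 0 -> is_derive x v f a ->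
  is_derive x v (fun y => (f y)^-1) (- (a / f x ^+ 2)).
Proof.
move=> fx [df <-]; apply: DeriveDef; first exact: derivableV.
by rewrite deriveV// /GRing.scale/= mulNr mulrC.
Qed.

(** A directional derivative is a derivative in one variable, for which the
    chain rule is available. *)
Lemma is_derive_line f x v a : is_derive x v f a <->
  is_derive (0 : R) (1 : R) (fun h => f (h *: v + x)) a.
Proof.
have E : 'D_v f x = 'D_1 (fun h : R => f (h *: v + x)) 0.
  rewrite /derive; congr (lim (_ @ 0^')); apply/funext => h /=.
  by rewrite addr0 scale0r add0r [_%:A]mulr1.
split=> -[df <-]; apply: DeriveDef.
- exact: (derivable1P f x v).1.
- by rewrite E.
- exact: (derivable1P f x v).2.
- by rewrite E.
Qed.

Lemma is_derive_fun_comp (h : R -> R) f x v a b : is_derive (f x) 1 h b ->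
  is_derive x v f a -> is_derive x v (fun y => h (f y)) (b * a).
Proof.
move=> hb /is_derive_line fa; apply/is_derive_line.
by apply: (is_derive1_comp (f := h)); rewrite ?scale0r ?add0r.
Qed.

End pointwise_derivatives.

Section real_derivatives.
Context (R : realType).
Implicit Types (f g : R -> R) (x : R).

Lemma is_derive_fun_id x : is_derive x 1 (fun y : R => y) 1.
Proof. exact: is_derive_id. Qed.

Lemma is_derive_continuous f x a : is_derive x 1 f a -> {for x, continuous f}.
Proof.
move=> fa; apply: differentiable_continuous; apply/derivable1_diffP.
exact: ex_derive.
Qed.

(** The end points come in either order, so that difference quotients can be
    estimated from both sides at once. *)
Lemma MVT_le f (df : R -> R) x y (M : R) :
    (forall z, (x <= z <= y) || (y <= z <= x) -> is_derive z 1 f (df z)) ->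
    (forall z, (x <= z <= y) || (y <= z <= x) -> `|df z| <= M) ->
  `|f y - f x| <= M * `|y - x|.
Proof.
wlog xy : x y / x <= y => [W|] dfE dfM.
  have [xy|/ltW yx] := leP x y; first exact: W.
  by rewrite distrC [`|y - x|]distrC; apply: W => // z; rewrite orbC => ?;
    [exact: dfE|exact: dfM].
have h z : x <= z <= y -> (x <= z <= y) || (y <= z <= x) by move=> ->.
have [||c cxy ->] := @MVT_segment R f df x y xy.
- move=> z; rewrite in_itv/= => /andP[xz zy]; apply: dfE; apply: h.
  by rewrite (ltW xz) (ltW zy).
- apply: continuous_in_subspaceT => z /set_mem/=; rewrite in_itv/= => xzy.
  exact: is_derive_continuous (dfE _ (h _ xzy)).
- by rewrite normrM ler_wpM2r//; apply/dfM/h; move: cxy; rewrite in_itv.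
Qed.

Lemma is_derive_nonincreasing f (df : R -> R) x y :
    x <= y ->
    (forall z, x <= z <= y -> is_derive z 1 f (df z)) ->
    (forall z, x <= z <= y -> df z <= 0) ->
  f y <= f x.
Proof.
move=> xy dfE df0; have [||c cxy e] := @MVT_segment R f df x y xy.
- move=> z; rewrite in_itv/= => /andP[xz zy]; apply: dfE.
  by rewrite (ltW xz) (ltW zy).
- apply: continuous_in_subspaceT => z /set_mem/=; rewrite in_itv/= => xzy.
  exact: is_derive_continuous (dfE _ xzy).
- rewrite -subr_le0 e mulr_le0_ge0 ?subr_ge0//.
  by apply: df0; move: cxy; rewrite in_itv.
Qed.

End real_derivatives.

Section measurability.
Context d (T : measurableType d) (R : realType).

Lemma measurable_fun_invr (D : set T) (f : T -> R) :
  measurable_fun D f -> measurable_fun D (fun x => (f x)^-1).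
Proof.
move=> mf.
(* a real power is measurable, and y * (y ^ 2)^-1 is y^-1 also for y = 0 *)
rewrite (_ : (fun _ => _) = fun x => f x * (f x ^+ 2) `^ (-1)).
  apply: measurable_funM => //.
  apply: (@measurableT_comp _ _ _ _ _ _ (fun x : R => x `^ (-1))) => //.
  exact: measurable_funX.
apply/funext => x; rewrite powR_inv1 ?sqr_ge0//.
by have [->|fx0] := eqVneq (f x) 0; [rewrite invr0 mul0r|field].
Qed.

End measurability.

(** * The measure of cubes *)

Section sets_of_rows.
Context (R : realType).

Definition sqnorm n (x : 'rV[R]_n) : R := \sum_i x ord0 i ^+ 2.

Definition cube n (a : R) : set 'rV[R]_n := [set x | forall i, `|x ord0 i| <= a].

Lemma sqnorm_ge0 n (x : 'rV[R]_n) : 0 <= sqnorm x.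
Proof. by apply: sumr_ge0 => i _; exact: sqr_ge0. Qed.

Lemma coord_le_sqnorm n (x : 'rV[R]_n) i : x ord0 i ^+ 2 <= sqnorm x.
Proof.
rewrite /sqnorm (bigD1 i)//= lerDl; apply: sumr_ge0 => j _; exact: sqr_ge0.
Qed.

Lemma sqnorm_eq0 n (x : 'rV[R]_n) : sqnorm x = 0 -> x = 0.
Proof.
move=> x0; apply/rowP => i; rewrite mxE; apply/eqP.
by rewrite -sqrf_eq0 eq_le sqr_ge0 andbT -x0 coord_le_sqnorm.
Qed.

Lemma sqnorm_cube n a (x : 'rV[R]_n) : cube a x -> sqnorm x <= n%:R * a ^+ 2.
Proof.
move=> xa; rewrite mulr_natl -[X in _ *+ X]card_ord -sumr_const.
apply: ler_sum => i _; rewrite -(real_normK (num_real _)).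
by rewrite ler_pXn2r ?nnegrE// (le_trans _ (xa i)).
Qed.

Lemma measurable_coordR n (i : 'I_n) :
  measurable_fun setT (fun x : 'rV[R]_n => x ord0 i : measurableTypeR R).
Proof. exact: measurable_coord. Qed.

Lemma measurable_sqnorm n : measurable_fun setT (@sqnorm n).
Proof.
apply: measurable_sum => i; apply: measurable_funX; exact: measurable_coordR.
Qed.

Lemma measurable_cube n a : measurable (@cube n a).
Proof.
rewrite (_ : cube a = \big[setI/setT]_(i < n)
    ((fun x : 'rV[R]_n => x ord0 i) @^-1` [set` `[-a, a]])); last first.
  apply/seteqP; split=> x /=.
    move=> xa; rewrite -bigcap_seq => i _ /=.
    by rewrite in_itv/= -ler_norml; exact: xa.
  rewrite -bigcap_seq => xa i; have := xa i (mem_index_enum i).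
  by rewrite /= in_itv/= -ler_norml.
apply: bigsetI_measurable => i _.
by rewrite -[X in measurable X]setTI; exact: measurable_coordR.
Qed.

(** Prepending a coordinate, by which the measure is built, turns a cube into the
    product of a segment and of a cube. *)
Lemma lebesgue_row_cube n (a : R) : 0 <= a ->
  lebesgue_row R n (cube a) = ((2 * a) ^+ n)%:E.
Proof.
move=> a0; elim: n => [|n IH].
  by rewrite /= diracE mem_set// => -[].
rewrite /= /lebesgue_cons /pushforward.
rewrite (_ : _ @^-1` _ = [set` `[-a, a]] `*` cube a); last first.
  apply/seteqP; split=> -[b v] /=.
    move=> bv; split=> [|i]/=.
      have := bv ord0; rewrite /row_cons mxE.
      case: fintype.splitP => [j _|//].
      by rewrite mxE !ord1 eqxx mulr1n in_itv/= -ler_norml.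
    have := bv (rshift 1%N i); rewrite /row_cons.
    by rewrite (row_mxEr (b%:M) v).
  move=> [ba va] i; rewrite /row_cons mxE.
  case: fintype.splitP => [j _|j _]; last exact: va.
  by rewrite mxE !ord1 eqxx mulr1n ler_norml; move: ba; rewrite in_itv.
rewrite product_measure1E//=; last exact: measurable_cube.
rewrite lebesgue_measure_itv/= lte_fin.
case: ltrP => [aa|aa]; last first.
  have -> : a = 0 by lra.
  by rewrite mul0e mulr0 expr0n.
transitivity (((2 * a)%:E * ((2 * a) ^+ n)%:E)%E).
  congr (_ * _)%E; last exact: IH.
  by rewrite -EFinD; congr EFin; ring.
by rewrite -EFinM exprS.
Qed.

Lemma lebesgue_row_le_cube n (a : R) (A : set 'rV[R]_n) : 0 <= a ->
  measurable A -> A `<=` cube a -> (lebesgue_row R n A <= ((2 * a) ^+ n)%:E)%E.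
Proof.
move=> a0 mA Aa; rewrite -lebesgue_row_cube//.
by apply: le_measure => //; rewrite inE//; exact: measurable_cube.
Qed.

Lemma lebesgue_row_set0 n : (0 < n)%N -> lebesgue_row R n [set x | sqnorm x = 0] = 0.
Proof.
move=> n0; apply/eqP; rewrite eq_le measure_ge0 andbT.
have -> : [set x | sqnorm x = 0] = @sqnorm n @^-1` [set 0] :> set 'rV[R]_n by [].
apply: le_trans (lebesgue_row_le_cube (lexx 0) _ _) _.
- by rewrite -[X in measurable X]setTI; exact: measurable_sqnorm.
- by move=> x /= /sqnorm_eq0 -> i; rewrite mxE normr0.
- by rewrite mulr0 expr0n gtn_eqF.
Qed.

End sets_of_rows.

(** * Integrals of derivatives of monotone functions *)

Section half_line_integrals.
Context (R : realType).
Local Notation mu := (@lebesgue_measure R).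
Implicit Types (F G : R -> R) (a b : R).

Lemma FTC2_is_derive F G a b : a < b ->
    (forall x : R, a <= x <= b -> is_derive x 1 F (G x)) ->
    (forall x : R, a <= x <= b -> {for x, continuous G}) ->
  (\int[mu]_(x in `[a, b]) (G x)%:E = (F b - F a)%:E)%E.
Proof.
move=> ab dF cG.
have cF x : a <= x <= b -> {for x, continuous F}.
  move=> /dF dFx; apply: differentiable_continuous.
  by apply/derivable1_diffP; exact: ex_derive.
rewrite EFinB; apply: (@continuous_FTC2 _ G F a b ab).
- by apply: continuous_in_subspaceT => x /set_mem/=; rewrite in_itv/=; exact: cG.
- split.
  + move=> x; rewrite in_itv/= => /andP[ax xb].
    by have := dF x; rewrite (ltW ax) (ltW xb) => /(_ isT) dFx; exact: ex_derive.
  + by apply: cvg_at_right_filter; apply: cF; rewrite lexx ltW.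
  + by apply: cvg_at_left_filter; apply: cF; rewrite lexx ltW.
- move=> x; rewrite in_itv/= => /andP[ax xb].
  rewrite derive1E; have := dF x; rewrite (ltW ax) (ltW xb) => /(_ isT) dFx.
  exact: derive_val.
Qed.

Lemma integral_exhaustion_le d (T : measurableType d)
    (nu : {measure set T -> \bar R}) (A : (set T)^nat) (f : T -> \bar R) (M : \bar R) :
    nondecreasing_seq A -> (forall k, measurable (A k)) ->
    measurable_fun (\bigcup_k A k) f ->
    (forall x, (\bigcup_k A k) x -> 0 <= f x)%E ->
    (forall k, \int[nu]_(x in A k) f x <= M)%E ->
  (\int[nu]_(x in \bigcup_k A k) f x <= M)%E.
Proof.
move=> ndA mA mf f0 fM.
have mU : measurable (\bigcup_k A k) by exact: bigcupT_measurable.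
have mfk k : measurable_fun (A k) f.
  by apply: measurable_funS mf => //; exact: bigcup_sup.
have f0k k x : A k x -> (0 <= f x)%E by move=> Akx; apply: f0; exists k.
have cv := @ge0_nondecreasing_set_cvg_integral _ _ _ A f nu ndA mA mfk f0k.
rewrite -(cvg_lim _ cv)//; apply: lime_le; first by apply/cvg_ex; eexists; exact: cv.
by apply: nearW => k; exact: fM.
Qed.

(** A bound on the increments of the primitive is enough when the derivative is
    nonnegative; the primitive need not have limits at the end points. *)
Lemma integral_exhaustion_FTC_le F G (a b : nat -> R) (M : R) :
    (forall k, a k < b k) ->
    (forall k l, (k <= l)%N -> a l <= a k) ->
    (forall k l, (k <= l)%N -> b k <= b l) ->
    (forall k x, a k <= x <= b k -> is_derive x 1 F (G x)) ->
    (forall k x, a k <= x <= b k -> {for x, continuous G}) ->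
    (forall k x, a k <= x <= b k -> 0 <= G x) ->
    measurable_fun setT G ->
    (forall k, F (b k) - F (a k) <= M) ->
  (\int[mu]_(x in \bigcup_k `[a k, b k]%classic) (G x)%:E <= M%:E)%E.
Proof.
move=> ab ai bi dF cG G0 mG FM; apply: integral_exhaustion_le => //.
- move=> k l kl; apply/subsetPset => x /=; rewrite !in_itv/= => /andP[ax xb].
  by rewrite (le_trans (ai _ _ kl))// (le_trans xb)// bi.
- by apply: measurable_funTS; apply/measurable_EFinP.
- by move=> x [k _] /=; rewrite in_itv/= lee_fin; exact: G0.
- move=> k; rewrite (FTC2_is_derive (ab k)) ?lee_fin//.
  by move=> x; exact: cG.
Qed.

Let invn_le k l : (k <= l)%N -> l.+2%:R^-1 <= k.+2%:R^-1 :> R.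
Proof. by move=> kl; rewrite lef_pV2 ?posrE// ler_nat. Qed.

Let expand k : k.+2%:R^-1 < 1 :> R.
Proof. by rewrite invf_lt1 ?ltr1n. Qed.

Lemma itv_oy_bigcup :
  \bigcup_k `[k.+2%:R^-1, k.+2%:R]%classic = `]0, +oo[%classic :> set R.
Proof.
apply/seteqP; split=> x /=.
  move=> [k _] /=; rewrite !in_itv/= andbT => /andP[kx _].
  by rewrite (lt_le_trans _ kx).
rewrite in_itv/= andbT => x0; pose m := Num.trunc (Num.max x x^-1).
have mx : Num.max x x^-1 < m.+1%:R by rewrite truncnS_gt.
have {}mx : x < m.+2%:R /\ x^-1 < m.+2%:R.
  by move: mx; rewrite gt_max => /andP[h1 h2]; split;
    [apply: lt_le_trans h1 _|apply: lt_le_trans h2 _]; rewrite ler_nat.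
exists m => //=; rewrite in_itv/= (ltW mx.1) andbT -[leRHS]invrK.
by rewrite lef_pV2 ?posrE ?invr_gt0// ltW// mx.2.
Qed.

Lemma itv_oo01_bigcup :
  \bigcup_k `[k.+3%:R^-1, 1 - k.+3%:R^-1]%classic = `]0, 1[%classic :> set R.
Proof.
apply/seteqP; split=> x /=.
  move=> [k _] /=; rewrite !in_itv/= => /andP[kx xk].
  have k0 : 0 < k.+3%:R^-1 :> R by rewrite invr_gt0.
  by rewrite (lt_le_trans k0 kx) (le_lt_trans xk)// gtrDl oppr_lt0.
rewrite in_itv/= => /andP[x0 x1]; pose y := Num.max x^-1 (1 - x)^-1.
have my : y < (Num.trunc y).+1%:R by rewrite truncnS_gt.
have : x^-1 < (Num.trunc y).+3%:R /\ (1 - x)^-1 < (Num.trunc y).+3%:R.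
  by move: my; rewrite {1}/y gt_max => /andP[h1 h2]; split;
    [apply: lt_le_trans h1 _|apply: lt_le_trans h2 _]; rewrite ler_nat 2?ltnW.
move: (Num.trunc y) => m [h1 h2]; exists m => //=; rewrite in_itv/=.
have x10 : 0 < 1 - x by rewrite subr_gt0.
have -> /= : m.+3%:R^-1 <= x.
  by rewrite -[leRHS]invrK lef_pV2 ?posrE ?invr_gt0// ltW.
rewrite lerBrDr -lerBrDl -[leRHS]invrK lef_pV2 ?posrE ?invr_gt0//.
exact: ltW.
Qed.

Lemma integral_oy_FTC_le F G (M : R) :
    (forall x : R, 0 < x -> is_derive x 1 F (G x)) ->
    (forall x : R, 0 < x -> {for x, continuous G}) ->
    (forall x : R, 0 < x -> 0 <= G x) ->
    measurable_fun setT G ->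
    (forall x y : R, 0 < x -> x < y -> F y - F x <= M) ->
  (\int[mu]_(x in `]0%R, +oo[) (G x)%:E <= M%:E)%E.
Proof.
move=> dF cG G0 mG FM; rewrite -itv_oy_bigcup.
have p k (x : R) : k.+2%:R^-1 <= x <= k.+2%:R -> 0 < x.
  by move=> /andP[kx _]; exact: lt_le_trans kx.
have q k : k.+2%:R^-1 < k.+2%:R :> R by rewrite (lt_trans (expand k))// ltr1n.
apply: integral_exhaustion_FTC_le => //.
- by move=> k l kl; rewrite ler_nat.
- by move=> k x /p; exact: dF.
- by move=> k x /p; exact: cG.
- by move=> k x /p; exact: G0.
- by move=> k; apply: FM.
Qed.

Lemma integral_oo01_FTC_le F G (M : R) :
    (forall x : R, 0 < x < 1 -> is_derive x 1 F (G x)) ->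
    (forall x : R, 0 < x < 1 -> {for x, continuous G}) ->
    (forall x : R, 0 < x < 1 -> 0 <= G x) ->
    measurable_fun setT G ->
    (forall x y : R, 0 < x -> x < y -> y < 1 -> F y - F x <= M) ->
  (\int[mu]_(x in `]0%R, 1%R[) (G x)%:E <= M%:E)%E.
Proof.
move=> dF cG G0 mG FM; rewrite -itv_oo01_bigcup.
have r k : 1 - k.+3%:R^-1 < 1 :> R by rewrite ltrBlDr ltrDl invr_gt0.
have p k (x : R) : k.+3%:R^-1 <= x <= 1 - k.+3%:R^-1 -> 0 < x < 1.
  by move=> /andP[kx xk]; rewrite (lt_le_trans _ kx)//= (le_lt_trans xk).
have q k : k.+3%:R^-1 < 1 - k.+3%:R^-1 :> R.
  have : k.+3%:R^-1 <= 3^-1 :> R by rewrite lef_pV2 ?posrE// ler_nat.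
  by move: (k.+3%:R^-1) => z; lra.
apply: integral_exhaustion_FTC_le => //.
- by move=> k l kl; apply: invn_le.
- by move=> k l kl; rewrite lerD2l lerN2; exact: invn_le.
- by move=> k x /p; exact: dF.
- by move=> k x /p; exact: cG.
- by move=> k x /p; exact: G0.
- by move=> k; apply: FM => //; rewrite invr_gt0.
Qed.

Lemma integral_oy_FTC_ge F G (a : R) :
    (forall x : R, a <= x -> is_derive x 1 F (G x)) ->
    (forall x : R, a <= x -> {for x, continuous G}) ->
    (forall x : R, a <= x -> 0 <= G x) ->
    measurable_fun setT G ->
    F x @[x --> +oo] --> 0 ->
  ((- F a)%:E <= \int[mu]_(x in `]a, +oo[) (G x)%:E)%E.
Proof.
move=> dF cG G0 mG F0.
rewrite integral_itv_obnd_cbnd; last first.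
  by apply: measurable_funTS; exact/measurable_EFinP.
have key b : a < b -> ((F b - F a)%:E <= \int[mu]_(x in `[a, +oo[) (G x)%:E)%E.
  move=> ab; have <- := @FTC2_is_derive F G a b ab
    (fun x axb => dF x (proj1 (andP axb))) (fun x axb => cG x (proj1 (andP axb))).
  apply: ge0_subset_integral => //=.
  - by apply: measurable_funTS; exact/measurable_EFinP.
  - by move=> x /=; rewrite in_itv/= andbT lee_fin; exact: G0.
  - by move=> x /=; rewrite !in_itv/= andbT => /andP[].
have : (0 <= \int[mu]_(x in `[a, +oo[) (G x)%:E)%E.
  by apply: integral_ge0 => x /=; rewrite in_itv/= andbT lee_fin; exact: G0.
move: key; case: (\int[mu]_(x in _) _)%E => [r||]//; last by move=> *; exact: leey.
move=> key r0; rewrite lee_fin.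
have h : (F x - F a) @[x --> +oo] --> 0 - F a by apply: cvgB => //; exact: cvg_cst.
rewrite -[leLHS]add0r -(cvg_lim _ h)//; apply: limr_le.
  by apply/cvg_ex; eexists; exact: h.
near=> b; rewrite -lee_fin; apply: key; near: b; exact: nbhs_pinfty_gt (num_real _).
Unshelve. all: by end_near. Qed.

End half_line_integrals.

(** * Integrals of radial functions *)

Section layer_cake.
Context (R : realType) (n : nat).
Local Notation mu := (@lebesgue_measure R).
Local Notation nu := (lebesgue_row R n).
Implicit Types (g G : R -> R).

Let slab G (z : measurableTypeR R * 'rV[R]_n) : \bar R :=
  if (0 < z.1) && (sqnorm z.2 < z.1) then (G z.1)%:E else 0%E.

Let measurable_slab G : measurable_fun setT G -> measurable_fun setT (slab G).
Proof.
move=> mG; apply: measurable_fun_ifT => //.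
- apply: measurable_and; apply: measurable_fun_ltr => //.
  by apply: measurableT_comp => //; exact: measurable_sqnorm.
- by apply/measurable_EFinP; exact: measurableT_comp.
Qed.

Let ball_sub_cube (l : R) : 0 < l ->
  [set x : 'rV[R]_n | sqnorm x < l] `<=` cube (Num.sqrt l).
Proof.
move=> l0 x /= xl i; rewrite -sqrtr_sqr ler_wsqrtr//.
exact/ltW/(le_lt_trans (coord_le_sqnorm x i)).
Qed.

Let measurable_ball (l : R) : measurable [set x : 'rV[R]_n | sqnorm x < l].
Proof.
rewrite (_ : [set x | _] = @sqnorm R n @^-1` [set` `]-oo, l[]); last first.
  by apply/seteqP; split=> x /=; rewrite in_itv.
by rewrite -[X in measurable X]setTI; exact: measurable_sqnorm.
Qed.

(** Layer cake. The value [g (|x|^2)] is at most the integral of [G] over the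
    [l > |x|^2]; by Tonelli the integral in [x] is at most that of [G l] times the
    measure of the ball [|x|^2 < l], which lies in a cube of side
    [2 * Num.sqrt l]. A cube is as good as the ball here, for only powers of [l]
    matter. *)
Lemma integral_radial_le g G (M : R) :
    (0 < n)%N ->
    measurable_fun setT g -> measurable_fun setT G ->
    (forall t, 0 <= g t) ->
    (forall l, 0 < l -> 0 <= G l) ->
    (forall t : R, 0 < t ->
      ((g t)%:E <= \int[mu]_(l in `]t, +oo[) (G l)%:E)%E) ->
    (\int[mu]_(l in `]0%R, +oo[) (G l * (2 * Num.sqrt l) ^+ n)%:E <= M%:E)%E ->
  (\int[nu]_x (g (sqnorm x))%:E <= M%:E)%E.
Proof.
move=> n0 mg mG g0 G0 gG GM; apply: le_trans GM.
have ms := measurable_slab mG.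
have slab0 z : (0 <= slab G z)%E.
  rewrite /slab; case: ifPn => // /andP[z0 _]; rewrite lee_fin; exact: G0.
have tail x : (\int[mu]_l slab G (l, x) =
    \int[mu]_(l in `]sqnorm x, +oo[) (G l)%:E)%E.
  rewrite [RHS]integral_mkcond; apply: eq_integral => l _.
  rewrite patchE /slab/= mem_setE in_itv/= andbT.
  case: ifPn => [/andP[_ ->]//|]; case: (ltP (sqnorm x) l) => [xl|//].
  by rewrite andbT (le_lt_trans (sqnorm_ge0 x)).
apply: (@le_trans _ _ (\int[nu]_x \int[mu]_l slab G (l, x))%E).
  apply: ae_ge0_le_integral => //.
  - by move=> x _; rewrite lee_fin.
  - apply/measurable_EFinP; apply: measurableT_comp => //.
    exact: measurable_sqnorm.
  - by move=> x _; exact: integral_ge0.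
  - exact: (measurable_fun_fubini_tonelli_G (slab G)).
  (* g is not bounded by the tail of G at 0, hence the null set *)
  - exists [set x | sqnorm x = 0]; split.
    + rewrite -[X in measurable X]setTI.
      exact: (@measurable_sqnorm R n measurableT _ (measurable_set1 0)).
    + exact: lebesgue_row_set0.
    + move=> x /= /not_implyP[_] h; apply: contrapT => x0; apply: h.
      rewrite tail; apply: gG; rewrite lt_neqAle sqnorm_ge0 andbT eq_sym.
      exact/eqP.
rewrite -(fubini_tonelli (slab G))// [leRHS]integral_mkcond.
apply: ge0_le_integral => //.
- by move=> l _; exact: integral_ge0.
- exact: (measurable_fun_fubini_tonelli_F (slab G)).
- apply/(measurable_restrictT _ _).1 => //.
  apply/measurable_EFinP; apply: measurable_funM; first exact: measurable_funTS.
  apply: measurable_funX; apply: measurable_funM => //.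
  apply: measurable_funTS; apply: continuous_measurable_fun.
  exact: sqrt_continuous.
move=> l _; rewrite patchE mem_setE in_itv/= andbT.
case: ltP => [l0|l0]; last first.
  by rewrite integral0_eq// => x _; rewrite /slab/= ltNge l0.
rewrite (_ : (\int[nu]_x _ = \int[nu]_(x in [set x | sqnorm x < l]%R) (G l)%:E)%E).
  rewrite integral_cst//= EFinM lee_wpmul2l ?lee_fin ?G0//.
  by apply: lebesgue_row_le_cube => //; exact: ball_sub_cube.
rewrite [RHS]integral_mkcond; apply: eq_integral => x _.
by rewrite patchE /slab/= l0 mem_setE.
Qed.

End layer_cake.

(** * The radial profile *)

Section profile.
Context (R : realType) (a : R).
Hypothesis a_ge : 4^-1 <= a.
Implicit Types x y L : R.
Local Notation mu := (@lebesgue_measure R).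

(** The constant 16 is large enough for the quotient of [2 * L] by this weight to
    be at most [4^-1] in absolute value, which makes the profile monotone as soon
    as [a >= 4^-1]. *)
Definition log_weight L : R := 16 + L ^+ 2.

(** In terms of [L = ln x], the function [slope] is [x f' / f] for the profile [f]
    below, and [curv] is [x^2 f'' / f]. *)
Definition slope L : R := - a - 2 * L / log_weight L.
Definition slope' L : R := - 2 / log_weight L + 4 * L ^+ 2 / log_weight L ^+ 2.
Definition curv L : R := slope L ^+ 2 + slope' L - slope L.

Definition profile x : R := expR (- a * ln x) / log_weight (ln x).

(** [profile1] and [profile2] are the first two derivatives. *)
Definition profile1 x : R := profile x * slope (ln x) / x.
Definition profile2 x : R := profile x * curv (ln x) / x ^+ 2.

Lemma log_weight_ge16 L : 16 <= log_weight L.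
Proof. by rewrite /log_weight lerDl sqr_ge0. Qed.

Lemma log_weight_gt0 L : 0 < log_weight L.
Proof. exact: lt_le_trans (log_weight_ge16 L). Qed.

Let log_weight_neq0 L : log_weight L != 0.
Proof. by rewrite gt_eqF// log_weight_gt0. Qed.

Lemma profile_gt0 x : 0 < profile x.
Proof. by rewrite divr_gt0 ?expR_gt0 ?log_weight_gt0. Qed.

Let slope_frac L : - 4^-1 <= 2 * L / log_weight L <= 4^-1.
Proof.
rewrite -ler_norml.
rewrite normrM normfV (gtr0_norm (log_weight_gt0 L)) ler_pdivrMr ?log_weight_gt0//.
have -> : log_weight L = 16 + `|L| ^+ 2 by rewrite real_normK// num_real.
rewrite normrM ger0_norm//.
(* 8 * l <= 16 + l ^ 2, because (l - 4) ^ 2 >= 0 *)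
have amgm (l : R) : 0 <= (l - 4) ^+ 2 -> 2 * l <= 4^-1 * (16 + l ^+ 2).
  by rewrite (_ : (l - 4) ^+ 2 = l ^+ 2 - 8 * l + 16); [lra|ring].
exact/amgm/sqr_ge0.
Qed.

Lemma slope_le0 L : slope L <= 0.
Proof. by have ha := a_ge; have /andP[t1 t2] := slope_frac L; rewrite /slope; lra. Qed.

Let slope_abs L : `|slope L| <= a + 4^-1.
Proof.
have ha := a_ge; have /andP[t1 t2] := slope_frac L; rewrite ler_norml /slope.
by apply/andP; split; lra.
Qed.

Definition slope_bound : R := (a + 1) ^+ 2.

Lemma slope_bound_ge1 : 1 <= slope_bound.
Proof. by have ha := a_ge; rewrite /slope_bound expr2; nra. Qed.

Lemma slope_le_bound L : `|slope L| <= slope_bound.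
Proof.
by have ha := a_ge; apply: le_trans (slope_abs L) _; rewrite /slope_bound expr2; nra.
Qed.

Lemma curv_le_bound L : `|curv L| <= slope_bound.
Proof.
have s'E : slope' L = (2 * L / log_weight L) ^+ 2 - 2 / log_weight L.
  by rewrite /slope' exprMn exprVn exprMn -natrX mulNr addrC.
have i0 : 0 <= (log_weight L)^-1 by rewrite invr_ge0 ltW// log_weight_gt0.
have i1 : (log_weight L)^-1 <= 16^-1 by rewrite lef_pV2 ?posrE ?log_weight_gt0// log_weight_ge16.
have ha := a_ge; have := slope_frac L; have := slope_abs L.
rewrite /curv s'E /slope_bound !ler_norml !expr2.
move: (slope L) (2 * L / log_weight L) ((log_weight L)^-1) i0 i1 => s t i i0 i1.
move=> /andP[s1 s2] /andP[t1 t2].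
by apply/andP; split; nra.
Qed.

Lemma is_derive_log_weight L : is_derive L 1 log_weight (2 * L).
Proof.
have := is_derive_fun_add (is_derive_fun_cst (16 : R) L 1) (is_derive_fun_mul (is_derive_fun_id L) (is_derive_fun_id L)).
by move=> H; apply: (is_derive_eq H); rewrite mul1r mulr1 add0r; ring.
Qed.

Lemma is_derive_slope L : is_derive L 1 slope (slope' L).
Proof.
have := is_derive_fun_add (is_derive_fun_cst (- a) L 1) (is_derive_fun_mul (is_derive_fun_cst (-1) L 1)
  (is_derive_fun_mul (is_derive_fun_mul (is_derive_fun_cst 2 L 1) (is_derive_fun_id L)) (is_derive_fun_inv (log_weight_neq0 L) (is_derive_log_weight L)))).
rewrite (_ : (fun _ => _) = slope); last first.
  by apply/funext => y; rewrite /slope mulN1r.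
by move=> H; apply: (is_derive_eq H); rewrite /slope'; field; exact: log_weight_neq0.
Qed.

Let shape L : R := expR (- a * L) / log_weight L.

Let is_derive_shape L : is_derive L 1 shape (shape L * slope L).
Proof.
have := is_derive_fun_mul (is_derive_fun_comp (is_derive_expR (- a * L)) (is_derive_fun_mul (is_derive_fun_cst (- a) L 1) (is_derive_fun_id L)))
  (is_derive_fun_inv (log_weight_neq0 L) (is_derive_log_weight L)).
by move=> H; apply: (is_derive_eq H); rewrite /shape /slope; field; exact: log_weight_neq0.
Qed.

Lemma is_derive_profile x : 0 < x -> is_derive x 1 profile (profile1 x).
Proof.
move=> x0; have := is_derive_fun_comp (is_derive_shape (ln x)) (is_derive1_ln x0).
by move=> H; exact: (is_derive_eq H).
Qed.

Lemma is_derive_profile1 x : 0 < x -> is_derive x 1 profile1 (profile2 x).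
Proof.
move=> x0; have xN0 : x != 0 by rewrite gt_eqF.
have := is_derive_fun_mul (is_derive_fun_mul (is_derive_profile x0)
  (is_derive_fun_comp (is_derive_slope (ln x)) (is_derive1_ln x0))) (is_derive_fun_inv xN0 (is_derive_fun_id x)).
move=> H; apply: (is_derive_eq H); rewrite /profile1 /profile2 /curv; field; exact: xN0.
Qed.

Lemma profile1_le0 x : 0 < x -> profile1 x <= 0.
Proof.
move=> x0; rewrite /profile1 mulr_le0_ge0 ?invr_ge0 ?(ltW x0)//.
by rewrite mulr_ge0_le0 ?slope_le0// ltW// profile_gt0.
Qed.

Lemma profile1_le x : 0 < x -> `|profile1 x| <= slope_bound * profile x / x.
Proof.
move=> x0; rewrite /profile1 normf_div normrM (gtr0_norm x0).
rewrite (gtr0_norm (profile_gt0 x)) ler_wpM2r ?invr_ge0 ?(ltW x0)// mulrC.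
by rewrite ler_wpM2r ?slope_le_bound// ltW// profile_gt0.
Qed.

Lemma profile2_le x : 0 < x -> `|profile2 x| <= slope_bound * profile x / x ^+ 2.
Proof.
move=> x0; rewrite /profile2 normf_div normrM (gtr0_norm (exprn_gt0 2 x0)).
rewrite (gtr0_norm (profile_gt0 x)) ler_wpM2r ?invr_ge0 ?exprn_ge0 ?(ltW x0)//.
by rewrite mulrC ler_wpM2r ?curv_le_bound// ltW// profile_gt0.
Qed.

Lemma profile_nonincreasing x y : 0 < x -> x <= y -> profile y <= profile x.
Proof.
move=> x0 xy; apply: (is_derive_nonincreasing xy) => z /andP[xz _].
- exact: is_derive_profile (lt_le_trans x0 xz).
- exact: profile1_le0 (lt_le_trans x0 xz).
Qed.

Lemma continuous_profile x : 0 < x -> {for x, continuous profile}.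
Proof. by move=> x0; exact: is_derive_continuous (is_derive_profile x0). Qed.

Lemma continuous_profile1 x : 0 < x -> {for x, continuous profile1}.
Proof. by move=> x0; exact: is_derive_continuous (is_derive_profile1 x0). Qed.

Lemma continuous_profile2 x : 0 < x -> {for x, continuous profile2}.
Proof.
move=> x0; pose L := ln x.
have dd := is_derive_log_weight L.
have ds' : exists l, is_derive L 1 slope' l.
  eexists; exact: (is_derive_fun_add (is_derive_fun_mul (is_derive_fun_cst (-2 : R) L 1) (is_derive_fun_inv (log_weight_neq0 L) dd))
    (is_derive_fun_mul (is_derive_fun_mul (is_derive_fun_cst (4 : R) L 1) (is_derive_fun_mul (is_derive_fun_id L) (is_derive_fun_id L)))
       (is_derive_fun_inv (f := fun y => log_weight y * log_weight y) (mulf_neq0 (log_weight_neq0 L) (log_weight_neq0 L))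
         (is_derive_fun_mul dd dd)))).
have [l dl] := ds'.
have ds := is_derive_slope L.
have dc : is_derive L 1 curv (slope' L * slope L + slope L * slope' L + l
    + (0 * slope L + -1 * slope' L)).
  rewrite (_ : curv = fun y => slope y * slope y + slope' y + -1 * slope y).
    exact: (is_derive_fun_add (is_derive_fun_add (is_derive_fun_mul ds ds) dl) (is_derive_fun_mul (is_derive_fun_cst (-1 : R) L 1) ds)).
  by apply/funext => y; rewrite /curv mulN1r expr2.
have H := is_derive_fun_mul (is_derive_fun_mul (is_derive_profile x0) (is_derive_fun_comp dc (is_derive1_ln x0)))
  (is_derive_fun_inv (f := fun y : R => y * y) (mulf_neq0 (lt0r_neq0 x0) (lt0r_neq0 x0))
    (is_derive_fun_mul (is_derive_fun_id x) (is_derive_fun_id x))).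
exact: is_derive_continuous H.
Qed.

Lemma measurable_log_weight : measurable_fun setT log_weight.
Proof.
apply: continuous_measurable_fun => L.
exact: is_derive_continuous (is_derive_log_weight L).
Qed.

Lemma measurable_slope : measurable_fun setT slope.
Proof.
apply: continuous_measurable_fun => L.
exact: is_derive_continuous (is_derive_slope L).
Qed.

Lemma measurable_curv : measurable_fun setT curv.
Proof.
apply: measurable_funB; last exact: measurable_slope.
apply: measurable_funD; first by apply: measurable_funX; exact: measurable_slope.
apply: measurable_funD; apply: measurable_funM => //.
- by apply: measurable_fun_invr; exact: measurable_log_weight.
- by apply: measurable_funM.
- by apply: measurable_fun_invr; apply: measurable_funX; exact: measurable_log_weight.
Qed.

Lemma measurable_profile : measurable_fun setT profile.
Proof.
apply: measurable_funM.
  apply: measurableT_comp; first exact: measurable_expR.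
  by apply: measurable_funM => //; exact: measurable_ln.
apply: measurable_fun_invr.
by apply: measurableT_comp; [exact: measurable_log_weight|exact: measurable_ln].
Qed.

Lemma measurable_profile1 : measurable_fun setT profile1.
Proof.
apply: measurable_funM; last exact: measurable_fun_invr.
apply: measurable_funM; first exact: measurable_profile.
by apply: measurableT_comp; [exact: measurable_slope|exact: measurable_ln].
Qed.

Lemma measurable_profile2 : measurable_fun setT profile2.
Proof.
apply: measurable_funM; last exact/measurable_fun_invr/measurable_funX.
apply: measurable_funM; first exact: measurable_profile.
by apply: measurableT_comp; [exact: measurable_curv|exact: measurable_ln].
Qed.

End profile.

(** * Integrability of the profile and of inverse powers *)

Section radial_integrals.
Context (R : realType) (n : nat).
Hypothesis n2 : (2 <= n)%N.
Implicit Types x y l t : R.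
Local Notation mu := (@lebesgue_measure R).
Local Notation nu := (lebesgue_row R n).
Local Notation a := (n%:R / 4 : R).
Local Notation f := (profile a).

Lemma exponent_ge : 4^-1 <= a.
Proof.
by rewrite -[leLHS]mul1r ler_wpM2r ?invr_ge0// ler1n (leq_trans _ n2).
Qed.

Let ha : 4^-1 <= a := exponent_ge.

Let n_gt0 : (0 < n)%N. Proof. exact: leq_trans n2. Qed.

Let a_gt0 : 0 < a. Proof. by apply: lt_le_trans ha; rewrite invr_gt0. Qed.

Let density x : R := - 2 * f x * profile1 a x.

Let density_ge0 x : 0 < x -> 0 <= density x.
Proof.
move=> x0; rewrite /density !mulNr oppr_ge0 mulr_ge0_le0 ?profile1_le0//.
by rewrite mulr_ge0// ltW// profile_gt0.
Qed.

Let measurable_density : measurable_fun setT density.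
Proof.
apply: measurable_funM; last exact: measurable_profile1.
by apply: measurable_funM => //; exact: measurable_profile.
Qed.

Let continuous_density x : 0 < x -> {for x, continuous density}.
Proof.
move=> x0; have h := is_derive_fun_mul (is_derive_fun_mul (is_derive_fun_cst (-2) x 1) (is_derive_profile a x0))
  (is_derive_profile1 a x0).
exact: is_derive_continuous h.
Qed.

Lemma profile_le_exp x : 0 < x -> f x <= expR (- a * ln x).
Proof.
move=> x0; rewrite /profile ler_pdivrMr ?log_weight_gt0// ler_peMr ?expR_ge0//.
by apply: le_trans (log_weight_ge16 _); rewrite ler1n.
Qed.

Let profile_sq_cvg0 : (- (f x ^+ 2)) @[x --> +oo] --> 0.
Proof.
suff f0 : f x @[x --> +oo] --> 0.
  rewrite -oppr0 -[X in - X](expr0n R 2); apply: cvgN.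
  by under eq_fun do rewrite expr2; rewrite expr2; exact: cvgM.
apply/cvgrPdist_le => /= e e0; near=> x.
have x0 : 0 < x by near: x; exact: nbhs_pinfty_gt (num_real _).
rewrite sub0r normrN (gtr0_norm (profile_gt0 _ _)).
apply: le_trans (profile_le_exp x0) _.
have : expR (- ln e / a) <= x by near: x; exact: nbhs_pinfty_ge (num_real _).
rewrite -[leRHS](lnK x0) ler_expR ler_pdivrMr// => h.
rewrite -[leRHS](lnK e0) ler_expR mulNr lerNl.
by rewrite mulrC.
Unshelve. all: by end_near. Qed.

Let profile_sq_le_tail t : 0 < t ->
  ((f t ^+ 2)%:E <= \int[mu]_(l in `]t, +oo[) (density l)%:E)%E.
Proof.
move=> t0; rewrite -[f t ^+ 2]opprK.
have pos x : t <= x -> 0 < x by exact: lt_le_trans.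
apply: (@integral_oy_FTC_ge _ (fun x => - (f x ^+ 2)) density).
- move=> x /pos x0; have d := is_derive_profile a x0.
  have := is_derive_fun_mul (is_derive_fun_cst (-1) x 1) (is_derive_fun_mul d d).
  rewrite (_ : (fun _ => _) = (fun x => - (f x ^+ 2))); last first.
    by apply/funext => y; rewrite mulN1r.
  by move=> H; apply: (is_derive_eq H); rewrite /density; ring.
- by move=> x /pos; exact: continuous_density.
- by move=> x /pos; exact: density_ge0.
- exact: measurable_density.
- exact: profile_sq_cvg0.
Qed.

Let K : R := 2 * slope_bound a * 2 ^+ n.

Let K_ge0 : 0 <= K.
Proof. by rewrite mulr_ge0// mulr_ge0// (le_trans _ (slope_bound_ge1 ha)). Qed.

Let weighted_density_le l : 0 < l ->
  density l * (2 * Num.sqrt l) ^+ n <= K / (l * log_weight (ln l)).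
Proof.
move=> l0; have lE : Num.sqrt l = expR (ln l / 2).
  apply/eqP; rewrite -(@eqrXn2 _ 2) ?sqrtr_ge0 ?expR_ge0// sqr_sqrtr ?ltW//.
  by rewrite -expRM_natl mulrC divfK// lnK.
have fE : f l ^+ 2 * Num.sqrt l ^+ n = (log_weight (ln l) ^+ 2)^-1.
  rewrite lE /profile expr_div_n -!expRM_natl mulrAC -expRD.
  rewrite (_ : _ + _ = 0) ?expR0 ?div1r//.
  by field.
have -> : density l * (2 * Num.sqrt l) ^+ n =
    - (2 * 2 ^+ n / l * slope a (ln l)) * (log_weight (ln l) ^+ 2)^-1.
  rewrite -fE /density /profile1 exprMn; ring.
rewrite /K [(l * _)^-1]invfM [leRHS]mulrA.
have i0 : 0 <= (log_weight (ln l) ^+ 2)^-1 by rewrite invr_ge0 sqr_ge0.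
apply: (@le_trans _ _ (2 * slope_bound a * 2 ^+ n / l * (log_weight (ln l) ^+ 2)^-1)).
  apply: ler_wpM2r => //; have s := slope_le_bound ha (ln l).
  rewrite -mulrN; apply: le_trans (_ : 2 * 2 ^+ n / l * slope_bound a <= _); last first.
    by rewrite le_eqVlt; apply/orP; left; apply/eqP; ring.
  rewrite ler_wpM2l ?divr_ge0 ?mulr_ge0 ?exprn_ge0 ?(ltW l0)//.
  by apply: le_trans s; rewrite -normrN ler_norm.
rewrite ler_wpM2l ?divr_ge0 ?(ltW l0)// lef_pV2 ?posrE ?exprn_gt0 ?log_weight_gt0//.
by rewrite expr2 ler_peMl ?(ltW (log_weight_gt0 _))// (le_trans _ (log_weight_ge16 _))// ler1n.
Qed.

Let inv_log_density l : 0 < l ->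
  is_derive l 1 (fun x => K * (4^-1 * atan (ln x / 4))) (K / (l * log_weight (ln l))).
Proof.
move=> l0; have lN0 : l != 0 by rewrite gt_eqF.
have h := is_derive_fun_mul (is_derive_fun_cst K l 1) (is_derive_fun_mul (is_derive_fun_cst 4^-1 l 1)
  (is_derive_fun_comp (f := fun y : R => ln y / 4) (is_derive1_atan (ln l / 4))
     (is_derive_fun_mul (is_derive1_ln l0) (is_derive_fun_cst 4^-1 l 1)))).
apply: (is_derive_eq h); rewrite /log_weight; field.
by rewrite lN0 andbT -/(log_weight (ln l)) gt_eqF// log_weight_gt0.
Qed.

(** The exponent [n / 4] is critical: in the layer cake bound all powers of [l]
    cancel but [l^-1], and what remains is at most a multiple of
    [1 / (l * (16 + (ln l)^2))], the derivative of [atan (ln l / 4) / 4]. *)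
Lemma profile_L2_bound :
  exists M : R, (\int[nu]_x (f (sqnorm x) ^+ 2)%:E <= M%:E)%E.
Proof.
have K0 := K_ge0.
exists (K * (4^-1 * pi)).
apply: (@integral_radial_le R n (fun t => f t ^+ 2) density) => //.
- by apply: measurable_funX; exact: measurable_profile.
- by move=> t; exact: sqr_ge0.
have mQ : measurable_fun setT (fun l : R => K / (l * log_weight (ln l))).
  apply: measurable_funM => //; apply: measurable_fun_invr.
  apply: measurable_funM => //.
  by apply: measurableT_comp; [exact: measurable_log_weight|exact: measurable_ln].
apply: (@le_trans _ _ (\int[mu]_(l in `]0%R, +oo[) (K / (l * log_weight (ln l)))%:E)%E).
  apply: ge0_le_integral => //.
  - move=> l /=; rewrite in_itv/= andbT => l0; rewrite lee_fin mulr_ge0//.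
    exact: density_ge0.
  - apply: measurable_funTS; apply/measurable_EFinP; apply: measurable_funM => //.
    apply: measurable_funX; apply: measurable_funM => //.
    by apply: continuous_measurable_fun; exact: sqrt_continuous.
  - by apply: measurable_funTS; exact/measurable_EFinP.
  - move=> l /=; rewrite in_itv/= andbT lee_fin; exact: weighted_density_le.
apply: (@integral_oy_FTC_le _ (fun x => K * (4^-1 * atan (ln x / 4)))
  (fun l => K / (l * log_weight (ln l)))) => //.
- move=> x x0; have xN0 : x != 0 by rewrite gt_eqF.
  have h := is_derive_fun_mul (is_derive_fun_cst K x 1) (is_derive_fun_inv (f := fun y : R => y * log_weight (ln y)) (mulf_neq0 xN0 (lt0r_neq0 (log_weight_gt0 (ln x))))
    (is_derive_fun_mul (is_derive_fun_id x) (is_derive_fun_comp (is_derive_log_weight (ln x)) (is_derive1_ln x0)))).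
  exact: is_derive_continuous h.
- by move=> x x0; rewrite divr_ge0// mulr_ge0 ?(ltW x0)// ltW// log_weight_gt0.
- move=> x y _ _; rewrite -mulrBr -mulrBr !ler_wpM2l// ?invr_ge0//.
  have := atan_ltpi2 (ln y / 4); have := atan_gtNpi2 (ln x / 4).
  set u := atan _; set v := atan _; rewrite -mulNr => *; lra.
Qed.

(** Up to the constant, this is what the change of variables [x = Num.sqrt e * y]
    gives; the layer cake bound gets there without it. *)
Lemma inverse_power_bound (k e : R) : n%:R / 2 < k -> 0 < e ->
  (\int[nu]_x ((e + sqnorm x) `^ (- k))%:E <=
     (k * 2 ^+ n / (k - n%:R / 2) * e `^ (n%:R / 2 - k))%:E)%E.
Proof.
move=> nk e0; pose m : R := n%:R / 2; pose C : R := k * 2 ^+ n.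
have k0 : 0 < k by apply: le_lt_trans nk; rewrite divr_ge0.
have km0 : 0 < k - m by rewrite subr_gt0.
have shifted p x : 0 < e + x -> is_derive x 1 (fun y => (e + y) `^ p) (p * (e + x) `^ (p - 1)).
  move=> ex0; have h := is_derive_fun_comp (is_derive1_powR p ex0) (is_derive_fun_add (is_derive_fun_cst e x 1) (is_derive_fun_id x)).
  by apply: (is_derive_eq h); rewrite add0r mulr1.
have mshift p : measurable_fun setT (fun y : R => (e + y) `^ p).
  apply: (@measurableT_comp _ _ _ _ _ _ (fun x : R => x `^ p)) => //.
  exact: measurable_funD.
apply: (@integral_radial_le R n (fun t => (e + t) `^ (- k))
    (fun l => k * (e + l) `^ (- k - 1))) => //.
- exact: measurable_funM.
- by move=> t; exact: powR_ge0.
- by move=> l l0; rewrite mulr_ge0 ?powR_ge0// ltW.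
- move=> t t0; rewrite -[(e + t) `^ _]opprK.
  apply: (@integral_oy_FTC_ge _ (fun t => - ((e + t) `^ (- k)))
    (fun l => k * (e + l) `^ (- k - 1))) => //.
  + move=> x tx; have ex : 0 < e + x by rewrite addr_gt0// (lt_le_trans t0).
    have := is_derive_fun_mul (is_derive_fun_cst (-1) x 1) (shifted (- k) x ex).
    rewrite (_ : (fun _ => _) = (fun t => - ((e + t) `^ (- k)))); last first.
      by apply/funext => y; rewrite mulN1r.
    by move=> H; apply: (is_derive_eq H); rewrite mul0r add0r mulrA mulN1r opprK.
  + move=> x tx; have ex : 0 < e + x by rewrite addr_gt0// (lt_le_trans t0).
    exact: is_derive_continuous (is_derive_fun_mul (is_derive_fun_cst k x 1) (shifted (- k - 1) x ex)).
  + by move=> x tx; rewrite mulr_ge0 ?powR_ge0// ltW.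
  + exact: measurable_funM.
  + rewrite -oppr0; apply: cvgN; apply/cvgrPdist_le => /= d d0; near=> x.
    have x0 : 0 < x by near: x; exact: nbhs_pinfty_gt (num_real _).
    have ex0 : 0 < e + x by rewrite addr_gt0.
    rewrite sub0r normrN ger0_norm ?powR_ge0// /powR gt_eqF//.
    have : expR (- ln d / k) <= x by near: x; exact: nbhs_pinfty_ge (num_real _).
    move=> h; have {}h : expR (- ln d / k) <= e + x by rewrite (le_trans h)// lerDr ltW.
    move: h; rewrite -[leRHS](lnK ex0) ler_expR ler_pdivrMr// => h.
    by rewrite -[leRHS](lnK d0) ler_expR mulNr lerNl mulrC.
apply: (@le_trans _ _ (\int[mu]_(l in `]0%R, +oo[) (C * (e + l) `^ (m - k - 1))%:E)%E).
  apply: ge0_le_integral => //.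
  - move=> l /=; rewrite in_itv/= andbT => l0.
    by rewrite lee_fin !mulr_ge0 ?powR_ge0 ?exprn_ge0 ?mulr_ge0 ?sqrtr_ge0// ltW.
  - apply: measurable_funTS; apply/measurable_EFinP; apply: measurable_funM => //.
      exact: (@measurable_funM _ _ _ _ (cst k) _ (measurable_cst _) (mshift (- k - 1))).
    apply: measurable_funX; apply: measurable_funM => //.
    by apply: continuous_measurable_fun; exact: sqrt_continuous.
  - by apply: measurable_funTS; apply/measurable_EFinP; exact: (@measurable_funM _ _ _ _ (cst C) _ (measurable_cst _) (mshift (m - k - 1))).
  - move=> l /=; rewrite in_itv/= andbT => l0; have el0 : 0 < e + l by rewrite addr_gt0.
    rewrite lee_fin exprMn /C -[leLHS]mulrA -[leRHS]mulrA ler_wpM2l ?(ltW k0)//.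
    rewrite mulrCA ler_wpM2l ?exprn_ge0//.
    rewrite (_ : m - k - 1 = (- k - 1) + m); last by ring.
    rewrite [in leRHS]powRD ?(gt_eqF el0) ?implybT// ler_wpM2l ?powR_ge0//.
    rewrite /m mulrC powRrM powR12_sqrt ?(ltW el0)// powR_mulrn ?sqrtr_ge0//.
    by rewrite lerXn2r ?nnegrE ?sqrtr_ge0// ler_wsqrtr// lerDr ltW.
apply: (@integral_oy_FTC_le _ (fun x => - (C / (k - m)) * (e + x) `^ (m - k))
  (fun l => C * (e + l) `^ (m - k - 1))).
- move=> x x0; have ex0 : 0 < e + x by rewrite addr_gt0.
  have H := is_derive_fun_mul (is_derive_fun_cst (- (C / (k - m))) x 1) (shifted (m - k) x ex0).
  apply: (is_derive_eq H); rewrite mul0r add0r mulrA; congr (_ * _).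
  by field; rewrite gt_eqF.
- move=> x x0; have ex0 : 0 < e + x by rewrite addr_gt0.
  exact: is_derive_continuous (is_derive_fun_mul (is_derive_fun_cst C x 1) (shifted (m - k - 1) x ex0)).
- by move=> x x0; rewrite !mulr_ge0 ?powR_ge0 ?exprn_ge0// ltW.
- exact: measurable_funM.
- move=> x y x0 xy; rewrite !mulNr opprK addrC.
  have C0 : 0 <= C / (k - m) by rewrite !mulr_ge0 ?exprn_ge0 ?invr_ge0 ?(ltW k0)// ltW.
  apply: (@le_trans _ _ (C / (k - m) * (e + x) `^ (m - k))).
    by rewrite gerBl mulr_ge0// powR_ge0.
  rewrite ler_wpM2l// -opprB !powRN lef_pV2 ?posrE ?powR_gt0 ?addr_gt0//.
  have ex : e <= e + x by rewrite lerDl ltW.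
  apply: ge0_ler_powR ex; rewrite ?nnegrE; [exact: ltW|exact: ltW|].
  by rewrite addr_ge0// ltW.
Unshelve. all: by end_near. Qed.

End radial_integrals.

(** * Smooth functions with compact support *)

Section bump_functions.
Context (R : realType).
Implicit Types (P : {poly R}) (w y : R).

(** A polynomial in [1 / y] times [exp (- 1 / y)], extended by 0 to [y <= 0].
    Carrying the polynomial along makes the family closed under differentiation. *)
Definition bump P y : R := if 0 < y then P.[y^-1] * expR (- y^-1) else 0.

Lemma poly_expRN_bounded P : exists2 M, 0 <= M &
  forall w, 0 < w -> `|P.[w] * expR (- w)| <= M.
Proof.
exists (\sum_(i < size P) `|P`_i| * i`!%:R).
  by apply: sumr_ge0 => i _; rewrite mulr_ge0.
move=> w w0; rewrite normrM (ger0_norm (expR_ge0 _)) horner_coef.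
apply: le_trans (_ : (\sum_(i < size P) `|P`_i| * w ^+ i) * expR (- w) <= _).
  rewrite ler_wpM2r ?expR_ge0//; apply: le_trans (ler_norm_sum _ _ _) _.
  by apply: ler_sum => i _; rewrite normrM normrX (gtr0_norm w0).
rewrite mulr_suml; apply: ler_sum => i _; rewrite -mulrA ler_wpM2l//.
rewrite expRN ler_pdivrMr ?expR_gt0//.
case: i => -[|k] _ /=.
  by rewrite expr0 fact0 mul1r -expR0 ler_expR ltW.
have := expR_ge1Dxn k (ltW w0) => /(le_trans _) h.
rewrite mulrC -ler_pdivrMr ?ltr0n ?fact_gt0//; apply: h.
by rewrite lerDr.
Qed.

Lemma bump_bounded P : exists2 M, 0 <= M & forall y, `|bump P y| <= M.
Proof.
have [M M0 h] := poly_expRN_bounded P; exists M => // y; rewrite /bump.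
by case: ifPn => [y0|_]; [apply: h; rewrite invr_gt0|rewrite normr0].
Qed.

(** Factoring [y] out leaves a function of the same family, bounded in turn: this
    is what settles continuity and differentiability at 0. *)
Lemma bumpMX P y : bump P y = y * bump ('X * P) y.
Proof.
rewrite /bump; case: ifPn => [y0|]; last by rewrite mulr0.
by rewrite hornerM hornerX !mulrA divff ?mul1r// gt_eqF.
Qed.

Let continuous0_bump P : {for 0, continuous (bump P)}.
Proof.
have [M M0 bM] := bump_bounded ('X * P).
rewrite /prop_for /continuous_at {2}/bump ltxx.
apply/cvgrPdist_le => /= e e0; near=> y.
rewrite sub0r normrN bumpMX normrM.
apply: (@le_trans _ _ (`|y| * (M + 1))).
  by rewrite ler_wpM2l// (le_trans (bM y))// lerDl.
rewrite -ler_pdivlMr ?ltr_wpDl//.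
have : `|0 - y| <= e / (M + 1).
  by near: y; apply: cvgr_dist_le; [exact: cvg_id|rewrite divr_gt0// ltr_wpDl].
by rewrite sub0r normrN.
Unshelve. all: by end_near. Qed.

Lemma is_derive_bump P y :
  is_derive y 1 (bump P) (bump ('X^2 * (P - P^`())) y).
Proof.
have [y0|y0|->] := ltgtP y 0.
- rewrite {2}/bump ltNge (ltW y0)/=.
  apply: (@near_eq_is_derive _ _ _ (fun _ => 0)).
  near=> z; rewrite /bump ltNge; suff -> : z <= 0 by [].
  by near: z; apply: filterS (lt_nbhsl y0) => z /ltW.
- have yN0 : y != 0 by rewrite gt_eqF.
  have iv : is_derive y 1 (fun z : R => z^-1) (- (1 / y ^+ 2)).
    exact: (is_derive_fun_inv yN0 (is_derive_fun_id y)).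
  have dP : is_derive y 1 (fun z : R => P.[z^-1]) (P^`().[y^-1] * - (1 / y ^+ 2)).
    exact: (is_derive_fun_comp (f := fun z : R => z^-1) (is_derive_poly P y^-1) iv).
  have dE : is_derive y 1 (fun z : R => expR (- z^-1))
      (expR (- y^-1) * (0 * y^-1 + -1 * - (1 / y ^+ 2))).
    have h := is_derive_fun_comp (f := fun z : R => -1 * z^-1) (is_derive_expR (-1 * y^-1)) (is_derive_fun_mul (is_derive_fun_cst (-1) y 1) iv).
    rewrite mulN1r in h; rewrite (_ : (fun _ => _) = fun z => expR (-1 * z^-1))//.
    by apply/funext => z; rewrite mulN1r.
  have := is_derive_fun_mul dP dE; set b := (X in is_derive _ _ _ X) => h.
  have -> : bump ('X^2 * (P - P^`())) y = b.
    rewrite /bump y0 hornerM hornerXn hornerD hornerN /b.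
    by field.
  apply: (near_eq_is_derive _ h).
  near=> z; rewrite /bump; suff -> : 0 < z by [].
  by near: z; exact: lt_nbhsr.
- apply/is_derive1_caratheodory; exists (bump ('X * P)); split.
  + by move=> z; rewrite {2}/bump ltxx !subr0 bumpMX mulrC.
  + exact: continuous0_bump.
  + by rewrite /bump ltxx.
Unshelve. all: by end_near. Qed.

Lemma continuous_bump P : continuous (bump P).
Proof. by move=> y; exact: is_derive_continuous (is_derive_bump P y). Qed.

End bump_functions.

Section smooth_expressions.
Context (R : realType) (n : nat).
Local Notation V := 'rV[R]_n.
Implicit Types (h : V -> R) (x : V).

(** Formulas whose partial derivatives are again such formulas, so that smoothness
    of all orders follows by induction on the formula. *)
Inductive smooth_expr : (V -> R) -> Prop :=
| smooth_const c : smooth_expr (fun _ => c)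
| smooth_coord i : smooth_expr (fun x => x ord0 i)
| smooth_add h k of smooth_expr h & smooth_expr k :
    smooth_expr (fun x => h x + k x)
| smooth_mul h k of smooth_expr h & smooth_expr k :
    smooth_expr (fun x => h x * k x)
| smooth_inv h of (forall x, h x != 0) & smooth_expr h :
    smooth_expr (fun x => (h x)^-1)
| smooth_ln h of (forall x, 0 < h x) & smooth_expr h :
    smooth_expr (fun x => ln (h x))
| smooth_exp h of smooth_expr h : smooth_expr (fun x => expR (h x))
| smooth_bump P h of smooth_expr h : smooth_expr (fun x => bump P (h x)).

Local Notation e_ i := (delta_mx ord0 i : V).

Lemma is_derive_coord x (i j : 'I_n) :
  is_derive x (e_ i) (fun y : V => y ord0 j) (i == j)%:R.
Proof.
apply/is_derive_line.
rewrite (_ : (fun _ => _) = fun h : R => h * (i == j)%:R + x ord0 j); last first.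
  by apply/funext => h; rewrite !mxE eqxx/= eq_sym.
have H := is_derive_fun_add (is_derive_fun_mul (is_derive_fun_id (0 : R)) (is_derive_fun_cst ((i == j)%:R : R) (0 : R) (1 : R)))
  (is_derive_fun_cst (x ord0 j : R) (0 : R) (1 : R)).
by apply: (is_derive_eq H); rewrite mul1r mulr0 !addr0.
Qed.

Lemma smooth_expr_continuous h : smooth_expr h -> continuous h.
Proof.
elim=> {h} [c|i|h k _ ch _ ck|h k _ ch _ ck|h h0 _ ch|h h0 _ ch|h _ ch|P h _ ch] x.
- exact: cst_continuous.
- exact: coord_continuous.
- exact: (continuousD (ch x) (ck x)).
- exact: (continuousM (ch x) (ck x)).
- exact: (continuousV (h0 x) (ch x)).
- by apply: continuous_comp; [exact: ch|exact: continuous_ln].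
- by apply: continuous_comp; [exact: ch|exact: continuous_expR].
- by apply: continuous_comp; [exact: ch|exact: continuous_bump].
Qed.

Lemma smooth_expr_derive h : smooth_expr h -> forall i,
  exists2 h', smooth_expr h' & forall x, is_derive x (e_ i) h (h' x).
Proof.
move=> sh i; elim: sh => {h}.
- move=> c; exists (fun _ => 0); first exact: smooth_const.
  by move=> x; exact: is_derive_fun_cst.
- move=> j; exists (fun _ => (i == j)%:R); first exact: smooth_const.
  by move=> x; exact: is_derive_coord.
- move=> h k sh [h' sh' dh] sk [k' sk' dk].
  exists (fun x => h' x + k' x); first exact: smooth_add.
  by move=> x; exact: (is_derive_fun_add (dh x) (dk x)).
- move=> h k sh [h' sh' dh] sk [k' sk' dk].
  exists (fun x => h' x * k x + h x * k' x).
    by apply: smooth_add; exact: smooth_mul.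
  by move=> x; exact: (is_derive_fun_mul (dh x) (dk x)).
- move=> h h0 sh [h' sh' dh].
  exists (fun x => (-1) * (h' x * ((h x)^-1 * (h x)^-1))).
    apply: smooth_mul; first exact: smooth_const.
    by apply: smooth_mul => //; apply: smooth_mul; exact: smooth_inv.
  move=> x; apply: (is_derive_eq (is_derive_fun_inv (h0 x) (dh x))).
  by rewrite mulN1r expr2 invfM.
- move=> h h0 sh [h' sh' dh].
  exists (fun x => (h x)^-1 * h' x).
    apply: smooth_mul => //; apply: smooth_inv => // x.
    by rewrite gt_eqF.
  by move=> x; exact: (is_derive_fun_comp (is_derive1_ln (h0 x)) (dh x)).
- move=> h sh [h' sh' dh]; exists (fun x => expR (h x) * h' x).
    by apply: smooth_mul => //; exact: smooth_exp.
  by move=> x; exact: (is_derive_fun_comp (is_derive_expR (h x)) (dh x)).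
- move=> P h sh [h' sh' dh].
  exists (fun x => bump ('X^2 * (P - P^`())) (h x) * h' x).
    by apply: smooth_mul => //; exact: smooth_bump.
  by move=> x; exact: (is_derive_fun_comp (is_derive_bump P (h x)) (dh x)).
Qed.

Lemma smooth_expr_smooth h : smooth_expr h -> smooth h.
Proof.
move=> sh s; have {sh} ss : smooth_expr (iter_partial s h).
  elim: s => [//|i s IH] /=.
  have [h' sh' dh] := smooth_expr_derive IH i.
  rewrite (_ : partial i _ = h')//.
  by apply/funext => x; rewrite /partial; exact: derive_val.
split; first exact: smooth_expr_continuous.
by move=> i x; have [h' _ dh] := smooth_expr_derive ss i; exact: ex_derive.
Qed.

Lemma smooth_expr_measurable h : smooth_expr h -> measurable_fun setT h.
Proof.
elim=> {h} [c|i|h k _ mh _ mk|h k _ mh _ mk|h _ _ mh|h _ _ mh|h _ mh|P h _ mh].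
- exact: measurable_cst.
- exact: measurable_coordR.
- exact: measurable_funD.
- exact: measurable_funM.
- exact: measurable_fun_invr.
- by apply: (@measurableT_comp _ _ _ _ _ _ (@ln R)) => //; exact: measurable_ln.
- by apply: (@measurableT_comp _ _ _ _ _ _ (@expR R)) => //; exact: measurable_expR.
- apply: (@measurableT_comp _ _ _ _ _ _ (bump P)) => //.
  by apply: continuous_measurable_fun; exact: continuous_bump.
Qed.

Lemma smooth_expr_laplacian h : smooth_expr h -> smooth_expr (laplacian h).
Proof.
move=> sh; rewrite /laplacian; elim: (index_enum _) => [|i r IH].
  rewrite (_ : (fun _ => _) = fun=> 0); first exact: smooth_const.
  by apply/funext => x; rewrite big_nil.
have partialE k : smooth_expr k -> smooth_expr (partial i k).
  move=> sk; have [k' sk' dk] := smooth_expr_derive sk i.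
  rewrite (_ : partial i _ = k')//.
  by apply/funext => x; rewrite /partial; exact: derive_val.
rewrite (_ : (fun _ => _) = fun x : V => partial i (partial i h) x +
    \sum_(j <- r) partial j (partial j h) x).
  by apply: smooth_add => //; apply/partialE/partialE.
by apply/funext => x; rewrite big_cons.
Qed.

Lemma smooth_expr_sqnorm : smooth_expr (@sqnorm R n).
Proof.
rewrite /sqnorm; elim: (index_enum _) => [|i r IH].
  rewrite (_ : (fun _ => _) = fun=> 0); first exact: smooth_const.
  by apply/funext => x; rewrite big_nil.
rewrite (_ : (fun _ => _) =
    fun x : V => x ord0 i * x ord0 i + \sum_(j <- r) x ord0 j ^+ 2).
  by apply: smooth_add => //; apply: smooth_mul; exact: smooth_coord.
by apply/funext => x; rewrite big_cons.
Qed.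

(** Closed cubes are compact, hence so is the closure of a subset of a ball. *)
Lemma compact_support_in_ball (r : R) h :
  (forall x, h x != 0 -> sqnorm x <= r) -> compact (closure [set x | h x != 0]).
Proof.
move=> hr; pose b := Num.sqrt (Num.max r 0).
have cb : compact [set v : V | forall i, `[- b, b]%classic (v ord0 i)].
  by apply: (@rV_compact _ _ (fun=> `[- b, b]%classic)) => _; exact: segment_compact.
apply: (subclosed_compact _ cb); first exact: closed_closure.
suff clb : closed [set x : V | sqnorm x <= r].
  move=> x /(closure_subset hr); rewrite -(closure_id _).1// => /= xr i.
  rewrite /= in_itv/= -ler_norml -sqrtr_sqr ler_wsqrtr// le_max.
  by rewrite (le_trans (coord_le_sqnorm x i)).
apply: (@preimage_closed _ _ (@sqnorm R n) [set y | y <= r]).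
  by move=> x _; exact: smooth_expr_continuous smooth_expr_sqnorm x.
exact: closed_le.
Qed.

Lemma is_derive_sqnorm x (i : 'I_n) : is_derive x (e_ i) (@sqnorm R n) (2 * x ord0 i).
Proof.
pose F (k : 'I_n) (y : V) : R := y ord0 k ^+ 2.
have dF k : is_derive x (e_ i) (F k) ((2 * x ord0 i) * (i == k)%:R).
  have H := is_derive_fun_mul (is_derive_coord x i k) (is_derive_coord x i k).
  apply: (is_derive_eq H).
  by case: eqVneq => [->|_]; rewrite ?mul1r ?mulr1 ?mul0r ?mulr0 ?addr0//; ring.
have := is_derive_sum (h := F) (fun k => dF k).
rewrite (_ : \sum_i _ = @sqnorm R n); last by rewrite /sqnorm fct_sumE.
move=> H; apply: (is_derive_eq H).
rewrite (bigD1 i)//= eqxx mulr1 big1 ?addr0// => k ki.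
by rewrite eq_sym (negbTE ki) mulr0.
Qed.

Lemma laplacian_radial (G G1 G2 : R -> R) x :
    (forall t : R, 0 <= t -> is_derive t 1 G (G1 t)) ->
    (forall t : R, 0 <= t -> is_derive t 1 G1 (G2 t)) ->
  laplacian (fun y => G (sqnorm y)) x =
    2 * n%:R * G1 (sqnorm x) + 4 * sqnorm x * G2 (sqnorm x).
Proof.
move=> dG dG1.
have p1 i : partial i (fun y : V => G (sqnorm y)) =
    fun y => G1 (sqnorm y) * (2 * y ord0 i).
  apply/funext => y; rewrite /partial.
  have H := is_derive_fun_comp (dG _ (sqnorm_ge0 y)) (is_derive_sqnorm y i).
  exact: derive_val.
have p2 i : partial i (partial i (fun y : V => G (sqnorm y))) x =
    2 * G1 (sqnorm x) + 4 * x ord0 i ^+ 2 * G2 (sqnorm x).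
  rewrite p1 /partial; have := is_derive_coord x i i; rewrite eqxx => dx.
  have H := is_derive_fun_mul (is_derive_fun_comp (dG1 _ (sqnorm_ge0 x)) (is_derive_sqnorm x i))
    (is_derive_fun_mul (is_derive_fun_cst (2 : R) x (e_ i)) dx).
  rewrite (@derive_val _ _ _ _ _ _ _ H) mulr1n; ring.
rewrite /laplacian (eq_bigr _ (fun i _ => p2 i)) big_split/=.
rewrite sumr_const card_ord -mulr_natr; congr (_ + _); first by ring.
by rewrite -mulr_suml -mulr_sumr.
Qed.

End smooth_expressions.

(** * Truncated profiles as test functions *)

Section cutoff_profile.
Context (R : realType) (n : nat) (a e : R).
Hypotheses (a_ge : 4^-1 <= a) (e0 : 0 < e).
Implicit Types t : R.
Local Notation f := (profile a).

Let diffX (P : {poly R}) : {poly R} := 'X^2 * (P - P^`()).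

(* normalised so as to be 1 at 1 for the constant polynomial 1 *)
Let hat P t : R := expR 1 * bump P t.

Let cut (k : nat) P t : R := hat P (1 - t * k.+1%:R^-1).

(** Shifting the profile by [e > 0] removes its singularity at the origin, and the
    cutoff vanishes outside the ball [|x|^2 < k + 1]. *)
Definition truncated k (x : 'rV[R]_n) : R :=
  f (e + sqnorm x) * cut k 1 (sqnorm x).

(** The Laplacian of [f (e + |x|^2)]. *)
Definition profile_laplacian (x : 'rV[R]_n) : R :=
  2 * n%:R * profile1 a (e + sqnorm x) + 4 * sqnorm x * profile2 a (e + sqnorm x).

Let is_derive_cut k P t : is_derive t 1 (cut k P) (- k.+1%:R^-1 * cut k (diffX P) t).
Proof.
pose K : R := k.+1%:R^-1.
have lin : is_derive t 1 (fun y : R => 1 - y * K) (0 + -1 * K).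
  have H := is_derive_fun_add (is_derive_fun_cst (1 : R) t 1) (is_derive_fun_mul (is_derive_fun_cst (-1 : R) t 1) (is_derive_fun_mul (is_derive_fun_id t) (is_derive_fun_cst K t 1))).
  rewrite (_ : (fun _ => _) = (fun y : R => 1 + -1 * (y * K))); last first.
    by apply/funext => y; rewrite mulN1r.
  by apply: (is_derive_eq H); ring.
have H := is_derive_fun_mul (is_derive_fun_cst (expR 1 : R) t 1)
  (is_derive_fun_comp (f := fun y : R => 1 - y * K) (is_derive_bump P (1 - t * K)) lin).
by apply: (is_derive_eq H); rewrite /cut /hat -/K /diffX; ring.
Qed.

Let is_derive_shifted (g g' : R -> R) t : (forall x : R, 0 < x -> is_derive x 1 g (g' x)) ->
  0 <= t -> is_derive t 1 (fun y => g (e + y)) (g' (e + t)).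
Proof.
move=> dg t0.
have H := is_derive_fun_comp (f := fun y : R => e + y) (dg _ (ltr_wpDr t0 e0))
  (is_derive_fun_add (is_derive_fun_cst e t 1) (is_derive_fun_id t)).
by apply: (is_derive_eq H); rewrite add0r mulr1.
Qed.

Let G k t : R := f (e + t) * cut k 1 t.

Let G1 k t : R := profile1 a (e + t) * cut k 1 t
  + f (e + t) * (- k.+1%:R^-1 * cut k (diffX 1) t).

Let G2 k t : R :=
  (profile2 a (e + t) * cut k 1 t
   + profile1 a (e + t) * (- k.+1%:R^-1 * cut k (diffX 1) t))
  + (profile1 a (e + t) * (- k.+1%:R^-1 * cut k (diffX 1) t)
   + f (e + t) * (- k.+1%:R^-1 * (- k.+1%:R^-1 * cut k (diffX (diffX 1)) t))).

Let laplacian_truncated k x : laplacian (truncated k) x =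
  2 * n%:R * G1 k (sqnorm x) + 4 * sqnorm x * G2 k (sqnorm x).
Proof.
have d0 t := is_derive_shifted (g := f) (t := t) (@is_derive_profile R a).
have d1 t := is_derive_shifted (g := profile1 a) (t := t) (is_derive_profile1 a).
apply: (@laplacian_radial R n (G k)) => t t0.
  exact: (is_derive_fun_mul (d0 t t0) (is_derive_cut k 1 t)).
apply: is_derive_fun_add; apply: is_derive_fun_mul; [exact: d1|exact: is_derive_cut|exact: d0|].
have H := is_derive_fun_mul (is_derive_fun_cst (- k.+1%:R^-1 : R) t 1) (is_derive_cut k (diffX 1) t).
by apply: (is_derive_eq H); rewrite mul0r add0r.
Qed.

Lemma smooth_expr_truncated k : smooth_expr (truncated k).
Proof.
have sq := @smooth_expr_sqnorm R n.
have ep (x : 'rV[R]_n) : 0 < e + sqnorm x by rewrite ltr_wpDr// sqnorm_ge0.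
have sl : smooth_expr (fun x : 'rV[R]_n => ln (e + sqnorm x)).
  by apply: smooth_ln => //; apply: smooth_add => //; exact: smooth_const.
rewrite /truncated; apply: smooth_mul; first apply: smooth_mul.
- by apply/smooth_exp/smooth_mul => //; exact: smooth_const.
- apply: smooth_inv; first by move=> x; rewrite gt_eqF// log_weight_gt0.
  apply: smooth_add; first exact: smooth_const.
  exact: (smooth_mul sl sl).
- apply: smooth_mul; first exact: smooth_const.
  apply: smooth_bump; apply: smooth_add; first exact: smooth_const.
  rewrite (_ : (fun _ => _) = fun x => -1 * (sqnorm x * k.+1%:R^-1)); last first.
    by apply/funext => x; rewrite mulN1r.
  apply: smooth_mul; first exact: smooth_const.
  by apply: smooth_mul => //; exact: smooth_const.
Qed.

Lemma test_function_truncated k : test_function (truncated k).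
Proof.
split; first exact/smooth_expr_smooth/smooth_expr_truncated.
apply: (@compact_support_in_ball _ _ k.+1%:R) => x; apply: contra_neqP.
move/negP; rewrite -ltNge => kx; rewrite /truncated /cut /hat /bump ifF ?mulr0//.
by apply/negbTE; rewrite -leNgt subr_le0 ler_pdivlMr// mul1r ltW.
Qed.

(** Every derivative of the profile costs a factor [1 / (e + t)], where
    [t = |x|^2], and every derivative of the cutoff a factor [1 / (k + 1)]. The
    Laplacian has terms with a factor [t], which is absorbed by [e + t] or, on the
    support of the cutoff, by [k + 1]. Hence one bound for all [k]. *)
Lemma truncated_bounded : exists2 C, 0 <= C & forall k x,
  `|truncated k x| <= C * f (e + sqnorm x) /\
  `|laplacian (truncated k) x| <= C * f (e + sqnorm x).
Proof.
have bn (P : {poly R}) : exists2 M, 0 <= M & forall k t, `|cut k P t| <= M.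
  have [M M0 bM] := bump_bounded P; exists (expR 1 * M); first by rewrite mulr_ge0 ?expR_ge0.
  by move=> k t; rewrite /cut /hat normrM (ger0_norm (expR_ge0 _)) ler_wpM2l ?expR_ge0.
have [M0 M00 bM0] := bn 1; have [M1 M10 bM1] := bn (diffX 1).
have [M2 M20 bM2] := bn (diffX (diffX 1)).
have b1 : 0 <= slope_bound a by apply: le_trans (slope_bound_ge1 a_ge).
pose c := slope_bound a.
exists (M0 + (2 * n%:R * (c / e * M0 + M1) + 4 * (c / e * M0 + 2 * c * M1 + M2))).
  have ce0 : 0 <= c / e by rewrite divr_ge0// ltW.
  by do ?[exact: ce0|by []|apply: addr_ge0|apply: mulr_ge0].
move=> k x; set t := sqnorm x; set F := f (e + t).
have t0 : 0 <= t := sqnorm_ge0 x.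
have et0 : 0 < e + t by rewrite ltr_wpDr.
have F0 : 0 <= F by rewrite ltW// profile_gt0.
pose K : R := k.+1%:R^-1.
have K0 : 0 <= K by rewrite invr_ge0.
have K1 : K <= 1 by rewrite invf_le1// ler1n.
have iet : (e + t)^-1 <= e^-1 by rewrite lef_pV2 ?posrE// lerDl.
have tet : t / (e + t) <= 1 by rewrite ler_pdivrMr// mul1r lerDr ltW.
have i0 : 0 <= (e + t)^-1 by rewrite invr_ge0 ltW.
have cF0 : 0 <= c * F by exact: mulr_ge0.
have f1 : `|profile1 a (e + t)| <= c / e * F.
  apply: le_trans (profile1_le a_ge et0) _.
  by rewrite mulrAC ler_wpM2r// ler_wpM2l.
have f1t : t * `|profile1 a (e + t)| <= c * F.
  apply: le_trans (ler_wpM2l t0 (profile1_le a_ge et0)) _.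
  by rewrite mulrCA ler_piMr// mulr_ge0.
have f2t : t * `|profile2 a (e + t)| <= c / e * F.
  apply: le_trans (ler_wpM2l t0 (profile2_le a_ge et0)) _.
  rewrite expr2 invfM (_ : t * _ = (t / (e + t)) * (c * F / (e + t))); last by rewrite /c /F; ring.
  apply: (@le_trans _ _ (1 * (c * F / (e + t)))).
    by apply: ler_wpM2r => //; exact: mulr_ge0.
  by rewrite mul1r [leRHS]mulrAC ler_wpM2l// mulr_ge0.
have tK : `|cut k (diffX (diffX 1)) t| * (t * K) <= M2.
  have [tK1|tK1] := ltP (t * K) 1.
    by apply: le_trans (bM2 k t); rewrite ler_piMr// ltW.
  rewrite {1}/cut /hat /bump -/K subr_gt0 ltNge tK1/= mulr0 normr0 mul0r.
  exact: M20.
have X0 := bM0 k t; have X1 := bM1 k t.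
have KN : `|- K| = K by rewrite normrN ger0_norm.
have h0 : `|truncated k x| <= M0 * F.
  by rewrite /truncated normrM -/t -/F (ger0_norm F0) mulrC ler_wpM2r.
have hG1 : `|G1 k t| <= (c / e * M0 + M1) * F.
  apply: le_trans (ler_normD _ _) _; rewrite mulrDl lerD//.
    by rewrite normrM mulrAC ler_pM.
  rewrite normrM (ger0_norm F0) -/K normrM KN mulrC ler_wpM2r//.
  by apply: le_trans X1; rewrite ler_piMl.
have hG2 : t * `|G2 k t| <= (c / e * M0 + 2 * c * M1 + M2) * F.
  have hd : t * `|profile1 a (e + t) * (- K * cut k (diffX 1) t)| <= c * M1 * F.
    rewrite normrM [`|- K * _|]normrM KN.
    rewrite (_ : t * _ = t * `|profile1 a (e + t)| * (K * `|cut k (diffX 1) t|)); last by ring.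
    rewrite [leRHS]mulrAC; apply: ler_pM => //.
    - exact: mulr_ge0.
    - exact: mulr_ge0.
    - by apply: le_trans X1; rewrite ler_piMl.
  have ha : t * `|profile2 a (e + t) * cut k 1 t| <= c / e * M0 * F.
    by rewrite normrM mulrA [leRHS]mulrAC; apply: ler_pM => //; exact: mulr_ge0.
  have hb : t * `|F * (- K * (- K * cut k (diffX (diffX 1)) t))| <= M2 * F.
    rewrite normrM (ger0_norm F0) normrM KN normrM KN.
    rewrite (_ : t * _ = K * (`|cut k (diffX (diffX 1)) t| * (t * K)) * F); last by ring.
    rewrite ler_wpM2r//; apply: le_trans tK; rewrite ler_piMl//.
    by rewrite !mulr_ge0.
  apply: le_trans (ler_wpM2l t0 (ler_normD _ _)) _.
  apply: le_trans (ler_wpM2l t0 (lerD (ler_normD _ _) (ler_normD _ _))) _.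
  rewrite [leLHS]mulrDr [X in X + _ <= _]mulrDr [X in _ + X <= _]mulrDr -/K -/F.
  have -> : (c / e * M0 + 2 * c * M1 + M2) * F =
    c / e * M0 * F + c * M1 * F + (c * M1 * F + M2 * F) by ring.
  exact: lerD (lerD ha hd) (lerD hd hb).
have hL : `|laplacian (truncated k) x| <=
    (2 * n%:R * (c / e * M0 + M1) + 4 * (c / e * M0 + 2 * c * M1 + M2)) * F.
  rewrite laplacian_truncated -/t; apply: le_trans (ler_normD _ _) _.
  rewrite [leRHS]mulrDl lerD//.
    by rewrite normrM ger0_norm ?mulr_ge0// -mulrA ler_wpM2l ?mulr_ge0.
  rewrite -mulrA normrM ger0_norm// -[leRHS]mulrA ler_wpM2l//.
  by rewrite normrM (ger0_norm t0).
have pos0 : 0 <= M0 * F by rewrite mulr_ge0.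
have posL := le_trans (normr_ge0 _) hL.
by rewrite mulrDl; split; [apply: le_trans h0 _; rewrite lerDl|
  apply: le_trans hL _; rewrite lerDr].
Qed.

Let cut_cvg P t : cut k P t @[k --> \oo] --> hat P 1.
Proof.
apply: (@continuous_cvg _ _ _ _ _ _ (hat P)).
  apply: continuousM; first exact: cst_continuous.
  exact: continuous_bump.
rewrite -[X in _ --> X]subr0 -(mulr0 t).
apply: cvgB; first exact: cvg_cst.
by apply: cvgM; [exact: cvg_cst|exact: cvg_harmonic].
Qed.

Let hat11 : hat 1 1 = 1.
Proof.
by rewrite /hat /bump ltr01 hornerC mul1r invr1 -expRD subrr expR0.
Qed.

Let invN_cvg : - k.+1%:R^-1 @[k --> \oo] --> (0 : R).
Proof. by rewrite -oppr0; apply: cvgN; exact: cvg_harmonic. Qed.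

Lemma truncated_cvg x :
  truncated k x @[k --> \oo] --> f (e + sqnorm x).
Proof.
rewrite -[X in _ --> X]mulr1 -hat11.
by apply: cvgM; [exact: cvg_cst|exact: cut_cvg].
Qed.

Lemma laplacian_truncated_cvg x :
  laplacian (truncated k) x @[k --> \oo] --> profile_laplacian x.
Proof.
under eq_fun do rewrite laplacian_truncated.
set t := sqnorm x.
have small (c : R) P : c * (- k.+1%:R^-1 * cut k P t) @[k --> \oo] --> c * (0 * hat P 1).
  by apply: cvgM; [exact: cvg_cst|apply: cvgM; [exact: invN_cvg|exact: cut_cvg]].
apply: cvgD; apply: cvgM; try exact: cvg_cst.
  rewrite (_ : profile1 a (e + t) = profile1 a (e + t) * hat 1 1
    + f (e + t) * (0 * hat (diffX 1) 1)); last by rewrite hat11; ring.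
  apply: cvgD; last exact: small.
  by apply: cvgM; [exact: cvg_cst|exact: cut_cvg].
rewrite (_ : profile2 a (e + t) = (profile2 a (e + t) * hat 1 1
   + profile1 a (e + t) * (0 * hat (diffX 1) 1))
  + (profile1 a (e + t) * (0 * hat (diffX 1) 1)
   + f (e + t) * (0 * (0 * hat (diffX (diffX 1)) 1)))); last first.
  by rewrite hat11; ring.
apply: cvgD; apply: cvgD.
- by apply: cvgM; [exact: cvg_cst|exact: cut_cvg].
- exact: small.
- exact: small.
- apply: cvgM; first exact: cvg_cst.
  apply: cvgM; first exact: invN_cvg.
  by apply: cvgM; [exact: invN_cvg|exact: cut_cvg].
Qed.

End cutoff_profile.

(** * Real square integrable functions *)

Section square_integrable.
Context d (T : measurableType d) (R : realType).
Variable mu : {measure set T -> \bar R}.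
Implicit Types (w v D : T -> R).

Definition L2 w := measurable_fun setT w /\
  mu.-integrable setT (fun x => (w x ^+ 2)%:E).

Definition ip w v : R := \int[mu]_x (w x * v x).

(** The square of the norm: working with it avoids extended reals and square
    roots. *)
Definition L2sq w : R := ip w w.

Import HBNNSimple.

(** Integrals of nonnegative functions are suprema over simple functions below
    them, hence monotone even for functions that are not known to be
    measurable. *)
Lemma integral_mono (A : set T) (f g : T -> \bar R) :
  (forall x, A x -> 0 <= f x)%E -> (forall x, A x -> f x <= g x)%E ->
  (\int[mu]_(x in A) f x <= \int[mu]_(x in A) g x)%E.
Proof.
move=> f0 fg; rewrite [leLHS]integral_mkcond [leRHS]integral_mkcond.
have fgA x : ((f \_ A) x <= (g \_ A) x)%E by apply: lee_restrict.
have f0A x : (0 <= (f \_ A) x)%E by exact: erestrict_ge0.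
rewrite !ge0_integralTE//; last by move=> x; exact: le_trans (fgA x).
apply: le_ereal_sup => _ [h hf <-]; exists h => // x.
exact: le_trans (hf x) (fgA x).
Qed.

Lemma L2P w : measurable_fun setT w ->
  (\int[mu]_x (w x ^+ 2)%:E < +oo)%E -> L2 w.
Proof.
move=> mw wfin; split=> //; apply/integrableP; split.
  by apply/measurable_EFinP; exact: measurable_funX.
by under eq_integral do rewrite gee0_abs ?lee_fin ?sqr_ge0//.
Qed.

Lemma L2_le w D : measurable_fun setT w -> L2 D ->
  (forall x, `|w x| <= `|D x|) -> L2 w.
Proof.
move=> mw [mD iD] wD; split=> //.
apply: (le_integrable _ _ _ iD) => //.
  by apply/measurable_EFinP; exact: measurable_funX.
move=> x _ /=; rewrite lee_fin !ger0_norm ?sqr_ge0//.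
by rewrite -[leLHS]real_normK ?num_real// -[leRHS]real_normK ?num_real// lerXn2r ?nnegrE.
Qed.

Lemma L2_le_ae w D : measurable_fun setT w -> L2 D ->
  {ae mu, forall x, `|w x| <= `|D x|} -> L2 w.
Proof.
move=> mw [mD iD] wD; apply: L2P => //.
have /integrableP[_] := iD; apply: le_lt_trans.
apply: ae_ge0_le_integral => //.
- by move=> x _; rewrite lee_fin sqr_ge0.
- by apply/measurable_EFinP; exact: measurable_funX.
- by apply/measurableT_comp => //; apply/measurable_EFinP; exact: measurable_funX.
- apply: filterS wD => x wDx _ /=; rewrite lee_fin (ger0_norm (sqr_ge0 _)).
  by rewrite -[leLHS]real_normK ?num_real// -[leRHS]real_normK ?num_real// lerXn2r ?nnegrE.
Qed.

Lemma L2_integrable w v : L2 w -> L2 v ->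
  mu.-integrable setT (fun x => (w x * v x)%:E).
Proof.
move=> [mw iw] [mv iv]; have iwv := integrableD measurableT iw iv.
apply: (le_integrable _ _ _ iwv) => //.
  by apply/measurable_EFinP; exact: measurable_funM.
move=> x _ /=; rewrite lee_fin normrM [leRHS]ger0_norm ?addr_ge0 ?sqr_ge0//.
rewrite -[w x ^+ 2]real_normK ?num_real// -[v x ^+ 2]real_normK ?num_real//.
have : 0 <= (`|w x| - `|v x|) ^+ 2 by exact: sqr_ge0.
have : 0 <= `|w x| * `|v x| by exact: mulr_ge0.
rewrite sqrrB -mulr_natr => h1 h2.
rewrite -subr_ge0 (_ : _ - _ = (`|w x| ^+ 2 - `|w x| * `|v x| * 2 + `|v x| ^+ 2)
  + `|w x| * `|v x|); last by ring.
exact: addr_ge0.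
Qed.

Lemma L2_scale c w : L2 w -> L2 (fun x => c * w x).
Proof.
move=> [mw iw]; split; first exact: measurable_funM.
have := integrableZl measurableT (c ^+ 2) iw.
by apply: eq_integrable => // x _; rewrite -EFinM exprMn.
Qed.

Lemma L2_add w v : L2 w -> L2 v -> L2 (fun x => w x + v x).
Proof.
move=> hw hv; have [mw iw] := hw; have [mv iv] := hv.
split; first exact: measurable_funD.
have i2 := integrableZl measurableT 2 (L2_integrable hw hv).
have := integrableD measurableT (integrableD measurableT iw i2) iv.
apply: eq_integrable => // x _ /=; rewrite -EFinM -!EFinD sqrrD.
by rewrite mulr_natl.
Qed.

Lemma L2_opp w : L2 w -> L2 (fun x => - w x).
Proof.
move=> /(L2_scale (-1)); rewrite (_ : (fun _ => _) = (fun x => - w x))//.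
by apply/funext => x; rewrite mulN1r.
Qed.

Lemma L2_sub w v : L2 w -> L2 v -> L2 (fun x => w x - v x).
Proof. by move=> hw hv; apply: L2_add => //; exact: L2_opp. Qed.

Lemma ipC w v : ip w v = ip v w.
Proof. by apply: eq_Rintegral => x _; rewrite mulrC. Qed.

Lemma ipDl w1 w2 v : L2 w1 -> L2 w2 -> L2 v ->
  ip (fun x => w1 x + w2 x) v = ip w1 v + ip w2 v.
Proof.
move=> h1 h2 hv; rewrite /ip -RintegralD//; last 2 first.
  exact: L2_integrable.
  exact: L2_integrable.
by apply: eq_Rintegral => x _; rewrite mulrDl.
Qed.

Lemma ipZl c w v : L2 w -> L2 v -> ip (fun x => c * w x) v = c * ip w v.
Proof.
move=> hw hv; rewrite /ip -RintegralZl//; last exact: L2_integrable.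
by apply: eq_Rintegral => x _; rewrite mulrA.
Qed.

Lemma ipNl w v : L2 w -> L2 v -> ip (fun x => - w x) v = - ip w v.
Proof.
move=> hw hv; rewrite -mulN1r -ipZl//.
by congr ip; apply/funext => x; rewrite mulN1r.
Qed.

Lemma ipBl w1 w2 v : L2 w1 -> L2 w2 -> L2 v ->
  ip (fun x => w1 x - w2 x) v = ip w1 v - ip w2 v.
Proof. by move=> *; rewrite ipDl ?ipNl//; exact: L2_opp. Qed.

Lemma ipDr w1 w2 v : L2 w1 -> L2 w2 -> L2 v ->
  ip v (fun x => w1 x + w2 x) = ip v w1 + ip v w2.
Proof. by move=> *; rewrite ipC ipDl// ipC [ip w2 _]ipC. Qed.

Lemma ipNr w v : L2 w -> L2 v -> ip v (fun x => - w x) = - ip v w.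
Proof. by move=> *; rewrite ipC ipNl// ipC. Qed.

Lemma ipBr w1 w2 v : L2 w1 -> L2 w2 -> L2 v ->
  ip v (fun x => w1 x - w2 x) = ip v w1 - ip v w2.
Proof. by move=> *; rewrite ipC ipBl// ipC [ip w2 _]ipC. Qed.

Lemma L2sq_ge0 w : 0 <= L2sq w.
Proof. by apply: Rintegral_ge0 => x _; rewrite -expr2 sqr_ge0. Qed.

Lemma ip_zero v : ip (fun _ => 0) v = 0.
Proof.
by rewrite /ip /Rintegral; under eq_integral do rewrite mul0r; rewrite integral0.
Qed.

Lemma L2sq_zero : L2sq (fun _ => 0) = 0.
Proof. exact: ip_zero. Qed.

Lemma L2sq_opp w : L2sq (fun x => - w x) = L2sq w.
Proof. by apply: eq_Rintegral => x _; rewrite mulrNN. Qed.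

Lemma L2sq_scale c w : L2 w -> L2sq (fun x => c * w x) = c ^+ 2 * L2sq w.
Proof.
by move=> hw; have hc := L2_scale c hw; rewrite /L2sq ipZl// ipC ipZl// mulrA expr2.
Qed.

Lemma L2sq_le w D : L2 w -> L2 D -> (forall x, `|w x| <= `|D x|) -> L2sq w <= L2sq D.
Proof.
move=> hw hD wD; apply: le_Rintegral => //; try exact: L2_integrable.
move=> x _; rewrite -!expr2 -[leLHS]real_normK ?num_real//.
by rewrite -[leRHS]real_normK ?num_real// lerXn2r ?nnegrE.
Qed.

Lemma L2sq_add_le w v : L2 w -> L2 v ->
  L2sq (fun x => w x + v x) <= 2 * L2sq w + 2 * L2sq v.
Proof.
move=> hw hv; have hs := L2_add hw hv; have hd := L2_sub hw hv.
have : 0 <= L2sq (fun x => w x - v x) by exact: L2sq_ge0.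
rewrite /L2sq ipBl// !ipBr// ipDl// !ipDr// [ip v w]ipC => ?; lra.
Qed.

Lemma cauchy_schwarz w v : L2 w -> L2 v -> ip w v ^+ 2 <= L2sq w * L2sq v.
Proof.
move=> hw hv.
(* the square of the norm of a * w - b * v *)
have q (a b : R) : 0 <= a ^+ 2 * L2sq w - 2 * a * b * ip w v + b ^+ 2 * L2sq v.
  have hs := L2_sub (L2_scale a hw) (L2_scale b hv).
  have := L2sq_ge0 (fun x => a * w x - b * v x).
  have ha := L2_scale a hw; have hb := L2_scale b hv.
  rewrite /L2sq ipBl// !ipBr// !ipZl// ![ip _ (fun x => _ * _)]ipC !ipZl//.
  rewrite [ip v w]ipC => h; apply: le_trans h _.
  by rewrite le_eqVlt; apply/orP; left; apply/eqP; ring.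
have v0 := L2sq_ge0 v; have w0 := L2sq_ge0 w.
have [v00|vN0] := eqVneq (L2sq v) 0.
  have := q (ip w v) ((1 + L2sq w)); rewrite v00 mulr0.
  have := sqr_ge0 (ip w v); rewrite !expr2 => h1 h2; nra.
have vp : 0 < L2sq v by rewrite lt_neqAle eq_sym vN0.
have := q (L2sq v) (ip w v).
rewrite (_ : _ + _ = L2sq v * (L2sq w * L2sq v - ip w v ^+ 2)); last by ring.
by rewrite pmulr_rge0// subr_ge0.
Qed.

Lemma ip_norm_le w v : L2 w -> L2 v ->
  `|ip w v| <= Num.sqrt (L2sq w) * Num.sqrt (L2sq v).
Proof.
move=> hw hv; rewrite -sqrtrM ?L2sq_ge0// -sqrtr_sqr ler_wsqrtr//.
exact: cauchy_schwarz.
Qed.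

Lemma ip_cvg (I : Type) (F : set_system I) (FF : ProperFilter F)
    (w v : I -> T -> R) w0 v0 :
  (forall i, L2 (w i)) -> (forall i, L2 (v i)) -> L2 w0 -> L2 v0 ->
  L2sq (fun x => w i x - w0 x) @[i --> F] --> 0 ->
  L2sq (fun x => v i x - v0 x) @[i --> F] --> 0 ->
  ip (w i) (v i) @[i --> F] --> ip w0 v0.
Proof.
move=> hw hv hw0 hv0 cw cv.
have sq0 (f : I -> R) : f i @[i --> F] --> 0 -> Num.sqrt (f i) @[i --> F] --> 0.
  by move=> cf; rewrite -(@sqrtr0 R); apply: continuous_cvg cf; exact: sqrt_continuous.
have dw i := L2_sub (hw i) hw0; have dv i := L2_sub (hv i) hv0.
pose A i := Num.sqrt (L2sq (fun x => w i x - w0 x)).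
pose B i := Num.sqrt (L2sq (fun x => v i x - v0 x)).
have cA : A i @[i --> F] --> 0 by exact: sq0.
have cB : B i @[i --> F] --> 0 by exact: sq0.
pose bound i := A i * B i + A i * Num.sqrt (L2sq v0) + Num.sqrt (L2sq w0) * B i.
have cb : bound i @[i --> F] --> 0.
  rewrite [X in _ --> X](_ : 0 = 0 * 0 + 0 * Num.sqrt (L2sq v0) + Num.sqrt (L2sq w0) * 0); last by ring.
  apply: cvgD; first apply: cvgD; apply: cvgM => //; exact: cvg_cst.
apply/cvgrPdist_lt => /= e e0; move/cvgrPdist_lt: cb => /(_ e e0).
apply: filterS => i; rewrite sub0r normrN => /(le_lt_trans (ler_norm _)).
apply: le_lt_trans.
rewrite (_ : ip w0 v0 - ip (w i) (v i) =
  - (ip (fun x => w i x - w0 x) (fun x => v i x - v0 x)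
   + ip (fun x => w i x - w0 x) v0 + ip w0 (fun x => v i x - v0 x))); last first.
  by rewrite !ipBl// !ipBr//; ring.
rewrite normrN; apply: le_trans (ler_normD _ _) _; apply: lerD; last exact: ip_norm_le.
by apply: le_trans (ler_normD _ _) _; apply: lerD; exact: ip_norm_le.
Qed.

(** The squares of the differences are dominated by [4 * D ^+ 2]. *)
Lemma L2_dominated_convergence (w : nat -> T -> R) w0 D :
    (forall k, measurable_fun setT (w k)) -> measurable_fun setT w0 -> L2 D ->
    {ae mu, forall x, w k x @[k --> \oo] --> w0 x} ->
    {ae mu, forall x k, `|w k x| <= D x} ->
  L2sq (fun x => w k x - w0 x) @[k --> \oo] --> 0.
Proof.
move=> mw mw0 hD cw wD; have [mD iD] := hD.
pose f k x := ((w k x - w0 x) ^+ 2)%:E.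
have mf k : measurable_fun setT (f k).
  by apply/measurable_EFinP/measurable_funX; exact: measurable_funB.
have [||||_ _ cv] := @dominated_convergence _ _ _ mu setT measurableT f
   (fun _ => 0%E) (fun x => (4 * D x ^+ 2)%:E) mf.
- exact: measurable_cst.
- apply: filterS cw => x cx _; apply/fine_cvgP; split; first exact: nearW.
  rewrite /f /= -[X in _ --> X](mulr0 (0 : R)).
  have h : w k x - w0 x @[k --> \oo] --> 0.
    by rewrite -[X in _ --> X](subrr (w0 x)); apply: cvgB => //; exact: cvg_cst.
  rewrite (_ : _ \o _ = (fun k => (w k x - w0 x) * (w k x - w0 x))); first exact: cvgM.
  by apply/funext => k /=; rewrite expr2.
- have := integrableZl measurableT 4 iD.
  by apply: eq_integrable => // x _; rewrite -EFinM.
- apply: filterS2 cw wD => x cx xD k _.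
  have D0 : 0 <= D x by rewrite (le_trans _ (xD 0%N)).
  have w0D : `|w0 x| <= D x.
    rewrite -(cvg_lim _ (cvg_norm cx))//; apply: limr_le.
      by apply/cvg_ex; eexists; exact: (cvg_norm cx).
    by apply: nearW => j; exact: xD.
  rewrite lee_fin ger0_norm ?sqr_ge0// (_ : 4 * D x ^+ 2 = (2 * D x) ^+ 2); last by ring.
  rewrite -[leLHS]real_normK ?num_real// lerXn2r ?nnegrE ?mulr_ge0//.
  by rewrite (le_trans (ler_normB _ _))// mulr_natl mulr2n lerD.
move: cv; rewrite integral0 => /fine_cvgP[_]; apply: cvg_trans.
by apply: near_eq_cvg; apply: nearW => k; rewrite /L2sq /ip /Rintegral/=.
Qed.

End square_integrable.

Section curves_in_L2.
Context (R : realType).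

Lemma cvg0_le (I : Type) (F : set_system I) (FF : Filter F) (f g : I -> R) :
  (forall i, 0 <= f i <= g i) -> g i @[i --> F] --> 0 -> f i @[i --> F] --> 0.
Proof.
move=> fg /cvgrPdist_lt cg; apply/cvgrPdist_lt => e e0.
apply: filterS (cg e e0) => i; have /andP[f0 fgi] := fg i.
by rewrite !sub0r !normrN !ger0_norm ?(le_trans f0)//; exact: le_lt_trans.
Qed.

(** The dominated convergence theorem is about sequences; this makes it available
    along a real parameter. *)
Lemma cvg_within_seq (A : set R) (t : R) (f : R -> R) (l : R) :
    (forall u : nat -> R, (forall k, A (u k)) -> u k @[k --> \oo] --> t ->
      f (u k) @[k --> \oo] --> l) ->
  f x @[x --> within A (nbhs t)] --> l.
Proof.
move=> h; apply: contrapT => nf.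
have [e e0 ne] : exists2 e : R, 0 < e &
    forall k : nat, exists y, [/\ A y, `|y - t| < k.+1%:R^-1 & e <= `|l - f y|].
  apply: contrapT => hn; apply: nf; apply/cvgrPdist_lt => /= e e0.
  apply: contrapT => ne; apply: hn; exists e => // k.
  apply: contrapT => nk; apply: ne; rewrite near_withinE.
  exists k.+1%:R^-1 => //=.
  move=> y /= ty Ay; rewrite ltNge; apply/negP => ey; apply: nk; exists y; split=> //.
  by rewrite distrC.
have [u hu] := choice ne.
have : f (u k) @[k --> \oo] --> l.
  apply: h; first by move=> k; case: (hu k).
  apply/cvgrPdist_lt => /= d d0.
  have := @cvg_harmonic R; move=> /cvgrPdist_lt/(_ d d0); apply: filterS => k.
  rewrite sub0r normrN /= ger0_norm ?invr_ge0// => kd.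
  by case: (hu k) => _ ut _; rewrite distrC; exact: lt_trans kd.
move=> /cvgrPdist_lt/(_ e e0)[k _ hk].
by have := hk k (leqnn k) => /=; case: (hu k) => _ _; rewrite leNgt => /negP.
Qed.

Lemma within_setT (t : R) : within setT (nbhs t) = nbhs t :> set_system R.
Proof.
apply/seteqP; split=> A.
  by rewrite /within/= => h; apply: filterS h => x; apply.
by move=> h; rewrite /within/=; apply: filterS h => x Ax _.
Qed.

Lemma cvg_within_seq_near (A B : set R) (t : R) (f : R -> R) (l : R) :
    nbhs t B ->
    (forall u : nat -> R, (forall k, A (u k) /\ B (u k)) -> u k @[k --> \oo] --> t ->
      f (u k) @[k --> \oo] --> l) ->
  f x @[x --> within A (nbhs t)] --> l.
Proof.
move=> tB h; have {h} := @cvg_within_seq (A `&` B) t f l h.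
apply: cvg_trans => S; rewrite /= !near_simpl /within/= => hS.
by apply: filterS2 tB hS => y By yS Ay; exact: yS.
Qed.

Lemma is_derive_quotient (f : R -> R) (x l : R) :
  (f y - f x) / (y - x) @[y --> x^'] --> l -> is_derive x 1 f l.
Proof.
move=> h; apply/is_derive1_caratheodory.
exists (fun y => if y == x then l else (f y - f x) / (y - x)); split.
- move=> y; case: eqVneq => [->|yx]; first by rewrite !subrr mulr0.
  by rewrite divfK// subr_eq0.
- apply/continuous_withinNx; rewrite eqxx; apply: cvg_trans h.
  apply: near_eq_cvg; rewrite near_withinE; apply: nearW => y yx.
  by rewrite ifN.
- by rewrite eqxx.
Qed.

Lemma is_derive_quotientP (f : R -> R) (x l : R) :
  is_derive x 1 f l -> (f y - f x) / (y - x) @[y --> x^'] --> l.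
Proof.
move=> /is_derive1_caratheodory[g [fg /continuous_withinNx cg <-]].
apply: cvg_trans cg; apply: near_eq_cvg; rewrite near_withinE.
by apply: nearW => y yx; rewrite fg mulfK// subr_eq0.
Qed.

End curves_in_L2.

(** * Complex square integrable functions *)

Section complex_parts.
Context (R : realType).
Implicit Types y z : R[i].
Local Notation Re := complex.Re.
Local Notation Im := complex.Im.

Lemma ReD y z : Re (y + z) = Re y + Re z. Proof. by case: y z => [? ?] [? ?]. Qed.
Lemma ImD y z : Im (y + z) = Im y + Im z. Proof. by case: y z => [? ?] [? ?]. Qed.
Lemma ReN z : Re (- z) = - Re z. Proof. by case: z. Qed.
Lemma ImN z : Im (- z) = - Im z. Proof. by case: z. Qed.
Lemma ReM y z : Re (y * z) = Re y * Re z - Im y * Im z.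
Proof. by case: y z => [? ?] [? ?]. Qed.
Lemma ImM y z : Im (y * z) = Re y * Im z + Im y * Re z.
Proof. by case: y z => [? ?] [? ?]. Qed.
Lemma Re_conjc z : Re (conjc z) = Re z. Proof. by case: z. Qed.
Lemma Im_conjc z : Im (conjc z) = - Im z. Proof. by case: z. Qed.

Lemma complex_ext y z : Re y = Re z -> Im y = Im z -> y = z.
Proof. by case: y z => [a b] [c e] /= -> ->. Qed.

Lemma modulus_ge0 z : 0 <= modulus z.
Proof. by case: z => a b; rewrite /modulus/= sqrtr_ge0. Qed.

Lemma modulus_sqr z : modulus z ^+ 2 = Re z ^+ 2 + Im z ^+ 2.
Proof. by case: z => a b; rewrite /modulus/= sqr_sqrtr// addr_ge0// sqr_ge0. Qed.

Lemma modulus_le z : modulus z <= `|Re z| + `|Im z|.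
Proof.
rewrite -(@ler_pXn2r _ 2) ?nnegrE ?modulus_ge0 ?addr_ge0// modulus_sqr sqrrD.
rewrite -[Re z ^+ 2]real_normK ?num_real// -[Im z ^+ 2]real_normK ?num_real//.
by rewrite lerD2r lerDl mulrn_wge0// mulr_ge0.
Qed.

Lemma modulus_real (r : R) : modulus (Complex r 0) = `|r|.
Proof. by rewrite /modulus/= expr0n/= addr0 sqrtr_sqr. Qed.

End complex_parts.

Section complex_L2.
Context (R : realType) (n : nat).
Local Notation Re := complex.Re.
Local Notation Im := complex.Im.
Local Notation nu := (lebesgue_row R n).
Local Notation fct := ('rV[R]_n -> R[i]).
Implicit Types f g h : fct.
Local Notation re f := (fun x => Re (f x)).
Local Notation im f := (fun x => Im (f x)).
Local Notation L2 := (L2 nu).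
Local Notation ip := (ip nu).
Local Notation L2sq := (L2sq nu).

Lemma measurable_modulus d (T : measurableType d) (D : set T) (f : T -> R[i]) :
  cmeasurable D f -> measurable_fun D (fun x => modulus (f x)).
Proof.
move=> [mr mi]; rewrite (_ : (fun _ => _) =
    fun x => Num.sqrt (Re (f x) ^+ 2 + Im (f x) ^+ 2)).
  apply: (@measurableT_comp _ _ _ _ _ _ (@Num.sqrt R)).
    by apply: continuous_measurable_fun; exact: sqrt_continuous.
  by apply: measurable_funD; exact: measurable_funX.
by apply/funext => x; rewrite -modulus_sqr sqrtr_sqr ger0_norm// modulus_ge0.
Qed.

Lemma Lq_norm2_sqr f : Lq_norm 2%:E f =
  ((\int[nu]_x (modulus (f x) ^+ 2)%:E) `^ 2^-1)%E.
Proof.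
rewrite /Lq_norm unlock; congr (_ `^ _)%E; apply: eq_integral => x _.
by rewrite /= ger0_norm ?modulus_ge0// powR_mulrn ?modulus_ge0.
Qed.

Lemma in_Lq2P f : in_Lq 2%:E f <-> L2 (re f) /\ L2 (im f).
Proof.
split=> [[[mr mi] fin]|[hr hi]].
  have mm := measurable_modulus (conj mr mi).
  have hm : L2 (fun x => modulus (f x)).
    apply: L2P => //; move: fin; rewrite Lq_norm2_sqr => /lty_poweRy; apply.
    by rewrite invr_eq0.
  have le1 x : `|Re (f x)| <= `|modulus (f x)|.
    rewrite (ger0_norm (modulus_ge0 _)) -(@ler_pXn2r _ 2) ?nnegrE ?modulus_ge0//.
    by rewrite modulus_sqr real_normK ?num_real// lerDl sqr_ge0.
  have le2 x : `|Im (f x)| <= `|modulus (f x)|.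
    rewrite (ger0_norm (modulus_ge0 _)) -(@ler_pXn2r _ 2) ?nnegrE ?modulus_ge0//.
    by rewrite modulus_sqr real_normK ?num_real// lerDr sqr_ge0.
  by split; [exact: L2_le hm le1|exact: L2_le hm le2].
split; first by split; [case: hr|case: hi].
rewrite Lq_norm2_sqr poweR_lty//.
have [_ /integrableP[_ +]] := hr; have [_ /integrableP[_ +]] := hi.
have [mr _] := hr; have [mi _] := hi.
under eq_integral do rewrite gee0_abs ?lee_fin ?sqr_ge0//.
move=> fi; under eq_integral do rewrite gee0_abs ?lee_fin ?sqr_ge0//.
move=> fr; under eq_integral do rewrite modulus_sqr EFinD.
rewrite ge0_integralD//; first exact: lte_add_pinfty.
- by move=> x _; rewrite lee_fin sqr_ge0.
- by apply/measurable_EFinP; exact: measurable_funX.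
- by move=> x _; rewrite lee_fin sqr_ge0.
- by apply/measurable_EFinP; exact: measurable_funX.
Qed.

(** The square of the norm of a complex function, again as a real number. *)
Definition cL2sq f : R := L2sq (re f) + L2sq (im f).

Lemma cL2sq_ge0 f : 0 <= cL2sq f.
Proof. by rewrite addr_ge0// L2sq_ge0. Qed.

Lemma Lq_norm2E f : in_Lq 2%:E f -> Lq_norm 2%:E f = (Num.sqrt (cL2sq f))%:E.
Proof.
move=> /in_Lq2P[hr hi].
rewrite Lq_norm2_sqr -powR12_sqrt ?cL2sq_ge0// -poweR_EFin; congr (_ `^ _)%E.
have ii w : L2 w -> (\int[nu]_x (w x ^+ 2)%:E = (L2sq w)%:E)%E.
  move=> [mw iw]; rewrite /L2sq /ip /Rintegral fineK//.
  by have := integrable_fin_num measurableT iw.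
have [mr _] := hr; have [mi _] := hi.
under eq_integral do rewrite modulus_sqr EFinD.
rewrite ge0_integralD ?ii ?EFinD//.
- by move=> x _; rewrite lee_fin sqr_ge0.
- by apply/measurable_EFinP; exact: measurable_funX.
- by move=> x _; rewrite lee_fin sqr_ge0.
- by apply/measurable_EFinP; exact: measurable_funX.
Qed.

Lemma in_Lq2_add f g : in_Lq 2%:E f -> in_Lq 2%:E g -> in_Lq 2%:E (fun x => f x + g x).
Proof.
move=> /in_Lq2P[a b] /in_Lq2P[c e]; apply/in_Lq2P; split.
  by under eq_fun do rewrite ReD; exact: L2_add.
by under eq_fun do rewrite ImD; exact: L2_add.
Qed.

Lemma in_Lq2_scale (c : R[i]) f : in_Lq 2%:E f -> in_Lq 2%:E (fun x => c * f x).
Proof.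
move=> /in_Lq2P[a b]; apply/in_Lq2P; split.
  by under eq_fun do rewrite ReM; apply: L2_sub; exact: L2_scale.
by under eq_fun do rewrite ImM; apply: L2_add; exact: L2_scale.
Qed.

Lemma in_Lq2_sub f g : in_Lq 2%:E f -> in_Lq 2%:E g -> in_Lq 2%:E (fun x => f x - g x).
Proof.
move=> hf /(in_Lq2_scale (-1)) hg; have := in_Lq2_add hf hg.
by under [X in in_Lq _ X -> _]eq_fun do rewrite mulN1r.
Qed.

Lemma in_Lq2_0 : in_Lq 2%:E (fun _ : 'rV[R]_n => 0 : R[i]).
Proof.
have z : L2 (fun _ => 0).
  by apply: L2P => //; under eq_integral do rewrite expr0n/=; rewrite integral0.
by apply/in_Lq2P.
Qed.

Lemma Re_dot_L2 f g : in_Lq 2%:E f -> in_Lq 2%:E g ->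
  Re (dot_L2 f g) = ip (re f) (re g) + ip (im f) (im g).
Proof.
move=> /in_Lq2P[a b] /in_Lq2P[c e]; rewrite /= /ip -RintegralD//; try exact: L2_integrable.
by apply: eq_Rintegral => x _; rewrite ReM Re_conjc Im_conjc mulrN opprK.
Qed.

Lemma Im_dot_L2 f g : in_Lq 2%:E f -> in_Lq 2%:E g ->
  Im (dot_L2 f g) = ip (im f) (re g) - ip (re f) (im g).
Proof.
move=> /in_Lq2P[a b] /in_Lq2P[c e]; rewrite /= /ip -RintegralB//; try exact: L2_integrable.
by apply: eq_Rintegral => x _; rewrite ImM Re_conjc Im_conjc mulrN addrC.
Qed.

Lemma dot_L2_ae f g h : in_Lq 2%:E f -> in_Lq 2%:E g -> in_Lq 2%:E h ->
  {ae nu, forall x, g x = h x} -> dot_L2 f g = dot_L2 f h.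
Proof.
move=> hf hg hh gh; have /in_Lq2P[a b] := hf; have /in_Lq2P[c e] := hg.
have /in_Lq2P[k l] := hh.
have ipE w v v' : L2 w -> L2 v -> L2 v' -> {ae nu, forall x, v x = v' x} ->
    ip w v = ip w v'.
  move=> hw hv hv' vv; rewrite /ip /Rintegral; congr fine.
  apply: ae_eq_integral => //.
  - by have /integrableP[] := L2_integrable hw hv.
  - by have /integrableP[] := L2_integrable hw hv'.
  - by apply: filterS vv => x -> _.
have vr : {ae nu, forall x, Re (g x) = Re (h x)} by apply: filterS gh => x ->.
have vi : {ae nu, forall x, Im (g x) = Im (h x)} by apply: filterS gh => x ->.
apply: complex_ext; rewrite ?Re_dot_L2 ?Im_dot_L2//.
  by rewrite (ipE _ _ _ a c k vr) (ipE _ _ _ b e l vi).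
by rewrite (ipE _ _ _ b c k vr) (ipE _ _ _ a e l vi).
Qed.

Lemma cL2sq_dot f : in_Lq 2%:E f -> cL2sq f = Re (dot_L2 f f).
Proof. by move=> hf; rewrite Re_dot_L2. Qed.

Lemma cL2sq_ae f g : in_Lq 2%:E f -> in_Lq 2%:E g ->
  {ae nu, forall x, f x = g x} -> cL2sq f = cL2sq g.
Proof.
move=> hf hg fg; rewrite !cL2sq_dot// (dot_L2_ae hf hf hg fg) !Re_dot_L2//.
by rewrite ipC [X in _ + X]ipC -!Re_dot_L2// (dot_L2_ae hg hf hg fg).
Qed.

Lemma cL2sq_sub f g :
  cL2sq (fun x => f x - g x) =
    L2sq (fun x => Re (f x) - Re (g x)) + L2sq (fun x => Im (f x) - Im (g x)).
Proof.
rewrite /cL2sq; congr (L2sq _ + L2sq _); apply/funext => x.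
  by rewrite ReD ReN.
by rewrite ImD ImN.
Qed.

Lemma cL2sq_add_le f g : in_Lq 2%:E f -> in_Lq 2%:E g ->
  cL2sq (fun x => f x + g x) <= 2 * cL2sq f + 2 * cL2sq g.
Proof.
move=> /in_Lq2P[a b] /in_Lq2P[c e]; rewrite /cL2sq.
have -> : re (fun x => f x + g x) = fun x => Re (f x) + Re (g x).
  by apply/funext => x; rewrite ReD.
have -> : im (fun x => f x + g x) = fun x => Im (f x) + Im (g x).
  by apply/funext => x; rewrite ImD.
have := L2sq_add_le a c; have := L2sq_add_le b e => h1 h2.
by apply: le_trans (lerD h2 h1) _; rewrite le_eqVlt; apply/orP; left; apply/eqP; ring.
Qed.

Lemma Lq_norm2_cvg0P (I : Type) (F : set_system I) (FF : ProperFilter F) (f : I -> fct) :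
  (\forall i \near F, in_Lq 2%:E (f i)) ->
  (Lq_norm 2%:E (f i) @[i --> F] --> 0%E) <-> (cL2sq (f i) @[i --> F] --> 0).
Proof.
move=> hf; have E : \forall i \near F, (Num.sqrt (cL2sq (f i)))%:E = Lq_norm 2%:E (f i).
  by apply: filterS hf => i /Lq_norm2E ->.
split=> [h|h].
  have : (Num.sqrt (cL2sq (f i)))%:E @[i --> F] --> 0%E.
    by apply: cvg_trans h; apply: near_eq_cvg; apply: filterS E.
  move=> /fine_cvgP[_ h2].
  rewrite -[X in _ --> X](mulr0 (0 : R)).
  rewrite (_ : (fun i => cL2sq (f i)) =
    (fun i => Num.sqrt (cL2sq (f i)) * Num.sqrt (cL2sq (f i)))); first exact: (cvgM h2 h2).
  by apply/funext => i; rewrite -expr2 sqr_sqrtr// cL2sq_ge0.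
have : (Num.sqrt (cL2sq (f i)))%:E @[i --> F] --> 0%E.
  apply: cvg_EFin; first exact: nearW.
  rewrite -(@sqrtr0 R); apply: continuous_cvg h; exact: sqrt_continuous.
by apply: cvg_trans; apply: near_eq_cvg; apply: filterS E => i ->.
Qed.

End complex_L2.

(** * Derivatives of scalar products *)

Section derivatives_of_pairings.
Context d (T : measurableType d) (R : realType).
Variable mu : {measure set T -> \bar R}.
Local Notation L2 := (L2 mu).
Local Notation ip := (ip mu).
Local Notation L2sq := (L2sq mu).

(** The formula for the derivative passes from the [phi k] to their limit [w]. By
    the mean value theorem, the difference quotient of the scalar product of
    [phi k] and [h] differs from its derivative at [t] by at most the norm of [D]
    times the oscillation of [h'] in the mean; this bound does not depend on
    [k]. *)
Lemma ip_derive_limit (phi psi : nat -> T -> R) (D w z : T -> R)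
    (h h' : R -> T -> R) (t : R) :
    L2 D ->
    (forall k, measurable_fun setT (phi k)) ->
    (forall k, measurable_fun setT (psi k)) ->
    (forall k x, `|phi k x| <= D x) -> (forall k x, `|psi k x| <= D x) ->
    measurable_fun setT w -> measurable_fun setT z ->
    (forall x, phi k x @[k --> \oo] --> w x) ->
    (forall x, psi k x @[k --> \oo] --> z x) ->
    (forall s, L2 (h s)) -> (forall s, L2 (h' s)) ->
    L2sq (fun x => h' s x - h' t x) @[s --> t] --> 0 ->
    (forall k (s : R), is_derive s 1 (fun r => ip (phi k) (h r)) (ip (psi k) (h' s))) ->
  is_derive t 1 (fun r => ip w (h r)) (ip z (h' t)).
Proof.
move=> hD mphi mpsi phiD psiD mw mz cphi cpsi hh hh' ch' dF.
have D0 x : 0 <= D x by apply: le_trans (phiD 0%N x).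
have absD x : `|D x| = D x by rewrite ger0_norm.
have hphi k : L2 (phi k) by apply: (L2_le (mphi k) hD) => x; rewrite absD.
have hpsi k : L2 (psi k) by apply: (L2_le (mpsi k) hD) => x; rewrite absD.
have lim_le (v : nat -> T -> R) (v0 : T -> R) : (forall k x, `|v k x| <= D x) ->
    (forall x, v k x @[k --> \oo] --> v0 x) -> forall x, `|v0 x| <= `|D x|.
  move=> vD cv x; rewrite absD -(cvg_lim _ (cvg_norm (cv x)))//; apply: limr_le.
    by apply/cvg_ex; eexists; exact: (cvg_norm (cv x)).
  by apply: nearW => k; exact: vD.
have hw : L2 w by apply: (L2_le mw hD); exact: lim_le phiD cphi.
have hz : L2 z by apply: (L2_le mz hD); exact: lim_le psiD cpsi.
have ip_lim (v : nat -> T -> R) (v0 g : T -> R) :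
    (forall k, measurable_fun setT (v k)) -> measurable_fun setT v0 ->
    (forall k x, `|v k x| <= D x) ->
    (forall x, v k x @[k --> \oo] --> v0 x) -> L2 g ->
    ip (v k) g @[k --> \oo] --> ip v0 g.
  move=> mv mv0 vD cv hg.
  apply: (@ip_cvg _ _ _ mu nat \oo _ v (fun _ => g)) => //.
  - by move=> k; apply: (L2_le (mv k) hD) => x; rewrite absD.
  - by apply: (L2_le mv0 hD); exact: lim_le cv.
  - apply: (@L2_dominated_convergence _ _ _ mu v v0 D) => //.
      by apply: aeW => x; exact: cv.
    by apply: aeW => x k; exact: vD.
  - rewrite (_ : (fun _ => _) = fun=> 0); first exact: cvg_cst.
    apply/funext => _; rewrite /L2sq /ip (@eq_Rintegral _ _ _ mu setT (fun _ => 0)).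
      by rewrite /Rintegral integral0.
    by move=> x _; rewrite subrr mulr0.
apply: is_derive_quotient; apply/cvgrPdist_le => /= e e0.
pose B := Num.sqrt (L2sq D) + 1.
have B0 : 0 < B by rewrite ltr_wpDl// sqrtr_ge0.
have cs : Num.sqrt (L2sq (fun x => h' s x - h' t x)) @[s --> t] --> 0.
  by rewrite -(@sqrtr0 R); apply: continuous_cvg ch'; exact: sqrt_continuous.
move/cvgrPdist_le: cs => /(_ (e / B) (divr_gt0 e0 B0))[r /= r0 hr].
rewrite near_withinE; exists r => //= y ty yt.
have small k s : `|t - s| < r -> `|ip (psi k) (h' s) - ip (psi k) (h' t)| <= e.
  move=> /hr; rewrite sub0r normrN ger0_norm ?sqrtr_ge0// => hs.
  rewrite -ipBr//; apply: le_trans (ip_norm_le (hpsi k) (L2_sub (hh' s) (hh' t))) _.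
  apply: (@le_trans _ _ (B * (e / B))); last by rewrite mulrCA divff ?mulr1// gt_eqF.
  apply: ler_pM; rewrite ?sqrtr_ge0//.
  apply: (@le_trans _ _ (Num.sqrt (L2sq D))); last by rewrite lerDl.
  by rewrite ler_wsqrtr//; apply: L2sq_le => // x; rewrite absD.
pose q k := ip (phi k) (h y) - ip (phi k) (h t) - ip (psi k) (h' t) * (y - t).
have qle k : `|q k| <= e * `|y - t|.
  pose c := ip (psi k) (h' t).
  pose g s := ip (phi k) (h s) + - c * s.
  have -> : q k = g y - g t by rewrite /q /g -/c; ring.
  apply: (@MVT_le R g (fun s => ip (psi k) (h' s) - c)) => s hs.
    have H := is_derive_fun_add (dF k s) (is_derive_fun_mul (is_derive_fun_cst (- c) s 1) (is_derive_fun_id s)).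
    by apply: (is_derive_eq H); ring.
  apply: small; apply: le_lt_trans ty.
  case/orP: hs => /andP[h1 h2].
    rewrite distrC [leRHS]distrC !ger0_norm ?subr_ge0 ?lerD2r//.
    exact: le_trans h2.
  by rewrite !ger0_norm ?subr_ge0 ?lerD2l ?lerN2// (le_trans h1).
have cq : q k @[k --> \oo] --> ip w (h y) - ip w (h t) - ip z (h' t) * (y - t).
  apply: cvgB; first by apply: cvgB; exact: ip_lim.
  by apply: cvgM; [exact: ip_lim|exact: cvg_cst].
have lim : `|ip w (h y) - ip w (h t) - ip z (h' t) * (y - t)| <= e * `|y - t|.
  rewrite -(cvg_lim _ (cvg_norm cq))//; apply: limr_le.
    by apply/cvg_ex; eexists; exact: (cvg_norm cq).
  exact: nearW.
have yt0 : y - t != 0 by rewrite subr_eq0.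
rewrite -(ler_pM2r (_ : 0 < `|y - t|)) ?normr_gt0// -normrM mulrBl divfK//.
by rewrite distrC.
Qed.

(** The Leibniz rule, where [u] is differentiable in the mean while [h] is only
    continuous in the mean and weakly differentiable against [u t]. *)
Lemma ip_derive_product (u : R -> T -> R) (u' : T -> R) (h : R -> T -> R) (t l : R) :
    (forall s, L2 (u s)) -> L2 u' -> (forall s, L2 (h s)) ->
    L2sq (fun x => (u y x - u t x) / (y - t) - u' x) @[y --> t^'] --> 0 ->
    L2sq (fun x => h y x - h t x) @[y --> t] --> 0 ->
    is_derive t 1 (fun s => ip (u t) (h s)) l ->
  is_derive t 1 (fun s => ip (u s) (h s)) (ip u' (h t) + l).
Proof.
move=> hu hu' hh cu ch dl; apply: is_derive_quotient.
have quo y : L2 (fun x => (u y x - u t x) / (y - t)).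
  have := L2_scale (y - t)^-1 (L2_sub (hu y) (hu t)).
  by under eq_fun do rewrite mulrC.
rewrite (_ : (fun y => _) = fun y =>
    ip (fun x => (u y x - u t x) / (y - t)) (h y)
    + (ip (u t) (h y) - ip (u t) (h t)) / (y - t)); last first.
  apply/funext => y; rewrite (_ : (fun x => (u y x - u t x) / (y - t)) =
      fun x => (y - t)^-1 * (u y x - u t x)); last first.
    by apply/funext => x; rewrite mulrC.
  by rewrite ipZl ?ipBl//; [ring|exact: L2_sub].
apply: cvgD; last exact: is_derive_quotientP.
apply: (@ip_cvg _ _ _ mu _ (t^') _ (fun y x => (u y x - u t x) / (y - t)) h) => //.
by apply: cvg_trans ch; apply: cvg_app; exact: nbhs_dnbhs.
Qed.

End derivatives_of_pairings.

(** * The free Schrodinger group *)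

Section group_facts.
Context (R : realType) (n : nat).
Local Notation Re := complex.Re.
Local Notation Im := complex.Im.
Local Notation nu := (lebesgue_row R n).
Local Notation fct := ('rV[R]_n -> R[i]).
Local Notation re f := (fun x => Re (f x)).
Local Notation im f := (fun x => Im (f x)).
Local Notation L2 := (L2 nu).
Local Notation ip := (ip nu).
Local Notation L2sq := (L2sq nu).
Context (U : R -> fct -> fct).
Hypothesis hU : is_schrodinger_group U.
Implicit Types (f g : fct) (t s : R).

Lemma group_cL2sq t g : in_Lq 2%:E g -> cL2sq (U t g) = cL2sq g.
Proof.
move=> hg; rewrite !cL2sq_dot//; last exact: group_L2.
by rewrite (group_unitary hU).
Qed.

Lemma group_L2_parts t g : in_Lq 2%:E g -> L2 (re (U t g)) /\ L2 (im (U t g)).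
Proof. by move=> /(group_L2 hU t)/in_Lq2P. Qed.

Lemma group_inverse t g : in_Lq 2%:E g ->
  {ae nu, forall x, U t (U (- t) g) x = g x}.
Proof.
move=> hg; have := groupD hU t (- t) hg; have := group0 hU hg.
by apply: filterS2 => x; rewrite subrr => -> <-.
Qed.

(** Unitarity and the group law: the adjoint of [U t] is its inverse. *)
Lemma group_adjoint t f g : in_Lq 2%:E f -> in_Lq 2%:E g ->
  dot_L2 (U t f) g = dot_L2 f (U (- t) g).
Proof.
move=> hf hg; have hUg := group_L2 hU (- t) hg.
rewrite -(group_unitary hU t hf hUg); apply: dot_L2_ae => //.
- exact: (group_L2 hU).
- exact: (group_L2 hU).
- by apply: filterS (group_inverse t hg) => x ->.
Qed.

Lemma group_cvg t g : in_Lq 2%:E g ->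
  L2sq (fun x => Re (U s g x) - Re (U t g x)) @[s --> t] --> 0 /\
  L2sq (fun x => Im (U s g x) - Im (U t g x)) @[s --> t] --> 0.
Proof.
move=> hg; have [_ /(_ t I)] := group_continuous hU hg.
rewrite within_setT; have dL s := in_Lq2_sub (group_L2 hU s hg) (group_L2 hU t hg).
move=> /(@Lq_norm2_cvg0P R n R (nbhs t) _ (fun s x => U s g x - U t g x)
  (@nearW _ (nbhs t) _ _ dL)).
under eq_fun do rewrite cL2sq_sub; move=> h.
by split; apply: (cvg0_le _ _ h) => s;
  rewrite L2sq_ge0/= ?lerDl ?lerDr L2sq_ge0.
Qed.

(** The free equation, tested against a real function, couples the real and the
    imaginary parts. *)
Lemma group_weak_derivative g (phi : 'rV[R]_n -> R) t :
  in_Lq 2%:E g -> test_function phi ->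
  is_derive t 1 (fun s => ip phi (re (U s g))) (ip (laplacian phi) (im (U t g))) /\
  is_derive t 1 (fun s => ip phi (im (U s g)))
    (- ip (laplacian phi) (re (U t g))).
Proof.
move=> hg tphi; have [l [dr di] lE] := group_solves hU hg tphi t.
set I := cintegral _ _ _ in lE.
have {}lE : 'i%C * l = I by apply/eqP; rewrite -subr_eq0; apply/eqP.
have lr : Re l = Im I by rewrite -lE ImM/= mul0r mul1r add0r.
have li : Im l = - Re I by rewrite -lE ReM/= mul0r mul1r sub0r opprK.
split.
- have -> : ip (laplacian phi) (im (U t g)) = Re l.
    rewrite lr; apply: eq_Rintegral => x _.
    by rewrite ImM/= mulr0 add0r mulrC.
  rewrite (_ : (fun s => _) = fun s => Re (cintegral nu setT
    (fun x => U s g x * (phi x)%:C%C)))//.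
  apply/funext => s; apply: eq_Rintegral => x _.
  by rewrite ReM/= mulr0 subr0 mulrC.
- have -> : - ip (laplacian phi) (re (U t g)) = Im l.
    rewrite li; congr (- _); apply: eq_Rintegral => x _.
    by rewrite ReM/= mulr0 subr0 mulrC.
  rewrite (_ : (fun s => _) = fun s => Im (cintegral nu setT
    (fun x => U s g x * (phi x)%:C%C)))//.
  apply/funext => s; apply: eq_Rintegral => x _.
  by rewrite ImM/= mulr0 add0r mulrC.
Qed.

(** Testing against smooth compactly supported functions determines the
    generator on every [w] that is, together with a square integrable function
    [z], a dominated limit of test functions and of their Laplacians. *)
Lemma group_derivative (phi : nat -> 'rV[R]_n -> R) (D w z : 'rV[R]_n -> R) g t :
    L2 D -> in_Lq 2%:E g ->
    (forall k, test_function (phi k)) ->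
    (forall k, measurable_fun setT (phi k)) ->
    (forall k, measurable_fun setT (laplacian (phi k))) ->
    (forall k x, `|phi k x| <= D x) -> (forall k x, `|laplacian (phi k) x| <= D x) ->
    measurable_fun setT w -> measurable_fun setT z ->
    (forall x, phi k x @[k --> \oo] --> w x) ->
    (forall x, laplacian (phi k) x @[k --> \oo] --> z x) ->
  is_derive t 1 (fun s => ip w (re (U s g))) (ip z (im (U t g))) /\
  is_derive t 1 (fun s => ip w (im (U s g))) (- ip z (re (U t g))).
Proof.
move=> hD hg tphi mphi mpsi phiD psiD mw mz cphi cpsi.
have [cr ci] := group_cvg t hg.
have hr s : L2 (re (U s g)) by case: (group_L2_parts s hg).
have hi s : L2 (im (U s g)) by case: (group_L2_parts s hg).
have hpsi k : L2 (laplacian (phi k)).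
  by apply: (L2_le (mpsi k) hD) => x; apply: le_trans (psiD k x) (ler_norm _).
split.
  apply: (@ip_derive_limit _ _ _ nu phi (fun k => laplacian (phi k)) D w z
    (fun s => re (U s g)) (fun s => im (U s g)) t) => //.
  by move=> k s; have [] := group_weak_derivative s hg (tphi k).
have hz : L2 z.
  apply: (L2_le mz hD) => x; apply: le_trans (ler_norm _).
  rewrite -(cvg_lim _ (cvg_norm (cpsi x)))//; apply: limr_le.
    by apply/cvg_ex; eexists; exact: (cvg_norm (cpsi x)).
  by apply: nearW => k; exact: psiD.
rewrite -ipNr//.
apply: (@ip_derive_limit _ _ _ nu phi (fun k => laplacian (phi k)) D w z
  (fun s => im (U s g)) (fun s x => - Re (U s g x)) t) => //.
- by move=> s; exact: L2_opp.
- apply: cvg_trans cr; apply: near_eq_cvg; apply: nearW => s.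
  rewrite (_ : (fun x => - Re (U s g x) - - Re (U t g x)) =
    (fun x => -1 * (Re (U s g x) - Re (U t g x)))); last first.
    by apply/funext => x; ring.
  by rewrite L2sq_scale ?sqrrN ?expr1n ?mul1r//; exact: L2_sub.
- by move=> k s; rewrite ipNr//; have [] := group_weak_derivative s hg (tphi k).
Qed.

End group_facts.

(** * The concentrating wave *)

Section concentrating_solution.
Context (R : realType) (n : nat).
Hypothesis n2 : (2 <= n)%N.
Local Notation nu := (lebesgue_row R n).
Local Notation a := (n%:R / 4 : R).
Local Notation V := 'rV[R]_n.
Local Notation L2 := (L2 nu).
Local Notation L2sq := (L2sq nu).
Let ha : 4^-1 <= a := exponent_ge R n2.
Implicit Types (s t y : R) (x : V).

(** The square of the length at which the wave lives at time [t]. *)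
Definition scale t : R := (1 - t) ^+ 2.

Definition wave t (x : V) : R := profile a (scale t + sqnorm x).

Definition wave_t t (x : V) : R :=
  profile1 a (scale t + sqnorm x) * (- 2 * (1 - t)).

Definition wave_lap t (x : V) : R := @profile_laplacian R n a (scale t) x.

Lemma scale_ge0 t : 0 <= scale t. Proof. exact: sqr_ge0. Qed.

Lemma scale_gt0 t : t != 1 -> 0 < scale t.
Proof. by move=> t1; rewrite exprn_even_gt0//= subr_eq0 eq_sym. Qed.

Lemma wave_gt0 t x : 0 < wave t x.
Proof. exact: profile_gt0. Qed.

Let rho_gt0 t (x : V) : t != 1 -> 0 < scale t + sqnorm x.
Proof. by move=> t1; rewrite ltr_pwDl ?scale_gt0 ?sqnorm_ge0. Qed.

Lemma is_derive_wave t x : t != 1 -> is_derive t 1 (wave ^~ x) (wave_t t x).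
Proof.
move=> t1; have ds : is_derive t 1 (fun s => scale s + sqnorm x) (- 2 * (1 - t)).
  have d1 : is_derive t 1 (fun s : R => 1 + -1 * s) (0 + (0 * t + -1 * 1)).
    exact: (is_derive_fun_add (is_derive_fun_cst (1 : R) t 1) (is_derive_fun_mul (is_derive_fun_cst (-1 : R) t 1) (is_derive_fun_id t))).
  have H := is_derive_fun_add (is_derive_fun_mul d1 d1) (is_derive_fun_cst (sqnorm x : R) t 1).
  rewrite (_ : (fun s => _) = (fun s => (1 + -1 * s) * (1 + -1 * s) + sqnorm x)).
    by apply: (is_derive_eq H); ring.
  by apply/funext => s; rewrite /scale; ring.
exact: (is_derive_fun_comp (f := fun s => scale s + sqnorm x)
  (is_derive_profile a (rho_gt0 x t1)) ds).
Qed.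

Let continuous_scale x t : {for t, continuous (fun s => scale s + sqnorm x : R)}.
Proof.
have d1 : is_derive t 1 (fun s : R => 1 + -1 * s) (0 + (0 * t + -1 * 1)).
  exact: (is_derive_fun_add (is_derive_fun_cst (1 : R) t 1) (is_derive_fun_mul (is_derive_fun_cst (-1 : R) t 1) (is_derive_fun_id t))).
have H := is_derive_fun_add (is_derive_fun_mul d1 d1) (is_derive_fun_cst (sqnorm x : R) t 1).
rewrite (_ : (fun s => _) = (fun s => (1 + -1 * s) * (1 + -1 * s) + sqnorm x)).
  exact: is_derive_continuous H.
by apply/funext => s; rewrite /scale; ring.
Qed.

Lemma continuous_wave t (x : V) : 0 < scale t + sqnorm x -> {for t, continuous (wave ^~ x)}.
Proof.
move=> r0; apply: (@continuous_comp _ _ _ (fun s => scale s + sqnorm x) (profile a)).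
  exact: continuous_scale.
exact: continuous_profile.
Qed.

Lemma continuous_wave_t t (x : V) : t != 1 -> {for t, continuous (wave_t ^~ x)}.
Proof.
move=> t1; apply: (@continuousM _ _ (fun s => profile1 a (scale s + sqnorm x))).
  apply: (@continuous_comp _ _ _ (fun s => scale s + sqnorm x) (profile1 a)).
    exact: continuous_scale.
  exact/continuous_profile1/rho_gt0.
have H := is_derive_fun_mul (is_derive_fun_cst (- 2 : R) t 1) (is_derive_fun_add (is_derive_fun_cst (1 : R) t 1) (is_derive_fun_mul (is_derive_fun_cst (-1 : R) t 1) (is_derive_fun_id t))).
rewrite (_ : (fun s => _) = (fun s => - 2 * (1 + -1 * s))).
  exact: is_derive_continuous H.
by apply/funext => s; rewrite mulN1r.
Qed.

Lemma continuous_wave_lap t (x : V) : t != 1 -> {for t, continuous (wave_lap ^~ x)}.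
Proof.
move=> t1; apply: (@continuousD _ _ _
    (fun s => 2 * n%:R * profile1 a (scale s + sqnorm x))
    (fun s => 4 * sqnorm x * profile2 a (scale s + sqnorm x))).
  apply: continuousM; first exact: cst_continuous.
  apply: (@continuous_comp _ _ _ (fun s => scale s + sqnorm x) (profile1 a)).
    exact: continuous_scale.
  exact/continuous_profile1/rho_gt0.
apply: continuousM; first exact: cst_continuous.
apply: (@continuous_comp _ _ _ (fun s => scale s + sqnorm x) (profile2 a)).
  exact: continuous_scale.
exact/continuous_profile2/rho_gt0.
Qed.

Let measurable_rho : measurable_fun setT
  (fun z : measurableTypeR R * V => scale z.1 + sqnorm z.2).
Proof.
apply: measurable_funD.
  by apply: measurable_funX; apply: measurable_funB.
by apply: measurableT_comp => //; exact: measurable_sqnorm.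
Qed.

Lemma measurable_wave2 : measurable_fun setT
  (fun z : measurableTypeR R * V => wave z.1 z.2).
Proof.
by apply: (@measurableT_comp _ _ _ _ _ _ (profile a)) => //; exact: measurable_profile.
Qed.

Lemma measurable_wave_t2 : measurable_fun setT
  (fun z : measurableTypeR R * V => wave_t z.1 z.2).
Proof.
apply: measurable_funM.
  by apply: (@measurableT_comp _ _ _ _ _ _ (profile1 a)) => //; exact: measurable_profile1.
by apply: measurable_funM => //; exact: measurable_funB.
Qed.

Lemma measurable_wave_lap2 : measurable_fun setT
  (fun z : measurableTypeR R * V => wave_lap z.1 z.2).
Proof.
apply: measurable_funD; apply: measurable_funM => //.
- by apply: (@measurableT_comp _ _ _ _ _ _ (profile1 a)) => //; exact: measurable_profile1.
- apply: measurable_funM => //.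
  by apply: measurableT_comp => //; exact: measurable_sqnorm.
- by apply: (@measurableT_comp _ _ _ _ _ _ (profile2 a)) => //; exact: measurable_profile2.
Qed.

Let slice (F : R -> V -> R) t :
  measurable_fun setT (fun z : measurableTypeR R * V => F z.1 z.2) ->
  measurable_fun setT (F t).
Proof.
move=> mF; exact: (measurableT_comp mF (pair1_measurable (t : measurableTypeR R))).
Qed.

Lemma measurable_wave t : measurable_fun setT (wave t).
Proof. exact: (@slice wave t measurable_wave2). Qed.

Lemma measurable_wave_t t : measurable_fun setT (wave_t t).
Proof. exact: (@slice wave_t t measurable_wave_t2). Qed.

Lemma measurable_wave_lap t : measurable_fun setT (wave_lap t).
Proof. exact: (@slice wave_lap t measurable_wave_lap2). Qed.

Lemma wave_le s t x : 0 < scale t + sqnorm x -> scale t <= scale s ->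
  wave s x <= wave t x.
Proof. by move=> r0 ts; apply: profile_nonincreasing => //; rewrite lerD2r. Qed.

Let scale1 : scale 1 = 0. Proof. by rewrite /scale subrr expr0n. Qed.

Let sqnorm_gt0_ae : {ae nu, forall x : V, 0 < sqnorm x}.
Proof.
exists [set x | sqnorm x = 0]; split.
- rewrite -[X in measurable X]setTI.
  exact: (@measurable_sqnorm R n measurableT _ (measurable_set1 0)).
- exact: lebesgue_row_set0 (leq_trans _ n2).
- move=> x /= h; apply: contrapT => x0; apply: h.
  by rewrite lt_neqAle sqnorm_ge0 andbT eq_sym; exact/eqP.
Qed.

Lemma wave_le1_ae : {ae nu, forall x, forall t, wave t x <= wave 1 x}.
Proof.
apply: filterS sqnorm_gt0_ae => x x0 t; apply: wave_le.
  by rewrite scale1 add0r.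
by rewrite scale1 scale_ge0.
Qed.

(** The wave is largest at time 1, except at the origin. *)
Lemma wave_L2 t : L2 (wave t).
Proof.
have h1 : L2 (wave 1).
  apply: L2P; first exact: measurable_wave.
  have [M bM] := profile_L2_bound R n2.
  apply: le_lt_trans (ltry M); apply: le_trans bM.
  by rewrite /wave scale1; under eq_integral do rewrite add0r.
apply: (L2_le_ae (measurable_wave t) h1).
apply: filterS wave_le1_ae => x /(_ t).
by rewrite !ger0_norm// ltW// wave_gt0.
Qed.

Lemma wave_continuous_L2 t :
  L2sq (fun x => wave s x - wave t x) @[s --> within `[0, 1] (nbhs t)] --> 0.
Proof.
apply: cvg_within_seq => u _ ut.
apply: (@L2_dominated_convergence _ _ _ nu (fun k => wave (u k)) (wave t) (wave 1)).
- by move=> k; exact: measurable_wave.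
- exact: measurable_wave.
- exact: wave_L2.
- apply: filterS sqnorm_gt0_ae => x x0; apply: (@continuous_cvg _ _ _ _ _ u (wave ^~ x)) ut.
  by apply: continuous_wave; rewrite ltr_wpDl// scale_ge0.
- apply: filterS wave_le1_ae => x h k.
  by rewrite ger0_norm// ltW// wave_gt0.
Qed.

(** Away from the time of concentration all the functions in play are
    dominated by a single square integrable one. *)
Let horizon t := (1 + t) / 2.

Let around t : set R := [set s | `|s - t| <= 1 /\ s <= horizon t].

Let around_nbhs t : t < 1 -> nbhs t (around t).
Proof.
move=> t1; pose r := Num.min 1 ((1 - t) / 2).
have r0 : 0 < r by rewrite lt_min ltr01 divr_gt0// subr_gt0.
exists r => //= s /=; rewrite lt_min distrC => /andP[s1 s2].
split; first exact: ltW.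
by have := ler_norm (s - t); rewrite /horizon; lra.
Qed.

Let around_lt1 t s : t < 1 -> around t s -> s < 1.
Proof. by move=> t1 [_]; rewrite /horizon; lra. Qed.

Let around_scale t s : t < 1 -> around t s -> scale (horizon t) <= scale s.
Proof.
move=> t1 [_ sh]; rewrite /scale lerXn2r ?nnegrE ?subr_ge0 ?lerD2l ?lerN2//.
  by rewrite /horizon; lra.
by apply: le_trans sh _; rewrite /horizon; lra.
Qed.

Let horizon_neq1 t : t < 1 -> horizon t != 1.
Proof. by move=> t1; rewrite lt_eqF// /horizon; lra. Qed.

Let c : R := slope_bound a.

Let c_ge0 : 0 <= c.
Proof. by apply: le_trans (slope_bound_ge1 ha). Qed.

Lemma wave_t_le t x : t != 1 ->
  `|wave_t t x| <= 2 * `|1 - t| * c * wave t x / (scale t + sqnorm x).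
Proof.
move=> t1; rewrite /wave_t normrM [`|- 2 * _|]normrM normrN [`|2|]ger0_norm// mulrC.
rewrite -[leRHS]mulrA -[leRHS]mulrA ler_wpM2l ?mulr_ge0//.
by rewrite mulrA; exact: (profile1_le ha (rho_gt0 x t1)).
Qed.

Lemma wave_lap_le t x : t != 1 ->
  `|wave_lap t x| <= (2 * n%:R + 4) * c * wave t x / (scale t + sqnorm x).
Proof.
move=> t1; have r0 := rho_gt0 x t1.
rewrite /wave_lap /profile_laplacian; apply: le_trans (ler_normD _ _) _.
rewrite -[leRHS]mulrA -[leRHS]mulrA [leRHS]mulrDl; apply: lerD.
  rewrite normrM ger0_norm ?mulr_ge0// ler_wpM2l ?mulr_ge0// mulrA.
  exact: (profile1_le ha r0).
rewrite normrM normrM ger0_norm// (ger0_norm (sqnorm_ge0 x)) -mulrA ler_wpM2l//.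
apply: le_trans (ler_wpM2l (sqnorm_ge0 x) (profile2_le ha r0)) _.
rewrite -/(wave t x) -/c; set r := scale t + sqnorm x.
have w0 : 0 <= wave t x by rewrite ltW// wave_gt0.
have i0 : 0 <= r^-1 by rewrite invr_ge0 ltW.
have xr : sqnorm x / r <= 1 by rewrite ler_pdivrMr// mul1r lerDr scale_ge0.
rewrite (_ : sqnorm x * _ = (sqnorm x / r) * (c * (wave t x / r))); last first.
  by rewrite expr2 invfM; ring.
by apply: ler_piMl => //; exact: (mulr_ge0 c_ge0 (mulr_ge0 w0 i0)).
Qed.

Let K t : R := (2 * (`|1 - t| + 1) + (2 * n%:R + 4)) * c / scale (horizon t).

Let K_ge0 t : 0 <= K t.
Proof.
by rewrite !mulr_ge0// ?invr_ge0 ?scale_ge0// addr_ge0 ?mulr_ge0 ?addr_ge0 ?mulr_ge0.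
Qed.

Let dominant t x : R := K t * wave (horizon t) x.

Let dominant_L2 t : L2 (dominant t).
Proof. exact/L2_scale/wave_L2. Qed.

Let dominate (m : R) t s x : t < 1 -> around t s ->
  0 <= m -> m <= 2 * (`|1 - t| + 1) + (2 * n%:R + 4) ->
  m * c * wave s x / (scale s + sqnorm x) <= dominant t x.
Proof.
move=> t1 ats m0 mM.
have h1 := horizon_neq1 t1; have sh := around_scale t1 ats.
have sc0 := scale_gt0 h1.
have w := wave_le (rho_gt0 x h1) sh.
have w0 : 0 <= wave s x by rewrite ltW// wave_gt0.
rewrite /dominant /K [leRHS]mulrAC.
apply: ler_pM.
- exact: (mulr_ge0 (mulr_ge0 m0 c_ge0) w0).
- by rewrite invr_ge0 addr_ge0 ?scale_ge0 ?sqnorm_ge0.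
- by apply: ler_pM => //; [exact: mulr_ge0|exact: ler_wpM2r].
rewrite lef_pV2 ?posrE// ?(lt_le_trans sc0)//.
  by apply: (le_trans sh); rewrite lerDl sqnorm_ge0.
by apply: (le_trans sh); rewrite lerDl sqnorm_ge0.
Qed.

Let norm_le t s : around t s -> `|1 - s| <= `|1 - t| + 1.
Proof.
move=> [st _]; rewrite (_ : 1 - s = (1 - t) + (t - s)); last by ring.
by apply: le_trans (ler_normD _ _) _; rewrite lerD2l distrC.
Qed.

Let wave_t_dominated t s x : t < 1 -> around t s -> `|wave_t s x| <= dominant t x.
Proof.
move=> t1 ats; have s1 : s != 1 by rewrite lt_eqF// (around_lt1 t1 ats).
apply: le_trans (wave_t_le x s1) _; apply: dominate => //.
apply: (@le_trans _ _ (2 * (`|1 - t| + 1))).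
  by apply: ler_wpM2l => //; exact: norm_le.
by rewrite lerDl addr_ge0// mulr_ge0.
Qed.

Let wave_lap_dominated t s x : t < 1 -> around t s -> `|wave_lap s x| <= dominant t x.
Proof.
move=> t1 ats; have s1 : s != 1 by rewrite lt_eqF// (around_lt1 t1 ats).
apply: le_trans (wave_lap_le x s1) _; apply: dominate => //.
by rewrite lerDr mulr_ge0// addr_ge0.
Qed.

Let around_self t : t < 1 -> around t t.
Proof. by move=> t1; split; rewrite ?subrr ?normr0// /horizon; lra. Qed.

Let dominant_ge0 t x : 0 <= dominant t x.
Proof. by rewrite mulr_ge0// ltW// wave_gt0. Qed.

Lemma wave_t_L2 t : t < 1 -> L2 (wave_t t).
Proof.
move=> t1; apply: (L2_le (measurable_wave_t t) (dominant_L2 t)) => x.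
by rewrite [leRHS]ger0_norm//; apply: wave_t_dominated => //; exact: around_self.
Qed.

Lemma wave_lap_L2 t : t < 1 -> L2 (wave_lap t).
Proof.
move=> t1; apply: (L2_le (measurable_wave_lap t) (dominant_L2 t)) => x.
by rewrite [leRHS]ger0_norm//; apply: wave_lap_dominated => //; exact: around_self.
Qed.

Let curve_continuous (F : R -> V -> R) t : t < 1 ->
    (forall s, measurable_fun setT (F s)) ->
    (forall s x, around t s -> `|F s x| <= dominant t x) ->
    (forall x, {for t, continuous (F ^~ x)}) ->
  L2sq (fun x => F s x - F t x) @[s --> t] --> 0.
Proof.
move=> t1 mF Fd cF; rewrite -(within_setT t).
apply: (cvg_within_seq_near (around_nbhs t1)) => u au ut.
apply: (@L2_dominated_convergence _ _ _ nu (fun k => F (u k)) (F t) (dominant t)) => //.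
  by apply: aeW => x; exact: (@continuous_cvg _ _ _ _ _ u (F ^~ x) t (cF x) ut).
by apply: aeW => x k; apply: Fd; case: (au k).
Qed.

Lemma wave_t_cvg t : t < 1 ->
  L2sq (fun x => wave_t s x - wave_t t x) @[s --> t] --> 0.
Proof.
move=> t1; apply: curve_continuous => //.
- exact: measurable_wave_t.
- by move=> s x; exact: wave_t_dominated.
- by move=> x; apply: continuous_wave_t; rewrite lt_eqF.
Qed.

Lemma wave_lap_cvg t : t < 1 ->
  L2sq (fun x => wave_lap s x - wave_lap t x) @[s --> t] --> 0.
Proof.
move=> t1; apply: curve_continuous => //.
- exact: measurable_wave_lap.
- by move=> s x; exact: wave_lap_dominated.
- by move=> x; apply: continuous_wave_lap; rewrite lt_eqF.
Qed.

(** The difference quotients are dominated by the mean value theorem. *)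
Lemma wave_differentiable_L2 t : t < 1 ->
  L2sq (fun x => (wave s x - wave t x) / (s - t) - wave_t t x) @[s --> t^'] --> 0.
Proof.
move=> t1; apply: (cvg_within_seq_near (around_nbhs t1)) => u au ut.
apply: (@L2_dominated_convergence _ _ _ nu
  (fun k x => (wave (u k) x - wave t x) / (u k - t)) (wave_t t) (dominant t)).
- move=> k; apply: measurable_funM => //.
  by apply: measurable_funB; exact: measurable_wave.
- exact: measurable_wave_t.
- exact: dominant_L2.
- apply: aeW => x; have tN1 : t != 1 by rewrite lt_eqF.
  have cu : u k @[k --> \oo] --> t^'.
    move=> A hA; have h : \forall k \near \oo, u k != t -> A (u k) := ut _ hA.
    suff : \forall k \near \oo, A (u k) by [].
    by apply: filterS h => k; apply; case: (au k).
  exact: (cvg_comp _ _ cu (is_derive_quotientP (is_derive_wave x tN1))).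
- apply: aeW => x k; have [ukt auk] := au k.
  have ut0 : 0 < `|u k - t| by rewrite normr_gt0 subr_eq0.
  rewrite normrM normfV ler_pdivrMr//.
  apply: (@MVT_le R (wave ^~ x) (wave_t ^~ x)) => s hs.
    apply: is_derive_wave; rewrite lt_eqF//.
    have := around_lt1 t1 auk.
    by case/orP: hs => /andP[h1 h2] u1; [exact: le_lt_trans u1|exact: le_lt_trans t1].
  apply: wave_t_dominated => //; split.
    case: auk => auk _; apply: le_trans auk.
    case/orP: hs => /andP[h1 h2].
      by rewrite !ger0_norm ?subr_ge0 ?lerD2r// (le_trans h1).
    by rewrite distrC [leRHS]distrC !ger0_norm ?subr_ge0 ?lerD2l ?lerN2// (le_trans h1).
  case: auk => _ auk; case/orP: hs => /andP[h1 h2]; first exact: le_trans auk.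
  by apply: (le_trans h2); rewrite /horizon; lra.
Qed.

Lemma wave_source_bounded s : s < 1 -> exists M, forall t, 0 <= t <= s ->
  L2sq (wave_t t) + L2sq (wave_lap t) <= M.
Proof.
move=> s1; have sN1 : s != 1 by rewrite lt_eqF.
pose m1 := 2 * c / scale s; pose m2 := (2 * n%:R + 4) * c / scale s.
have e0 := scale_gt0 sN1.
have m10 : 0 <= m1 by rewrite !mulr_ge0// invr_ge0 ltW.
have m20 : 0 <= m2 by rewrite !mulr_ge0// ?addr_ge0 ?mulr_ge0// invr_ge0 ltW.
exists (L2sq (fun x => m1 * wave s x) + L2sq (fun x => m2 * wave s x)).
move=> t /andP[t0 ts]; have t1 : t < 1 by exact: le_lt_trans s1.
have tN1 : t != 1 by rewrite lt_eqF.
have sc : scale s <= scale t.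
  by rewrite /scale lerXn2r ?nnegrE ?subr_ge0 ?lerD2l ?lerN2// ltW.
have ww x : 0 <= wave s x by rewrite ltW// wave_gt0.
have key (m : R) x : 0 <= m ->
    m * c * wave t x / (scale t + sqnorm x) <= m * c / scale s * wave s x.
  move=> m0; rewrite [leRHS]mulrAC; apply: ler_pM.
  - exact: (mulr_ge0 (mulr_ge0 m0 c_ge0) (ltW (wave_gt0 t x))).
  - by rewrite invr_ge0 ltW// rho_gt0.
  - by apply: ler_wpM2l; [exact: mulr_ge0|apply: wave_le; [exact: rho_gt0|]].
  - rewrite lef_pV2 ?posrE ?rho_gt0//.
    by apply: (le_trans sc); rewrite lerDl sqnorm_ge0.
apply: lerD; apply: L2sq_le.
- exact: wave_t_L2.
- exact/L2_scale/wave_L2.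
- move=> x; rewrite [leRHS]ger0_norm; last exact: (mulr_ge0 m10 (ww x)).
  apply: le_trans (wave_t_le x tN1) _; rewrite -/m1.
  apply: le_trans (key 2 x _); last by [].
  rewrite ler_wpM2r ?invr_ge0 ?(ltW (rho_gt0 x tN1))//.
  rewrite ler_wpM2r ?(ltW (wave_gt0 t x))// ler_wpM2r//.
  by rewrite ger0_norm ?subr_ge0 ?(ltW t1)// ler_piMr// gerBl.
- exact: wave_lap_L2.
- exact/L2_scale/wave_L2.
- move=> x; rewrite [leRHS]ger0_norm; last exact: (mulr_ge0 m20 (ww x)).
  apply: le_trans (wave_lap_le x tN1) _.
  by apply: key; rewrite addr_ge0// mulr_ge0.
Qed.

End concentrating_solution.

(** * The integral equation *)

Section mild_solution_wave.
Context (R : realType) (n : nat).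
Hypothesis n2 : (2 <= n)%N.
Local Notation Re := complex.Re.
Local Notation Im := complex.Im.
Local Notation V := 'rV[R]_n.
Local Notation nu := (lebesgue_row R n).
Local Notation fct := (V -> R[i]).
Local Notation re f := (fun x => Re (f x)).
Local Notation im f := (fun x => Im (f x)).
Local Notation L2 := (L2 nu).
Local Notation ip := (ip nu).
Local Notation L2sq := (L2sq nu).
Local Notation wave := (@wave R n).
Local Notation wave_t := (@wave_t R n).
Local Notation wave_lap := (@wave_lap R n).
Context (U : R -> fct -> fct).
Hypothesis hU : is_schrodinger_group U.
Implicit Types (f g : fct) (t s tau : R).

Definition solution t : fct := fun x => Complex (wave t x) 0.

(** The quotient [(Delta u - i d_t u) / u]; its product with the solution is
    [Delta u - i d_t u], whose real and imaginary parts are explicit. *)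
Definition potential t : fct := fun x =>
  Complex (wave_lap t x / wave t x) (- wave_t t x / wave t x).

Let source t : fct := fun x => potential t x * solution t x.

Let sourceE t x : source t x = Complex (wave_lap t x) (- wave_t t x).
Proof.
have w0 : wave t x != 0 by rewrite gt_eqF// wave_gt0.
by apply: complex_ext; rewrite ?ReM ?ImM/= ?mulr0 ?subr0 ?add0r divfK.
Qed.

Let L2_zero : L2 (fun _ => 0).
Proof. by have [] := (in_Lq2P _).1 (in_Lq2_0 R n). Qed.

Lemma solution_L2 t : in_Lq 2%:E (solution t).
Proof. by apply/in_Lq2P; split; [exact: wave_L2|exact: L2_zero]. Qed.

Let source_L2 t : t < 1 -> in_Lq 2%:E (source t).
Proof.
move=> t1; apply/in_Lq2P; split.
  by under eq_fun do rewrite sourceE/=; exact: wave_lap_L2.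
by under eq_fun do rewrite sourceE/=; apply: L2_opp; exact: wave_t_L2.
Qed.

Let cL2sq_solution_sub s t :
  cL2sq (fun x => solution s x - solution t x) = L2sq (fun x => wave s x - wave t x).
Proof.
rewrite cL2sq_sub /= (_ : (fun _ => 0 - 0) = fun=> 0); last by apply/funext => x; rewrite subrr.
by rewrite L2sq_zero addr0.
Qed.

Lemma solution_continuous : in_C_L2 `[0, 1] solution.
Proof.
split; first by move=> t _; exact: solution_L2.
move=> t t01.
have pf : ProperFilter (within `[0, 1]%classic (nbhs t)).
  by apply: within_nbhs_proper; exact: subset_closure.
apply/(Lq_norm2_cvg0P _).
  by apply: nearW => s; apply: in_Lq2_sub; exact: solution_L2.
by under eq_fun do rewrite cL2sq_solution_sub; exact: wave_continuous_L2.
Qed.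

(** The wave at a time [t < 1] is in the domain of the generator, which acts on it
    as the Laplacian. *)
Let wave_group_derivative t g s : t < 1 -> in_Lq 2%:E g ->
  is_derive s 1 (fun r => ip (wave t) (re (U r g))) (ip (wave_lap t) (im (U s g))) /\
  is_derive s 1 (fun r => ip (wave t) (im (U r g))) (- ip (wave_lap t) (re (U s g))).
Proof.
move=> t1 hg; have e0 : 0 < scale t by apply: scale_gt0; rewrite lt_eqF.
have ha := exponent_ge R n2.
have [C C0 bC] := truncated_bounded n ha e0.
apply: (@group_derivative R n U hU (@truncated R n (n%:R / 4) (scale t)) (fun x => C * wave t x) _ _ g s) => //.
- exact/L2_scale/wave_L2.
- by move=> k; exact: test_function_truncated.
- by move=> k; exact: smooth_expr_measurable (smooth_expr_truncated _ _ e0 k).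
- move=> k; apply: smooth_expr_measurable; apply: smooth_expr_laplacian.
  exact: (smooth_expr_truncated _ _ e0 k).
- by move=> k x; case: (bC k x).
- by move=> k x; case: (bC k x).
- exact: measurable_wave.
- exact: measurable_wave_lap.
- by move=> x; exact: truncated_cvg.
- by move=> x; exact: laplacian_truncated_cvg.
Qed.

Section pairing_with_the_group.
Variables (t : R) (g : fct).
Hypothesis hg : in_Lq 2%:E g.

Let h tau : fct := U (tau - t) g.

Let hr tau : L2 (re (h tau)). Proof. by case: (group_L2_parts hU (tau - t) hg). Qed.
Let hi tau : L2 (im (h tau)). Proof. by case: (group_L2_parts hU (tau - t) hg). Qed.

Let shift_near tau (F : R -> R) : F r @[r --> tau - t] --> 0 ->
  F (r - t) @[r --> tau] --> 0.
Proof.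
move=> cF; apply: (@cvg_comp _ _ _ (fun r => r - t) F _ _ _ _ cF).
by apply: cvgB; [exact: cvg_id|exact: cvg_cst].
Qed.

Let chr tau : L2sq (fun x => Re (h s x) - Re (h tau x)) @[s --> tau] --> 0.
Proof.
have [c _] := group_cvg hU (tau - t) hg.
exact: (shift_near (F := fun r => L2sq (fun x => Re (U r g x) - Re (U (tau - t) g x))) c).
Qed.

Let chi tau : L2sq (fun x => Im (h s x) - Im (h tau x)) @[s --> tau] --> 0.
Proof.
have [_ c] := group_cvg hU (tau - t) hg.
exact: (shift_near (F := fun r => L2sq (fun x => Im (U r g x) - Im (U (tau - t) g x))) c).
Qed.

(* the real and imaginary parts of the scalar product with the wave, and their
   derivatives in [tau] *)
Let A tau := ip (wave tau) (re (h tau)).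
Let B tau := ip (wave tau) (im (h tau)).
Let A' tau := ip (wave_t tau) (re (h tau)) + ip (wave_lap tau) (im (h tau)).
Let B' tau := ip (wave_t tau) (im (h tau)) + - ip (wave_lap tau) (re (h tau)).

Let shift_derive tau (F : R -> R) l : is_derive (tau - t) 1 F l ->
  is_derive tau 1 (fun s => F (s - t)) l.
Proof.
move=> dF; have H := is_derive_fun_comp (f := fun s : R => s + - t) dF
  (is_derive_fun_add (is_derive_fun_id tau) (is_derive_fun_cst (- t) tau 1)).
by apply: (is_derive_eq H); rewrite addr0 mulr1.
Qed.

Let dA tau : tau < 1 -> is_derive tau 1 A (A' tau).
Proof.
move=> t1; apply: ip_derive_product.
- by move=> s; exact: wave_L2.
- exact: wave_t_L2.
- exact: hr.
- exact: wave_differentiable_L2.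
- exact: chr.
- have [d _] := wave_group_derivative (tau - t) t1 hg.
  exact: (shift_derive d).
Qed.

Let dB tau : tau < 1 -> is_derive tau 1 B (B' tau).
Proof.
move=> t1; apply: ip_derive_product.
- by move=> s; exact: wave_L2.
- exact: wave_t_L2.
- exact: hi.
- exact: wave_differentiable_L2.
- exact: chi.
- have [_ d] := wave_group_derivative (tau - t) t1 hg.
  exact: (shift_derive d).
Qed.

Let pairing_continuous (F : R -> V -> R) (k : R -> V -> R) tau : tau < 1 ->
    (forall s, s < 1 -> L2 (F s)) -> (forall s, L2 (k s)) ->
    L2sq (fun x => F s x - F tau x) @[s --> tau] --> 0 ->
    L2sq (fun x => k s x - k tau x) @[s --> tau] --> 0 ->
  ip (F s) (k s) @[s --> tau] --> ip (F tau) (k tau).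
Proof.
move=> t1 hF hk cF ck.
(* outside the domain where it is square integrable the curve is made constant *)
pose G s := if s < 1 then F s else F tau.
have GF : \forall s \near tau, G s = F s.
  by near=> s; rewrite /G; suff -> : s < 1 by []; near: s; exact: lt_nbhsl.
have Gt : G tau = F tau by rewrite /G t1.
have : ip (G s) (k s) @[s --> tau] --> ip (F tau) (k tau).
  apply: (@ip_cvg _ _ _ nu _ (nbhs tau) _ G k) => //.
  - by move=> s; rewrite /G; case: ifPn => s1; exact: hF.
  - exact: hF.
  - by apply: cvg_trans cF; apply: near_eq_cvg; apply: filterS GF => s ->.
by apply: cvg_trans; apply: near_eq_cvg; apply: filterS GF => s ->.
Unshelve. all: by end_near. Qed.

Let cA' tau : tau < 1 -> {for tau, continuous A'}.
Proof.
move=> t1; apply: cvgD.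
  apply: (pairing_continuous (F := wave_t) (k := fun s => re (h s))) => //.
  - by move=> s; exact: wave_t_L2.
  - exact: wave_t_cvg.
apply: (pairing_continuous (F := wave_lap) (k := fun s => im (h s))) => //.
- by move=> s; exact: wave_lap_L2.
- exact: wave_lap_cvg.
Qed.

Let cB' tau : tau < 1 -> {for tau, continuous B'}.
Proof.
move=> t1; apply: cvgD.
  apply: (pairing_continuous (F := wave_t) (k := fun s => im (h s))) => //.
  - by move=> s; exact: wave_t_L2.
  - exact: wave_t_cvg.
apply: cvgN; apply: (pairing_continuous (F := wave_lap) (k := fun s => re (h s))) => //.
- by move=> s; exact: wave_lap_L2.
- exact: wave_lap_cvg.
Qed.

Lemma dot_source tau : tau < 1 ->
  dot_L2 (U (t - tau) (source tau)) g = Complex (- B' tau) (- A' tau).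
Proof.
move=> t1; have hs := source_L2 t1.
rewrite group_adjoint// opprB; have hh : in_Lq 2%:E (U (tau - t) g) by exact: (group_L2 hU).
have wl := wave_lap_L2 n2 t1; have wt := wave_t_L2 n2 t1.
have sE : source tau = fun x => Complex (wave_lap tau x) (- wave_t tau x).
  by apply/funext => x; exact: sourceE.
rewrite sE in hs *.
have Lr : L2 (re (U (tau - t) g)) by exact: hr.
have Li : L2 (im (U (tau - t) g)) by exact: hi.
apply: complex_ext; rewrite ?Re_dot_L2 ?Im_dot_L2//= ipNl//.
  by rewrite /B' opprD opprK addrC.
by rewrite /A' opprD.
Qed.

Lemma dot_solution tau :
  dot_L2 (U (t - tau) (solution tau)) g = Complex (A tau) (- B tau).
Proof.
have hs := solution_L2 tau.
rewrite group_adjoint// opprB; have hh : in_Lq 2%:E (U (tau - t) g) by exact: (group_L2 hU).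
by apply: complex_ext; rewrite ?Re_dot_L2 ?Im_dot_L2//= ip_zero ?addr0 ?sub0r.
Qed.

(** The equation makes the scalar product of [g] with [U (t - tau) (V u)(tau)] the
    derivative, up to the factor [i], of its scalar product with
    [U (t - tau) u(tau)]. *)
Lemma integral_dot_source s : 0 < s < 1 ->
  cmeasurable `]0, s[ (fun tau => dot_L2 (U (t - tau) (source tau)) g) /\
  cintegral (@lebesgue_measure R) `]0, s[
    (fun tau => dot_L2 (U (t - tau) (source tau)) g) =
  Complex (- (B s - B 0)) (- (A s - A 0)).
Proof.
move=> /andP[s0 s1].
have inE' tau : tau \in `]0, s[%classic -> tau < 1.
  by rewrite inE/= in_itv/= => /andP[_ /lt_trans]; apply.
have E : {in `]0, s[%classic, (fun tau => dot_L2 (U (t - tau) (source tau)) g) =1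
    (fun tau => Complex (- B' tau) (- A' tau))}.
  by move=> tau /inE' /dot_source.
have mneg (k : R -> R) : (forall tau, tau < 1 -> {for tau, continuous k}) ->
    measurable_fun `]0, s[ (fun tau => - k tau).
  move=> ck; apply: open_continuous_measurable_fun => // tau /inE' tau1.
  by apply: cvgN; exact: ck.
have ineg (K k : R -> R) : (forall tau, tau < 1 -> is_derive tau 1 K (k tau)) ->
    (forall tau, tau < 1 -> {for tau, continuous k}) ->
    \int[@lebesgue_measure R]_(tau in `]0, s[) (- k tau) = - (K s - K 0).
  move=> dK ck.
  have lt1 tau : 0 <= tau <= s -> tau < 1 by move=> /andP[_ /le_lt_trans]; apply.
  have dn tau : 0 <= tau <= s -> is_derive tau 1 (fun r => -1 * K r) (- k tau).
    move=> /lt1 tau1; have H := is_derive_fun_mul (is_derive_fun_cst (-1 : R) tau 1) (dK tau tau1).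
    by apply: (is_derive_eq H); rewrite mul0r add0r mulN1r.
  have cn tau : 0 <= tau <= s -> {for tau, continuous (fun r => - k r)}.
    by move=> /lt1 tau1; apply: cvgN; exact: ck.
  rewrite /Rintegral -(@integral_itv_bndoo R 0 s _ true false); last first.
    by apply/measurable_EFinP; exact: mneg.
  have -> := @FTC2_is_derive R (fun r => -1 * K r) (fun r => - k r) 0 s s0 dn cn.
  rewrite /=.
  by ring.
split.
  split.
    apply: (eq_measurable_fun (fun tau => - B' tau)); last exact: mneg.
    by move=> tau /E ->.
  apply: (eq_measurable_fun (fun tau => - A' tau)); last exact: mneg.
  by move=> tau /E ->.
apply: complex_ext.
  transitivity (\int[@lebesgue_measure R]_(tau in `]0, s[) (- B' tau)); last exact: ineg.
  by apply: eq_Rintegral => tau /E e; rewrite e.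
transitivity (\int[@lebesgue_measure R]_(tau in `]0, s[) (- A' tau)); last exact: ineg.
by apply: eq_Rintegral => tau /E e; rewrite e.
Qed.

End pairing_with_the_group.

(* [J t s] is the integral of the Duhamel integrand over [0, s], and [G t] its limit
   as [s] tends to [t] *)
Let J t s : fct := fun x => if 0 < s
  then - 'i%C * (U (t - s) (solution s) x - U t (solution 0) x) else 0.

Let G t : fct := fun x => - 'i%C * (solution t x - U t (solution 0) x).

Let G_L2 t : in_Lq 2%:E (G t).
Proof.
apply/in_Lq2_scale/in_Lq2_sub; first exact: solution_L2.
exact/(group_L2 hU)/solution_L2.
Qed.

Let J_L2 t s : in_Lq 2%:E (J t s).
Proof.
rewrite /J; case: ltP => _; last exact: in_Lq2_0.
by apply/in_Lq2_scale/in_Lq2_sub; exact/(group_L2 hU)/solution_L2.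
Qed.

Let dot_scale (c : R[i]) f g : in_Lq 2%:E f -> in_Lq 2%:E g ->
  dot_L2 (fun x => c * f x) g = c * dot_L2 f g.
Proof.
move=> hf hg; have hcf := in_Lq2_scale c hf.
have [/in_Lq2P[fr fi] /in_Lq2P[gr gi]] := (hf, hg).
have sc k w : L2 w -> L2 (fun x => k * w x) by exact: L2_scale.
have reE : re (fun x => c * f x) = fun x => Re c * Re (f x) - Im c * Im (f x).
  by apply/funext => x; rewrite ReM.
have imE : im (fun x => c * f x) = fun x => Re c * Im (f x) + Im c * Re (f x).
  by apply/funext => x; rewrite ImM.
apply: complex_ext; rewrite ?ReM ?ImM ?Re_dot_L2 ?Im_dot_L2// reE imE.
  by rewrite !ipBl ?ipDl ?ipZl//; try exact: sc; ring.
by rewrite !ipBl ?ipDl ?ipZl//; try exact: sc; ring.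
Qed.

Let dot_sub f1 f2 g : in_Lq 2%:E f1 -> in_Lq 2%:E f2 -> in_Lq 2%:E g ->
  dot_L2 (fun x => f1 x - f2 x) g = dot_L2 f1 g - dot_L2 f2 g.
Proof.
move=> h1 h2 hg; have h12 := in_Lq2_sub h1 h2.
have [/in_Lq2P[fr fi] /in_Lq2P[gr gi]] := (h1, h2).
have /in_Lq2P[kr ki] := hg.
have reE : re (fun x => f1 x - f2 x) = fun x => Re (f1 x) - Re (f2 x).
  by apply/funext => x; rewrite ReD ReN.
have imE : im (fun x => f1 x - f2 x) = fun x => Im (f1 x) - Im (f2 x).
  by apply/funext => x; rewrite ImD ImN.
apply: complex_ext; rewrite ?ReD ?ImD ?ReN ?ImN ?Re_dot_L2 ?Im_dot_L2// reE imE.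
  by rewrite !ipBl//; ring.
by rewrite !ipBl//; ring.
Qed.

Lemma source_integral t s : s < 1 ->
  is_L2_integral `]0, s[ (fun tau => U (t - tau) (source tau)) (J t s).
Proof.
move=> s1; have [s0|s0] := leP s 0.
  have -> : `]0, s[%classic = set0 :> set R by rewrite set_itv_ge// bnd_simp -leNgt.
  split.
  - by apply: aeW.
  - by move=> g hg; split; exact: measurable_fun_set0.
  - by rewrite integral_set0.
  - exact: J_L2.
  - move=> g hg; rewrite /J ltNge s0/= /cintegral !Rintegral_set0.
    by have := dot_scale 0 (in_Lq2_0 R n) hg; rewrite !mul0r => ->.
split.
- apply: aeW => tau; rewrite /= in_itv/= => /andP[_ ts].
  by apply/(group_L2 hU)/source_L2; exact: lt_trans s1.
- by move=> g hg; have [] := integral_dot_source t hg (s := s); rewrite ?s0.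
- have [M bM] := wave_source_bounded n2 s1.
  apply: (@le_lt_trans _ _ (\int[@lebesgue_measure R]_(tau in `]0%R, s[)
      (Num.sqrt M)%:E)%E); last first.
    rewrite integral_cst//= lebesgue_measure_itv/= lte_fin s0 -EFinD -EFinM.
    exact: ltry.
  apply: integral_mono; first by move=> x _; exact: Lnorm_ge0.
  move=> tau; rewrite /= in_itv/= => /andP[t0 ts].
  have t1 : tau < 1 by exact: lt_trans s1.
  rewrite Lq_norm2E; last exact/(group_L2 hU)/source_L2.
  rewrite lee_fin ler_wsqrtr// group_cL2sq//; last exact: source_L2.
  rewrite /cL2sq; have -> : source tau = fun x => Complex (wave_lap tau x) (- wave_t tau x).
    by apply/funext => x; exact: sourceE.
  rewrite /= addrC (_ : (fun x => - wave_t tau x) = fun x => -1 * wave_t tau x); last first.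
    by apply/funext => x; rewrite mulN1r.
  rewrite L2sq_scale ?sqrrN ?expr1n ?mul1r; last exact: wave_t_L2.
  by apply: bM; rewrite !ltW.
- exact: J_L2.
- move=> g hg; have [|_ ->] := integral_dot_source t hg (s := s); first by rewrite s0.
  have uL tau : in_Lq 2%:E (U (t - tau) (solution tau)).
    exact/(group_L2 hU)/solution_L2.
  have uL0 : in_Lq 2%:E (U t (solution 0)) by exact/(group_L2 hU)/solution_L2.
  rewrite (_ : J t s = fun x => - 'i%C * (U (t - s) (solution s) x - U t (solution 0) x)); last first.
    by apply/funext => x; rewrite /J s0.
  rewrite dot_scale//; last exact: in_Lq2_sub.
  rewrite dot_sub// dot_solution// -[in U t _](subr0 t) dot_solution//.
  by apply: complex_ext; rewrite ?ReM ?ImM ?ReD ?ImD ?ReN ?ImN/=; ring.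
Qed.

Let cL2sq_iscale f : cL2sq (fun x => - 'i%C * f x) = cL2sq f.
Proof.
rewrite /cL2sq addrC; congr (_ + _).
  rewrite -[RHS]L2sq_opp; congr (L2sq _); apply/funext => x.
  by rewrite ImM ReN ImN/= oppr0 mul0r add0r mulN1r.
congr (L2sq _); apply/funext => x.
by rewrite ReM ReN ImN/= oppr0 mul0r sub0r mulN1r opprK.
Qed.

Let cL2sq_zero : cL2sq (fun _ : V => 0) = 0.
Proof. by rewrite /cL2sq /= L2sq_zero addr0. Qed.

Let cL2sq_solution_zero : cL2sq (fun x => solution 0 x - U 0 (solution 0) x) = 0.
Proof.
have h0 := solution_L2 0.
transitivity (cL2sq (fun _ : V => 0)); last exact: cL2sq_zero.
apply: cL2sq_ae.
- exact: (in_Lq2_sub h0 (group_L2 hU 0 h0)).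
- exact: in_Lq2_0.
- by have := group0 hU h0; apply: filterS => x ->; rewrite subrr.
Qed.

(* strong continuity of the group, and continuity of the solution carried along by
   unitarity *)
Let group_solution_cvg t : 0 < t <= 1 ->
  cL2sq (fun x => U (t - s) (solution s) x - solution t x) @[s --> t^'-] --> 0.
Proof.
move=> /andP[t0 t1]; have hs r := solution_L2 r.
have hU' r p : in_Lq 2%:E (U r (solution p)) by exact: (group_L2 hU).
pose b1 s := cL2sq (fun x => solution s x - solution t x).
pose b2 s := cL2sq (fun x => U (t - s) (solution t) x - U 0 (solution t) x).
have bound s : cL2sq (fun x => U (t - s) (solution s) x - solution t x)
    <= 2 * b1 s + 2 * b2 s.
  have lin : cL2sq (fun x => U (t - s) (solution s) x - U (t - s) (solution t) x) = b1 s.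
    rewrite /b1 -[RHS](group_cL2sq hU (t - s)); last exact: in_Lq2_sub.
    apply: cL2sq_ae; first exact: in_Lq2_sub.
      by apply: (group_L2 hU); exact: in_Lq2_sub.
    have := group_linear hU (t - s) (-1) (hs t) (hs s).
    apply: filterS => x.
    rewrite (_ : (fun x => -1 * solution t x + solution s x) =
      (fun x => solution s x - solution t x)) => [->|].
      by rewrite mulN1r addrC.
    by apply/funext => y; rewrite mulN1r addrC.
  have zz : cL2sq (fun x => U (t - s) (solution t) x - solution t x) = b2 s.
    apply: cL2sq_ae; [exact: in_Lq2_sub|exact: in_Lq2_sub|].
    by have := group0 hU (hs t); apply: filterS => x ->.
  rewrite -lin -zz.
  apply: le_trans (cL2sq_add_le (in_Lq2_sub (hU' _ _) (hU' _ _)) (in_Lq2_sub (hU' _ _) (hs t))).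
  by under [X in _ <= cL2sq X]eq_fun do rewrite addrA subrK.
have c1 : b1 s @[s --> t^'-] --> 0.
  have := wave_continuous_L2 n2 t; under eq_fun do rewrite -cL2sq_solution_sub.
  apply: cvg_trans; apply: cvg_app => S hS.
  have hS' : \forall s \near t, `[0, 1]%classic s -> S s by exact: hS.
  have hp : \forall s \near t, 0 < s by exact: lt_nbhsr.
  suff : \forall s \near t, s < t -> S s by [].
  apply: filterS2 hS' hp => s h s0 st; apply: h.
  by rewrite /= in_itv/= (ltW s0) (le_trans (ltW st)).
have c2 : b2 s @[s --> t^'-] --> 0.
  have [cr ci] := group_cvg hU 0 (hs t).
  have c : cL2sq (fun x => U r (solution t) x - U 0 (solution t) x) @[r --> 0] --> 0.
    have h := cvgD cr ci; rewrite addr0 in h.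
    rewrite (_ : (fun r => cL2sq _) = (fun r =>
      L2sq (fun x => Re (U r (solution t) x) - Re (U 0 (solution t) x))
      + L2sq (fun x => Im (U r (solution t) x) - Im (U 0 (solution t) x)))); first exact: h.
    by apply/funext => r; rewrite cL2sq_sub.
  apply: (@cvg_comp _ _ _ (fun s => t - s) (fun r => cL2sq (fun x => U r (solution t) x - U 0 (solution t) x)) _ _ _ _ c).
  have c' : t - s @[s --> t] --> 0.
    by rewrite -[X in _ --> X](subrr t); apply: cvgB; [exact: cvg_cst|exact: cvg_id].
  by apply: cvg_trans c'; apply: cvg_app; exact: cvg_within.
apply: (@cvg0_le R R (t^'-) _ _ (fun s => 2 * b1 s + 2 * b2 s)) => [s|].
  by rewrite cL2sq_ge0 bound.
rewrite [X in _ --> X](_ : 0 = 2 * 0 + 2 * 0); last by ring.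
by apply: cvgD; apply: cvgM => //; exact: cvg_cst.
Qed.

Lemma solution_mild : mild_solution U potential solution.
Proof.
split.
  by apply: aeW => tau; rewrite in_itv/= => /andP[_ t1]; exact: source_L2.
move=> t; rewrite in_itv/= => /andP[t0 t1]; exists (G t); last first.
  apply: aeW => x; rewrite /G mulrA mulrN -expr2 sqr_i opprK mul1r.
  by rewrite addrC subrK.
exists (J t); split; first by move=> s st; apply: source_integral; exact: lt_le_trans t1.
split; first exact: G_L2.
apply/(Lq_norm2_cvg0P _).
  by apply: nearW => s; apply: in_Lq2_sub; [exact: J_L2|exact: G_L2].
move: t0; rewrite le_eqVlt => /predU1P[t0|t0]; last first.
  have c := group_solution_cvg (t := t); rewrite t0 t1 in c; have {}c := c isT.
  apply: cvg_trans c; apply: near_eq_cvg; near=> s.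
  have s0 : 0 < s by near: s; apply: nbhs_left_gt.
  rewrite -cL2sq_iscale; congr (cL2sq _); apply/funext => x.
  by rewrite /J s0 /G -mulrBr opprB addrA subrK.
rewrite -t0; have c0 : (fun _ : R => 0 : R) @ (0 : R)^'- --> (0 : R) by exact: cvg_cst.
apply: cvg_trans c0; apply: near_eq_cvg; near=> s.
have s0 : s < 0 by near: s; exact: nbhs_left_lt.
have E x : J 0 s x - G 0 x = - (- 'i%C * (solution 0 x - U 0 (solution 0) x)).
  by rewrite /J ltNge (ltW s0)/= sub0r.
transitivity (cL2sq (fun x => - 'i%C * (solution 0 x - U 0 (solution 0) x))).
  by rewrite cL2sq_iscale cL2sq_solution_zero.
rewrite /cL2sq; congr (_ + _).
  by rewrite -[LHS]L2sq_opp; congr (L2sq _); apply/funext => x; rewrite E ReN.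
by rewrite -[LHS]L2sq_opp; congr (L2sq _); apply/funext => x; rewrite E ImN.
Unshelve. all: by end_near. Qed.

End mild_solution_wave.

(** * Mixed space-time norms *)

Section mixed_norms.
Context (R : realType) (n : nat).
Local Notation mu := (@lebesgue_measure R).
Local Notation nu := (lebesgue_row R n).
Local Notation fct := ('rV[R]_n -> R[i]).

Lemma ge0_integral_mrestr d (T : measurableType d) (m : {measure set T -> \bar R})
    (D : set T) (mD : measurable D) (f : T -> \bar R) :
  measurable_fun setT f -> (forall x, 0 <= f x)%E ->
  (\int[mrestr m mD]_x f x = \int[m]_(x in D) f x)%E.
Proof.
move=> mf f0.
rewrite (@ge0_negligible_integral _ _ _ (mrestr m mD) setT (~` D))//; last 2 first.
  exact: measurableC.
  by rewrite /= /mrestr setIC setICr measure0.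
rewrite setDE setTI setCK; apply: eq_measure_integral => A mA AD.
by rewrite /= /mrestr (setIidl AD).
Qed.

Lemma Lq_norm_real (q : R) (f : fct) :
  Lq_norm q%:E f = ((\int[nu]_x (modulus (f x) `^ q)%:E) `^ q^-1)%E.
Proof.
rewrite /Lq_norm unlock; congr (_ `^ _)%E; apply: eq_integral => x _.
by rewrite /= ger0_norm ?modulus_ge0.
Qed.

(** Monotonicity holds for arbitrary functions, integrals of nonnegative functions
    being suprema over simple functions. *)
Lemma Lq_norm_mono (q : R) (f g : fct) : 0 < q ->
  (forall x, modulus (f x) <= modulus (g x)) ->
  (Lq_norm q%:E f <= Lq_norm q%:E g)%E.
Proof.
move=> q0 fg; rewrite !Lq_norm_real; apply: gt0_ler_poweR.
- by rewrite invr_ge0 ltW.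
- by rewrite in_itv/= leey andbT integral_ge0// => x _; rewrite lee_fin powR_ge0.
- by rewrite in_itv/= leey andbT integral_ge0// => x _; rewrite lee_fin powR_ge0.
- apply: integral_mono => x _; rewrite lee_fin ?powR_ge0//.
  by apply: ge0_ler_powR; rewrite ?nnegrE ?modulus_ge0// ltW.
Qed.

Lemma measurable_Lq_norm (q : R) (u : R -> fct) :
  measurable_fun setT (fun z : measurableTypeR R * 'rV[R]_n => modulus (u z.1 z.2)) ->
  measurable_fun setT (fun t : measurableTypeR R => Lq_norm q%:E (u t)).
Proof.
move=> mu2; under eq_fun do rewrite Lq_norm_real.
apply: (measurableT_comp (measurable_poweR _)).
pose f z : \bar R := ((modulus (u z.1 z.2)) `^ q)%:E.
apply: (@measurable_fun_fubini_tonelli_F _ _ (measurableTypeR R) 'rV[R]_n R nu f).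
  apply/measurable_EFinP.
  by apply: (@measurableT_comp _ _ _ _ _ _ (fun x : R => x `^ q)) => //; exact: measurable_powR.
by move=> z; rewrite lee_fin powR_ge0.
Qed.

Lemma LpLq_norm_real (a b p q : R) (u : R -> fct) :
  measurable_fun setT (fun z : measurableTypeR R * 'rV[R]_n => modulus (u z.1 z.2)) ->
  LpLq_norm a b p%:E q%:E u =
    ((\int[mu]_(t in `]a, b[) (Lq_norm q%:E (u t) `^ p)) `^ p^-1)%E.
Proof.
move=> mu2; rewrite /LpLq_norm unlock; congr (_ `^ _)%E.
rewrite ge0_integral_mrestr.
- by apply: eq_integral => t _; rewrite gee0_abs// Lnorm_ge0.
- apply: (measurableT_comp (measurable_poweR _)).
  by apply: measurableT_comp => //; exact: measurable_Lq_norm.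
- by move=> t; exact: poweR_ge0.
Qed.

Lemma LpLq_norm_finite (a b p q : R) (u : R -> fct) (h : R -> R) : 0 < p ->
  measurable_fun setT (fun z : measurableTypeR R * 'rV[R]_n => modulus (u z.1 z.2)) ->
  (forall t, a < t < b -> 0 <= h t) ->
  (forall t, a < t < b -> (Lq_norm q%:E (u t) <= (h t)%:E)%E) ->
  (\int[mu]_(t in `]a, b[) (h t `^ p)%:E < +oo)%E ->
  (LpLq_norm a b p%:E q%:E u < +oo)%E.
Proof.
move=> p0 mu2 h0 uh hfin; rewrite LpLq_norm_real// poweR_lty//.
apply: le_lt_trans hfin; apply: integral_mono => t; first by move=> _; exact: poweR_ge0.
rewrite /= in_itv/= => tab; rewrite -poweR_EFin; apply: gt0_ler_poweR.
- exact: ltW.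
- by rewrite in_itv/= leey andbT; exact: Lnorm_ge0.
- by rewrite in_itv/= leey andbT lee_fin h0.
- exact: uh.
Qed.

End mixed_norms.

Section time_integrals.
Context (R : realType).
Local Notation mu := (@lebesgue_measure R).

Let derive_gap (t : R) : is_derive t 1 (fun y : R => 1 - y) (-1).
Proof.
have H := is_derive_fun_add (is_derive_fun_cst (1 : R) t 1) (is_derive_fun_mul (is_derive_fun_cst (-1 : R) t 1) (is_derive_fun_id t)).
rewrite (_ : (fun y => 1 - y) = (fun y => 1 + -1 * y)).
  by apply: (is_derive_eq H); rewrite mul0r add0r add0r mulr1.
by apply/funext => y; rewrite mulN1r.
Qed.

Let derive_gap_powR (p t : R) : t < 1 ->
  is_derive t 1 (fun y => (1 - y) `^ p) (- (p * (1 - t) `^ (p - 1))).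
Proof.
move=> t1; have t0 : 0 < 1 - t by rewrite subr_gt0.
have H := is_derive_fun_comp (f := fun y : R => 1 - y) (is_derive1_powR p t0) (derive_gap t).
by apply: (is_derive_eq H); rewrite mulrN1.
Qed.

Lemma integral_gap_power_finite (C k : R) : 0 <= C -> k < 1 ->
  (\int[mu]_(t in `]0%R, 1%R[) (C * (1 - t) `^ (- k))%:E < +oo)%E.
Proof.
move=> C0 k1; have k10 : 0 < 1 - k by rewrite subr_gt0.
apply: (@le_lt_trans _ _ (C / (1 - k))%:E); last exact: ltry.
apply: (@integral_oo01_FTC_le _ (fun t => - (C / (1 - k)) * (1 - t) `^ (1 - k))
   (fun t => C * (1 - t) `^ (- k))).
- move=> t /andP[_ t1].
  have H := is_derive_fun_mul (is_derive_fun_cst (- (C / (1 - k))) t 1) (derive_gap_powR (1 - k) t1).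
  apply: (is_derive_eq H); rewrite mul0r add0r mulrNN.
  rewrite (_ : 1 - k - 1 = - k); last by ring.
  by rewrite mulrA divfK// gt_eqF.
- move=> t /andP[_ t1].
  exact: is_derive_continuous (is_derive_fun_mul (is_derive_fun_cst C t 1) (derive_gap_powR (- k) t1)).
- by move=> t _; rewrite mulr_ge0// powR_ge0.
- apply: measurable_funM => //.
  apply: (@measurableT_comp _ _ _ _ _ _ (fun x : R => x `^ (- k))) => //.
  exact: measurable_funB.
- move=> x y x0 xy y1; rewrite !mulNr opprK addrC.
  have D0 : 0 <= C / (1 - k) by rewrite divr_ge0// ltW.
  apply: (@le_trans _ _ (C / (1 - k) * (1 - x) `^ (1 - k))).
    by rewrite gerBl mulr_ge0// powR_ge0.
  rewrite -[leRHS]mulr1 ler_wpM2l//.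
  rewrite [leRHS](_ : 1 = 1 `^ (1 - k)); last by rewrite powR1.
  apply: ge0_ler_powR; rewrite ?nnegrE ?(ltW k10)// ?subr_ge0 ?gerBl ?(ltW x0)//.
  exact/ltW/(lt_trans xy).
Qed.

Lemma integral_gap_inverse_infinite (c : R) : 0 < c ->
  (\int[mu]_(t in `]0%R, 1%R[) (c / (1 - t))%:E = +oo)%E.
Proof.
move=> c0; pose I := (\int[mu]_(t in `]0%R, 1%R[) (c / (1 - t))%:E)%E.
have mG : measurable_fun setT (fun t : R => c / (1 - t)).
  by apply: measurable_funM => //; apply: measurable_fun_invr; exact: measurable_funB.
have G0 t : t < 1 -> 0 <= c / (1 - t) by move=> t1; rewrite divr_ge0 ?subr_ge0// ltW.
have I0 : (0 <= I)%E.
  by apply: integral_ge0 => t; rewrite /= in_itv/= => /andP[_ t1]; rewrite lee_fin G0.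
suff big (A : R) : 0 < A -> (A%:E <= I)%E.
  by apply/eqyP => A A0; exact: big.
move=> A0; pose e : R := expR (- (A / c)) / 2.
have e0 : 0 < e by rewrite divr_gt0 ?expR_gt0.
have e2 : e < 2^-1.
  rewrite /e -[ltRHS]mul1r ltr_pM2r ?invr_gt0// expR_lt1 oppr_lt0.
  by rewrite divr_gt0.
have half1 : (2^-1 : R) < 1 - e.
  have : (2^-1 : R) + 2^-1 = 1 by field.
  by move=> h; lra.
have d01 x : 2^-1 <= x <= 1 - e -> x < 1 by move=> /andP[_ h]; apply: le_lt_trans h _; lra.
have dF x : 2^-1 <= x <= 1 - e -> is_derive x 1 (fun t : R => - c * ln (1 - t)) (c / (1 - x)).
  move=> /d01 x1; have x0 : 0 < 1 - x by rewrite subr_gt0.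
  have H := is_derive_fun_mul (is_derive_fun_cst (- c) x 1) (is_derive_fun_comp (f := fun y : R => 1 - y) (is_derive1_ln x0) (derive_gap x)).
  by apply: (is_derive_eq H); rewrite mul0r add0r mulrN1 mulrNN.
have cG x : 2^-1 <= x <= 1 - e -> {for x, continuous (fun t : R => c / (1 - t))}.
  move=> /d01 x1; have x0 : 1 - x != 0 by rewrite subr_eq0 eq_sym lt_eqF.
  exact: is_derive_continuous (is_derive_fun_mul (is_derive_fun_cst c x 1) (is_derive_fun_inv (f := fun y : R => 1 - y) x0 (derive_gap x))).
have E := FTC2_is_derive half1 dF cG.
have -> : A%:E = (- c * ln (1 - (1 - e)) - - c * ln (1 - 2^-1))%:E.
  congr EFin; rewrite (_ : 1 - (1 - e) = e); last by ring.
  rewrite (_ : 1 - 2^-1 = 2^-1 :> R); last by field.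
  rewrite /e lnM ?posrE ?expR_gt0 ?invr_gt0// expRK.
  by field; rewrite gt_eqF.
rewrite -E; apply: ge0_subset_integral => //=.
- by apply: measurable_funTS; exact/measurable_EFinP.
- by move=> t; rewrite /= in_itv/= => /andP[_ t1]; rewrite lee_fin G0.
- move=> t; rewrite /= !in_itv/= => h; rewrite (d01 _ h) andbT.
  by case/andP: h => h _; apply: lt_le_trans h; rewrite invr_gt0.
Qed.

End time_integrals.

(** * The norms of the potential and of the solution *)

Section norms_of_the_construction.
Context (R : realType) (n : nat).
Hypothesis n2 : (2 <= n)%N.
Local Notation mu := (@lebesgue_measure R).
Local Notation nu := (lebesgue_row R n).
Local Notation V := 'rV[R]_n.
Local Notation a := (n%:R / 4 : R).
Local Notation wave := (@wave R n).
Local Notation solution := (@solution R n).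
Local Notation potential := (@potential R n).
Implicit Types (s t : R) (x : V).
Let ha : 4^-1 <= a := exponent_ge R n2.

Let scale_powR t : t < 1 -> scale t = (1 - t) `^ 2.
Proof. by move=> t1; rewrite powR_mulrn// subr_ge0 ltW. Qed.

Lemma modulus_solution t x : modulus (solution t x) = wave t x.
Proof. by rewrite modulus_real gtr0_norm// wave_gt0. Qed.

Lemma measurable_modulus_solution : measurable_fun setT
  (fun z : measurableTypeR R * V => modulus (solution z.1 z.2)).
Proof. by under eq_fun do rewrite modulus_solution; exact: measurable_wave2. Qed.

Lemma cmeasurable_solution (D : set (measurableTypeR R * V)%type) :
  cmeasurable D (fun z => solution z.1 z.2).
Proof. by split => //=; apply: measurable_funTS; exact: measurable_wave2. Qed.

Lemma cmeasurable_potential (D : set (measurableTypeR R * V)%type) :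
  cmeasurable D (fun z => potential z.1 z.2).
Proof.
have iw : measurable_fun setT (fun z : measurableTypeR R * V => (wave z.1 z.2)^-1).
  by apply: measurable_fun_invr; exact: measurable_wave2.
split; apply: measurable_funTS; apply: measurable_funM => //.
  exact: measurable_wave_lap2.
have -> : (fun z : measurableTypeR R * V => - @wave_t R n z.1 z.2) =
    (fun z : measurableTypeR R * V => -1 * @wave_t R n z.1 z.2).
  by apply/funext => z; rewrite mulN1r.
by apply: measurable_funM => //; exact: measurable_wave_t2.
Qed.

Let Cpot : R := (2 * n%:R + 6) * slope_bound a.

Let Cpot_ge0 : 0 <= Cpot.
Proof. by rewrite mulr_ge0 ?addr_ge0 ?mulr_ge0// (le_trans _ (slope_bound_ge1 ha)). Qed.

Let potential_le t x : 0 < t < 1 ->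
  modulus (potential t x) <= Cpot / (scale t + sqnorm x).
Proof.
move=> /andP[t0 t1]; have tN1 : t != 1 by rewrite lt_eqF.
have w0 := wave_gt0 t x; have r0 : 0 < scale t + sqnorm x.
  by rewrite ltr_pwDl ?scale_gt0 ?sqnorm_ge0.
apply: le_trans (modulus_le _) _; rewrite /= !normrM normrN normfV (gtr0_norm w0) -mulrDl.
rewrite ler_pdivrMr//; apply: le_trans (lerD (wave_lap_le n2 x tN1) (wave_t_le n2 x tN1)) _.
rewrite -mulrDl [leRHS]mulrAC ler_wpM2r ?invr_ge0 ?(ltW r0)//.
rewrite -mulrDl ler_wpM2r ?(ltW w0)// /Cpot -mulrDl.
rewrite ler_wpM2r ?(le_trans _ (slope_bound_ge1 ha))//.
have : `|1 - t| <= 1 by rewrite ger0_norm ?subr_ge0 ?(ltW t1)// gerBl ltW.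
by move: (`|1 - t|) => m m1; lra.
Qed.

(** The potential is at most a multiple of [1 / (scale t + |x|^2)], whose norm is
    known by [inverse_power_bound]. *)
Lemma potential_norm_le (p : R) : n%:R / 2 < p -> exists2 C : R, 0 <= C &
  forall t, 0 < t < 1 ->
    (Lq_norm p%:E (potential t) <= (C * (1 - t) `^ (- (2 - n%:R / p)))%:E)%E.
Proof.
move=> np; have p0 : 0 < p by apply: le_lt_trans np; rewrite divr_ge0.
pose K : R := p * 2 ^+ n / (p - n%:R / 2).
have K0 : 0 <= K by rewrite divr_ge0 ?subr_ge0 ?(ltW np)// mulr_ge0 ?exprn_ge0// ltW.
exists ((Cpot `^ p * K) `^ p^-1); first exact: powR_ge0.
move=> t t01; have /andP[t0 t1] := t01.
have e0 : 0 < scale t by apply: scale_gt0; rewrite lt_eqF.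
rewrite Lq_norm_real.
have ip0 : 0 <= p^-1 by rewrite invr_ge0 ltW.
have bnd1 : (\int[nu]_x (modulus (potential t x) `^ p)%:E <=
    (Cpot `^ p * K * scale t `^ (n%:R / 2 - p))%:E)%E.
  apply: (@le_trans _ _ (\int[nu]_x ((Cpot `^ p)%:E * ((scale t + sqnorm x) `^ (- p))%:E))%E).
    apply: integral_mono => x _; first by rewrite lee_fin powR_ge0.
    have r0 : 0 < scale t + sqnorm x by rewrite ltr_pwDl ?sqnorm_ge0.
    rewrite -EFinM lee_fin (_ : _ `^ (- p) = (scale t + sqnorm x)^-1 `^ p); last first.
      by rewrite -mulN1r powRrM powR_inv1 ?(ltW r0).
    rewrite -powRM ?invr_ge0 ?(ltW r0)//.
    apply: ge0_ler_powR; rewrite ?nnegrE ?modulus_ge0 ?divr_ge0 ?(ltW p0) ?(ltW r0)//.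
    exact: potential_le.
  rewrite ge0_integralZl//; last 3 first.
  - apply/measurable_EFinP.
    apply: (@measurableT_comp _ _ _ _ _ _ (fun x : R => x `^ (- p))) => //.
    by apply: measurable_funD => //; exact: measurable_sqnorm.
  - by move=> x _; rewrite lee_fin powR_ge0.
  - by rewrite lee_fin powR_ge0.
  rewrite -mulrA EFinM; apply: lee_wpmul2l; first by rewrite lee_fin powR_ge0.
  exact: (inverse_power_bound n2 np e0).
apply: le_trans (gt0_ler_poweR ip0 _ _ bnd1) _.
- by rewrite in_itv/= leey andbT integral_ge0// => x _; rewrite lee_fin powR_ge0.
- rewrite in_itv/= leey andbT lee_fin; apply: mulr_ge0; last exact: powR_ge0.
  by apply: mulr_ge0 K0; exact: powR_ge0.
rewrite poweR_EFin lee_fin powRM ?powR_ge0//; last by apply: mulr_ge0 K0; exact: powR_ge0.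
apply: ler_wpM2l; first exact: powR_ge0.
rewrite scale_powR// -!powRrM le_eqVlt; apply/orP; left; apply/eqP; congr (_ `^ _).
by field; rewrite gt_eqF.
Qed.

(** The hypothesis says that [r * (2 - n / p) < 1], that is, that the power [r] of
    the bound of [potential_norm_le] is integrable up to time 1. *)
Lemma potential_in_LrLs (r p : R) : 1 <= r -> n%:R / 2 < p ->
  1 / (2 * r) + n%:R / (2 * p) > 1 -> in_LpLq 0 1 r%:E p%:E potential.
Proof.
move=> r1 np rp; split; first exact: cmeasurable_potential.
have r0 : 0 < r by apply: lt_le_trans r1.
have p0 : 0 < p by apply: le_lt_trans np; rewrite divr_ge0.
have [C C0 hC] := potential_norm_le np.
have gap : r * (2 - n%:R / p) < 1.
  have e : 1 / (2 * r) + n%:R / (2 * p) = (r^-1 + n%:R / p) / 2.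
    by field; rewrite !gt_eqF.
  have h : 2 - n%:R / p < r^-1.
    by move: rp; rewrite e; move: (n%:R / p) (r^-1) => u v; lra.
  by rewrite -(ltr_pM2l r0) divff ?gt_eqF// in h.
apply: (@LpLq_norm_finite R n 0 1 r p _ (fun t => C * (1 - t) `^ (- (2 - n%:R / p)))) => //.
- by apply: measurable_modulus; exact: cmeasurable_potential.
- by move=> t _; rewrite mulr_ge0// powR_ge0.
- have := integral_gap_power_finite (powR_ge0 C r) gap.
  congr (_ < _)%E; apply: eq_integral => t _; congr EFin.
  by rewrite powRM ?powR_ge0// -powRrM mulNr [_ * r]mulrC.
Qed.

(** The solution increases with time until 1, so only its norm at time [T] matters;
    there it is bounded and square integrable, and [q >= 2]. *)
Lemma solution_in_LpLq (p q T : R) : 0 < p -> 2 <= q -> 0 < T < 1 ->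
  in_LpLq 0 T p%:E q%:E solution.
Proof.
move=> p0 q2 /andP[T0 T1]; split; first exact: cmeasurable_solution.
have q0 : 0 < q by apply: lt_le_trans q2.
have TN1 : T != 1 by rewrite lt_eqF.
have e0 : 0 < scale T by apply: scale_gt0.
have fin : (Lq_norm q%:E (solution T) < +oo)%E.
  rewrite Lq_norm_real poweR_lty//.
  pose B := profile a (scale T) `^ (q - 2).
  have [_ iw] := wave_L2 n2 T.
  have /integrableP[_] := integrableZl measurableT B iw; apply: le_lt_trans.
  apply: integral_mono => x _; first by rewrite lee_fin powR_ge0.
  have w0 := wave_gt0 T x.
  rewrite -EFinM gee0_abs; last by rewrite lee_fin; apply: mulr_ge0; [exact: powR_ge0|exact: sqr_ge0].
  rewrite lee_fin modulus_solution.
  rewrite -powR_mulrn ?(ltW w0)//.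
  rewrite -[X in wave T x `^ X <= _](subrK 2 q) powRD ?(gt_eqF w0) ?implybT//.
  rewrite ler_wpM2r ?powR_ge0//; apply: ge0_ler_powR; rewrite ?nnegrE ?subr_ge0 ?(ltW w0)//.
    exact/ltW/profile_gt0.
  by apply: profile_nonincreasing => //; rewrite lerDl sqnorm_ge0.
have [M M0 ME] : exists2 M : R, 0 <= M & Lq_norm q%:E (solution T) = M%:E.
  have : (0 <= Lq_norm q%:E (solution T))%E by exact: Lnorm_ge0.
  by move: fin; case: (Lq_norm _ _) => // M _ M0; exists M.
apply: (@LpLq_norm_finite R n 0 T p q _ (fun=> M)) => //.
- exact: measurable_modulus_solution.
- move=> t /andP[t0 tT]; rewrite -ME; apply: Lq_norm_mono => // x.
  rewrite !modulus_solution; apply: wave_le => //.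
    by rewrite ltr_pwDl// sqnorm_ge0.
  rewrite /scale lerXn2r ?nnegrE ?subr_ge0 ?lerD2l ?lerN2 ?(ltW tT) ?(ltW T1)//.
  by rewrite ltW// (lt_trans tT).
- rewrite integral_cst//= lebesgue_measure_itv/= lte_fin T0 -EFinD -EFinM.
  exact: ltry.
Qed.

(** The exponential bound comes from the quadratic term of its power series. *)
Let log_weight_le_exp (b : R) : 0 < b -> forall L, log_weight L <= (16 + 2 / b ^+ 2) * expR (b * `|L|).
Proof.
move=> b0 L; have bL0 : 0 <= b * `|L| by rewrite mulr_ge0// ltW.
have := expR_ge1Dxn 1 bL0; rewrite (_ : 2`!%:R = 2)// => h.
have e1 : 1 <= expR (b * `|L|) by rewrite -expR0 ler_expR.
have -> : log_weight L = 16 + 2 / b ^+ 2 * ((b * `|L|) ^+ 2 / 2).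
  rewrite /log_weight -[L ^+ 2]real_normK ?num_real//; field; rewrite gt_eqF//.
rewrite [leRHS]mulrDl; apply: lerD; first by rewrite ler_peMr.
rewrite ler_wpM2l ?divr_ge0 ?exprn_ge0 ?(ltW b0)//.
by apply: le_trans h; rewrite lerDr.
Qed.

(** A logarithm costs less than any power of [d]. The power [d ^ (1 / p)] given
    away here is what the admissible norms can afford. *)
Lemma profile_ge_power (p : R) : 0 < p -> exists2 c : R, 0 < c & forall d, 0 < d -> d <= 1 ->
  c * d `^ (- (n%:R / 2) + p^-1) <= profile a ((n%:R + 1) * d ^+ 2).
Proof.
(* the logarithm of d ^ 2 enters with the coefficient b, hence d with the power
   2 * b = 1 / p *)
move=> p0; pose b : R := (2 * p)^-1.
have b0 : 0 < b by rewrite invr_gt0 mulr_gt0.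
pose K : R := 16 + 2 / b ^+ 2.
have K0 : 0 < K by rewrite ltr_pwDl// divr_ge0// exprn_ge0// ltW.
pose N : R := n%:R + 1.
have N1 : 1 <= N by rewrite lerDr.
have N0 : 0 < N by apply: lt_le_trans N1.
exists (expR (- a * ln N) * (K * expR (b * ln N))^-1).
  by rewrite mulr_gt0 ?expR_gt0// invr_gt0 mulr_gt0 ?expR_gt0.
move=> d d0 d1; have d20 : 0 < d ^+ 2 by rewrite exprn_gt0.
have LE : ln (N * d ^+ 2) = ln N + 2 * ln d.
  by rewrite lnM ?posrE// lnXn// mulr_natl.
have lnd : ln d <= 0 by rewrite ln_le0.
have lnN : 0 <= ln N by rewrite ln_ge0.
have absL : `|ln (N * d ^+ 2)| <= ln N - 2 * ln d.
  by rewrite LE ler_norml; apply/andP; split; lra.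
have dle : log_weight (ln (N * d ^+ 2)) <= K * (expR (b * ln N) * d `^ (- p^-1)).
  apply: le_trans (log_weight_le_exp b0 _) _; rewrite ler_wpM2l ?(ltW K0)//.
  rewrite /powR gt_eqF// -expRD ler_expR.
  apply: le_trans (ler_wpM2l (ltW b0) absL) _.
  rewrite le_eqVlt; apply/orP; left; apply/eqP; rewrite /b; field.
  by rewrite gt_eqF.
have E : expR (- a * ln (N * d ^+ 2)) = expR (- a * ln N) * d `^ (- (n%:R / 2)).
  by rewrite LE /powR gt_eqF// -expRD; congr expR; field.
rewrite /profile -/N E powRD ?(gt_eqF d0) ?implybT// -[leLHS]mulrA -[leRHS]mulrA.
rewrite ler_wpM2l ?expR_ge0// mulrCA ler_wpM2l ?powR_ge0//.
have -> : (K * expR (b * ln N))^-1 * d `^ p^-1 = (K * (expR (b * ln N) * d `^ (- p^-1)))^-1.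
  by rewrite powRN [K * (_ * _)]mulrA [RHS]invfM invrK.
by rewrite lef_pV2// posrE ?log_weight_gt0// !mulr_gt0 ?expR_gt0 ?powR_gt0.
Qed.

End norms_of_the_construction.

(** * Blow-up of the admissible norms *)

Section blow_up.
Context (R : realType) (n : nat).
Hypothesis n2 : (2 <= n)%N.
Local Notation mu := (@lebesgue_measure R).
Local Notation nu := (lebesgue_row R n).
Local Notation V := 'rV[R]_n.
Local Notation wave := (@wave R n).
Local Notation solution := (@solution R n).

Lemma Lq_norm_ge_cube (q m d : R) (f : V -> R[i]) : 0 < q -> 0 <= m -> 0 <= d ->
  measurable_fun setT (fun x => modulus (f x)) ->
  (forall x, cube d x -> m <= modulus (f x)) ->
  ((m * (d ^+ n) `^ q^-1)%:E <= Lq_norm q%:E f)%E.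
Proof.
move=> q0 m0 d0 mf fm; rewrite Lq_norm_real.
have iq0 : 0 <= q^-1 by rewrite invr_ge0 ltW.
have mE : m = (m `^ q) `^ q^-1 by rewrite -powRrM mulfV ?gt_eqF// powRr1.
rewrite {1}mE -powRM ?powR_ge0 ?exprn_ge0// -poweR_EFin.
apply: gt0_ler_poweR => //.
- by rewrite in_itv/= leey andbT lee_fin mulr_ge0 ?powR_ge0 ?exprn_ge0.
- by rewrite in_itv/= leey andbT integral_ge0// => x _; rewrite lee_fin powR_ge0.
have mc := @measurable_cube R n d.
have mfq : measurable_fun setT (fun x => (modulus (f x) `^ q)%:E).
  apply/measurable_EFinP.
  by apply: (@measurableT_comp _ _ _ _ _ _ (fun x : R => x `^ q)) => //; exact: measurable_powR.
apply: (@le_trans _ _ (\int[nu]_(x in cube d) (modulus (f x) `^ q)%:E)%E); last first.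
  by apply: ge0_subset_integral => // x _; rewrite lee_fin powR_ge0.
apply: (@le_trans _ _ (\int[nu]_(x in cube d) (m `^ q)%:E)%E).
  rewrite integral_cst; last exact: mc.
  rewrite [X in (_ <= _ * X)%E](_ : _ = ((2 * d) ^+ n)%:E); last exact: lebesgue_row_cube.
  rewrite -EFinM lee_fin ler_wpM2l ?powR_ge0// lerXn2r ?nnegrE ?mulr_ge0//.
  by rewrite ler_peMl// ler1n.
apply: ge0_le_integral => //.
- by move=> x _; rewrite lee_fin powR_ge0.
- by apply: measurable_funTS.
- move=> x xd; rewrite lee_fin; apply: ge0_ler_powR; rewrite ?nnegrE ?modulus_ge0 ?(ltW q0)//.
  exact: fm.
Qed.

(** On the cube of half side [d = 1 - t] the solution is at least of the order of
    [d ^ (- n / 2 + 1 / p)], and the cube contributes [d ^ (n / q)]. For an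
    admissible pair [n / q - n / 2 = - 2 / p]. *)
Lemma solution_norm_ge (p q : R) : 0 < p -> 0 < q ->
  p^-1 + n%:R / 2 * q^-1 = n%:R / 4 -> exists2 c : R, 0 < c &
  forall t, 0 < t < 1 -> ((c * (1 - t) `^ (- p^-1))%:E <= Lq_norm q%:E (solution t))%E.
Proof.
move=> p0 q0 pq; have [c c0 hc] := profile_ge_power n p0.
exists c => // t /andP[t0 t1]; pose d := 1 - t.
have d0 : 0 < d by rewrite subr_gt0.
have d1 : d <= 1 by rewrite gerBl ltW.
apply: le_trans (@Lq_norm_ge_cube q (c * d `^ (- (n%:R / 2) + p^-1)) d _ q0 _ (ltW d0) _ _).
- rewrite lee_fin -/d -mulrA ler_wpM2l ?(ltW c0)// -powR_mulrn ?(ltW d0)//.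
  rewrite -powRrM -powRD ?(gt_eqF d0) ?implybT//.
  rewrite (_ : - (n%:R / 2) + p^-1 + n%:R / q = - p^-1)//.
  have -> : n%:R / 2 = 2 * (n%:R / 4) :> R by field.
  rewrite -pq; field; by rewrite !gt_eqF.
- by rewrite mulr_ge0 ?powR_ge0// ltW.
- by under eq_fun do rewrite modulus_solution; exact: measurable_wave.
- move=> x xd; rewrite modulus_solution; apply: le_trans (hc d d0 d1) _.
  have s0 : 0 < scale t by apply: scale_gt0; rewrite lt_eqF.
  apply: (profile_nonincreasing (exponent_ge R n2)).
    by rewrite ltr_pwDl// sqnorm_ge0.
  rewrite mulrDl mul1r addrC lerD2r.
  exact: sqnorm_cube.
Qed.

(** The power [p] of the lower bound is a multiple of [1 / (1 - t)]. *)
Lemma solution_not_in_LpLq (p q : R) : 0 < p -> 0 < q ->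
  p^-1 + n%:R / 2 * q^-1 = n%:R / 4 -> ~ in_LpLq 0 1 p%:E q%:E solution.
Proof.
move=> p0 q0 pq [_]; have [c c0 hc] := solution_norm_ge p0 q0 pq.
rewrite LpLq_norm_real; last exact: measurable_modulus_solution.
suff -> : (\int[mu]_(t in `]0%R, 1%R[) (Lq_norm q%:E (solution t) `^ p) = +oo)%E.
  by rewrite poweRyr// invr_neq0// gt_eqF.
apply/eqP; rewrite -leye_eq -(@integral_gap_inverse_infinite R (c `^ p) (powR_gt0 p c0)).
apply: integral_mono => t /=; rewrite in_itv/= => /andP[t0 t1].
  by rewrite lee_fin divr_ge0 ?powR_ge0// subr_ge0 ltW.
have d0 : 0 <= 1 - t by rewrite subr_ge0 ltW.
have -> : c `^ p / (1 - t) = (c * (1 - t) `^ (- p^-1)) `^ p.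
  rewrite powRM ?powR_ge0 ?(ltW c0)// -powRrM mulNr mulVf ?gt_eqF//.
  by rewrite powR_inv1.
rewrite -poweR_EFin; apply: gt0_ler_poweR; first exact: ltW.
- by rewrite in_itv/= leey andbT lee_fin mulr_ge0 ?powR_ge0// ltW.
- by rewrite in_itv/= leey andbT; exact: Lnorm_ge0.
- by apply: hc; rewrite t0.
Qed.

End blow_up.

(** If [q] were infinite, then [p = 4 / n] and [p >= 2] would leave only the pair
    that is excluded in dimension 2. *)
Lemma admissible_finite (R : realType) (n : nat) (p q : \bar R) :
  (2 <= n)%N -> admissible n p q -> (p < +oo)%E ->
  exists p0 q0 : R, [/\ p = p0%:E, q = q0%:E, 2 <= p0, 2 <= q0 &
    p0^-1 + n%:R / 2 * q0^-1 = n%:R / 4].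
Proof.
move=> n2 [pq p2 q2 N] poo.
case: p p2 poo pq N => [p0||]//; rewrite lee_fin => p2 _.
have p_gt0 : 0 < p0 by apply: lt_le_trans p2.
rewrite inver gt_eqF//.
case: q q2 => [q0||]//.
  rewrite lee_fin => q2; have q_gt0 : 0 < q0 by apply: lt_le_trans q2.
  rewrite inver gt_eqF// -EFinM -EFinD => -[pq] _.
  by exists p0, q0.
rewrite invey mule0 adde0 => _ [pE] []; have n0 : (0 < n)%N by apply: leq_trans n2.
have pn : p0 * n%:R = 4.
  have : p0 * p0^-1 = 1 by rewrite mulfV// gt_eqF.
  by rewrite pE => h; rewrite -[RHS]mulr1 -h; field.
have nR : (2 : R) <= n%:R by rewrite ler_nat.
have pE2 : p0 = 2.
  have ? : p0 * 2 <= 4 by rewrite -pn ler_wpM2l// ltW.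
  by lra.
split => //; last by rewrite pE2.
apply/eqP; rewrite -(eqr_nat R); apply/eqP; rewrite pE2 in pn; lra.
Qed.

Theorem proposition1p4 (R : realType) (n : nat)
    (U : R -> ('rV[R]_n -> R[i]) -> ('rV[R]_n -> R[i])) (r s : R) :
  (2 <= n)%N ->
  is_schrodinger_group U ->
  1 <= r ->
  n%:R / 2 < s < n%:R ->
  1 / (2 * r) + n%:R / (2 * s) > 1 ->
  exists V u : R -> 'rV[R]_n -> R[i],
    [/\ in_LpLq 0 1 r%:E s%:E V,
        in_C_L2 `[0, 1] u,
        mild_solution U V u &
        forall p q : \bar R, admissible n p q -> (p < +oo)%E ->
          (forall T : R, 0 < T < 1 -> in_LpLq 0 T p q u) /\
          ~ in_LpLq 0 1 p q u].
Proof.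
move=> n2 HU r1 /andP[s1 _] rs; exists (@potential R n), (@solution R n); split.
- exact: potential_in_LrLs.
- exact: solution_continuous.
- exact: solution_mild.
move=> p q pq poo; have [p0 [q0 [-> -> p2 q2 e]]] := admissible_finite n2 pq poo.
have p0' : 0 < p0 by apply: lt_le_trans p2.
have q0' : 0 < q0 by apply: lt_le_trans q2.
by split; [move=> T; exact: solution_in_LpLq|exact: solution_not_in_LpLq].
Qed.
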